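(* Let $\varepsilon>0$ be (arbitrarily) small. Let $M,T,N\geqslant 1$ satisfy $N^{\varepsilon}\leqslant M\leqslant T<N$. Let $\mathcal{A}=\{a_n\}$ be a real sequence with $a_n=0$ unless $N<n\leqslant 2N$. Then $$T(\mathcal{A})=\frac{2}{\sqrt{\pi}}\varSigma(\mathcal{A})+O\big(N^{1+\varepsilon}\|\mathcal{A}\|^2\big),$$ where the implied constant depends only on $\varepsilon$.
   Context: Write $e(x)=\exp(2\pi i x)$ and $\|\mathcal{A}\|^2=\sum_{N<n\leqslant 2N}a_n^2$. Define the weight $$h(t)=\exp\Big(-\frac{(t-T)^2}{M^2}\Big)+\exp\Big(-\frac{(t+T)^2}{M^2}\Big)$$ and the Eisenstein contribution $$T(\mathcal{A})=\frac1\pi\int_{-\infty}^\infty\frac{h(t)}{|\zeta(1+2it)|^2}\bigg|\sum_{N<n\leqslant 2N}a_n\sigma_{2it}(n)\bigg|^2\,dt,\qquad \sigma_\nu(n)=\sum_{d\mid n}d^\nu.$$ Define the bilinear form $$\varSigma(\mathcal{A})=M\sum_{m}\sum_{n}a_ma_n\,\sigma(m,n),\qquad \sigma(m,n)=\sum_{c=1}^\infty\frac{S(m,0;c)S(n,0;c)}{c^2},$$ where $S(m,0;c)=\sum_{\alpha\bmod c,\,(\alpha,c)=1}e(\alpha m/c)$ is the Ramanujan sum. (The notation $T(\mathcal A)$ is unrelated to the real parameter $T$.) *)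

(* Defs.v *)
From HB Require Import structures.
From mathcomp Require Import all_boot all_order all_algebra.
From mathcomp Require Import all_classical all_reals all_analysis.
From mathcomp Require Import complex.

Set Implicit Arguments.
Unset Strict Implicit.
Unset Printing Implicit Defensive.

Import Order.TTheory GRing.Theory Num.Theory.
Import numFieldNormedType.Exports.
Import ComplexField.

Local Open Scope classical_set_scope.
Local Open Scope ring_scope.
Local Open Scope complex_scope.

Section Definitions.
Variable R : realType.
Implicit Types (a : nat -> R) (N M T : R) (s : R[i]) (m n c : nat).

Definition cexp (z : R[i]) : R[i] :=
  (expR (complex.Re z))%:C * (cos (complex.Im z) +i* sin (complex.Im z)).

Definition e (x : R) : R[i] := cexp (0 +i* (2 * pi * x)).

(* n ^ s = exp (s log n); only meaningful for n > 0. *)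
Definition natpow n s : R[i] := cexp (s * (ln n%:R)%:C).

Definition limC (u : nat -> R[i]) : R[i] :=
  limn (fun k => complex.Re (u k)) +i* limn (fun k => complex.Im (u k)).

(* The Riemann zeta function in Re s > 0, s != 1: there it is
   lim_K (\sum_(1 <= k <= K) k^-s - K^(1-s) / (1-s)), locally uniformly in s.
   For Re s > 1 the second term tends to 0 and this is the Dirichlet series
   (zeta_dirichlet below). On Re s = 1 the series itself diverges. At the pole
   s = 1 the value is a meaningless default. *)
Definition zeta s : R[i] :=
  limC (fun K => \sum_(1 <= k < K.+1) natpow k (- s)
                 - natpow K (1 - s) / (1 - s)).

Definition divsigma s n : R[i] := \sum_(d <- divisors n) natpow d s.

(* The integers n with N < n <= 2N, N being real. *)
Definition dyadic N : seq nat :=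
  [seq n <- iota 0 (Num.truncn (2 * N)).+1 | N < n%:R <= 2 * N].

Definition normsq a N : R := \sum_(n <- dyadic N) a n ^+ 2.

Definition h T M (t : R) : R :=
  expR (- ((t - T) ^+ 2 / M ^+ 2)) + expR (- ((t + T) ^+ 2 / M ^+ 2)).

(* The integrand is nonnegative; with values in \bar R, any finite bound on
   this quantity includes the convergence of the integral. *)
Definition eisenstein a N T M : \bar R :=
  ((pi^-1)%:E * \int[lebesgue_measure]_(t in [set: R])
    (h T M t / ComplexField.Normc.normc (zeta (1 +i* (2 * t))) ^+ 2
     * ComplexField.Normc.normc (\sum_(n <- dyadic N)
                (a n)%:C * divsigma (0 +i* (2 * t)) n) ^+ 2)%:E)%E.

(* S(m,0;c); the sum is real, see ramanujan_sumE. *)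
Definition ramanujan_sum m c : R :=
  complex.Re (\sum_(0 <= al < c | coprime al c) e (al%:R * m%:R / c%:R)).

Definition sigma_bil m n : R :=
  \big[+%R/0]_(1 <= c <oo)
    (ramanujan_sum m c * ramanujan_sum n c / c%:R ^+ 2).

Definition Sigma_form a N M : R :=
  M * \sum_(m <- dyadic N) \sum_(n <- dyadic N) a m * a n * sigma_bil m n.

Lemma mem_dyadic N n : (n \in dyadic N) = (N < n%:R <= 2 * N).
Proof.
rewrite mem_filter mem_iota /= add0n ltnS.
have [/andP[_ hn]|//] := boolP (N < n%:R <= 2 * N).
rewrite /= truncn_ge_nat //; exact: le_trans hn.
Qed.

Let sinD2pin m (x : R) : sin (x + 2 * pi * m%:R) = sin x.
Proof. by rewrite mulr_natr mulr_natl (periodicn (@sinD2pi R)). Qed.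

Lemma ramanujan_sumE m c :
  (ramanujan_sum m c)%:C
  = \sum_(0 <= al < c | coprime al c) e (al%:R * m%:R / c%:R).
Proof.
rewrite /ramanujan_sum; set S := (X in complex.Re X).
suff ImS : complex.Im S = 0 by rewrite [RHS]complexE ImS mulr0 addr0.
case: c @S => [|c] S; first by rewrite /S big_geq.
have ImD : {morph @complex.Im R : x y / x + y} by case=> ? ? [].
rewrite /S (big_morph _ ImD (erefl : complex.Im (0 : R[i]) = 0)) /=.
under eq_bigr do rewrite expR0 mul1r mul0r addr0.
rewrite big_ltn_cond // mul0r mul0r mulr0 sin0 add0r if_same.
set B := (X in X = _).
suff : B = - B by move/eqP; rewrite -addr_eq0 -mulr2n mulrn_eq0 => /eqP.
rewrite {1}/B big_nat_rev -sumrN big_nat_cond [RHS]big_nat_cond.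
have c0 : c.+1%:R != 0 :> R by rewrite pnatr_eq0.
apply: eq_big => [i|i /andP[/andP[i1 ic] _]].
  have [/andP[i1 ic]|//] := boolP (1 <= i < c.+1)%N.
  have k := subnKC (ltnW ic).
  by rewrite add1n subSS /coprime -{2 3}k gcdnDr gcdnDl gcdnC.
rewrite add1n subSS natrB ?(ltnW ic) // -sinN -(sinD2pin m (- _)).
congr sin; rewrite -mulrN -mulrDr; congr (_ * _).
by rewrite mulrBl mulrBl [RHS]addrC mulrAC divff ?mul1r.
Qed.

Let normc_natpow n s :
  ComplexField.Normc.normc (natpow n s) = expR (complex.Re s * ln n%:R).
Proof.
rewrite /natpow /cexp ComplexField.Normc.normcM /=.
rewrite expr0n addr0 sqrtr_sqr ger0_norm ?expR_ge0 // cos2Dsin2 sqrtr1 mulr1.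
by case: s => x y /=; rewrite mulr0 subr0.
Qed.

Lemma zeta_dirichlet s : 1 < complex.Re s ->
  zeta s = limC (fun K => \sum_(1 <= k < K.+1) natpow k (- s)).
Proof.
move=> s1; pose v K := natpow K (1 - s) / (1 - s).
have nv0 : ComplexField.Normc.normc (v K) @[K --> \oo] --> (0 : R).
  have lny : (ln k%:R : R) @[k --> \oo] --> +oo.
    apply/cvgryPge => A; near=> k.
    have k0 : (0 < k)%N by near: k; exact: nbhs_infty_gt.
    rewrite -(expRK A) ler_ln ?posrE ?expR_gt0 ?ltr0n //.
    by near: k; exact: nbhs_infty_ger.
  rewrite -(mul0r (ComplexField.Normc.normc (1 - s)^-1)).
  under eq_fun do rewrite ComplexField.Normc.normcM normc_natpow.
  apply: cvgMr_tmp; have -> : complex.Re (1 - s) = - (complex.Re s - 1).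
    by case: (s) => x y /=; rewrite opprB.
  under eq_fun do rewrite mulNr.
  have : (complex.Re s - 1) * ln k%:R @[k --> \oo] --> +oo.
    apply: (cvg_comp (fun k => ln k%:R) ( *%R (complex.Re s - 1)) lny).
    by apply: gt0_cvgMry; [rewrite subr_gt0|exact: cvg_id].
  move=> H; exact: (cvg_comp _ (fun x => expR (- x)) H (@cvgr_expR R)).
have normRe z : `|complex.Re z| <= ComplexField.Normc.normc z.
  by case: z => x y /=; rewrite -sqrtr_sqr; apply: ler_wsqrtr; rewrite lerDl sqr_ge0.
have normIm z : `|complex.Im z| <= ComplexField.Normc.normc z.
  by case: z => x y /=; rewrite -sqrtr_sqr; apply: ler_wsqrtr; rewrite lerDr sqr_ge0.
have limB (u w : R^nat) : w @ \oo --> (0 : R) ->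
    limn (fun k => u k - w k) = limn u.
  move=> w0; congr (get _); apply/funext => l; apply/propext; split => ul.
    rewrite -(addr0 l) (_ : u = fun k => u k - w k + w k).
      exact: cvgD.
    by apply/funext => k; rewrite subrK.
  by rewrite -(subr0 l); exact: cvgB.
have ReB : {morph @complex.Re R : x y / x - y} by case=> ? ? [].
have ImB : {morph @complex.Im R : x y / x - y} by case=> ? ? [].
rewrite /zeta /limC; congr (_ +i* _).
- under eq_fun do rewrite ReB.
  apply: limB; apply: norm_cvg0.
  apply: (squeeze_cvgr _ (cvg_cst 0) nv0); near=> k.
  by rewrite normr_ge0 normRe.
- under eq_fun do rewrite ImB.
  apply: limB; apply: norm_cvg0.
  apply: (squeeze_cvgr _ (cvg_cst 0) nv0); near=> k.
  by rewrite normr_ge0 normIm.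
Unshelve. all: by end_near.
Qed.

End Definitions.

(* Main.v *)
Require Import Defs.
From mathcomp Require Import all_boot all_order all_algebra.
From mathcomp Require Import all_classical all_reals all_analysis.
From mathcomp Require Import measurable_realfun complex ring lra.

(* Writing b_d for the sum of the a_n with d | n, the sum of a_n sigma_{2it}(n)
   is the Dirichlet polynomial of the b_d d^{2it}. Near the line Re s = 1 the
   3-4-1 inequality bounds 1 / zeta polynomially in log |t|, and likewise its
   finite differences with a small step d. Extrapolating from the points
   1 + it + jd, 1 <= j <= J, where the Moebius series converges absolutely,
   replaces 1 / zeta(1 + it) by the sum of mu(k) w(k) k^{-1-it} over k <= X,
   w(k) = 1 - (1 - k^{-d})^J, at the cost of O(d^J (1 + |t|)^kappa) in the square
   of its modulus; here d = N^{-kappa} with J kappa >= 1, so that d^J M <= 1. The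
   integrand becomes h(t) |sum_c x_c c^{2it}|^2 with
   c x_c = sum_{d | c} d b_d (mu w)(c/d), and since the Fourier transform of h
   decays like exp (- M^2 log^2 (c/c')), integrating term by term leaves the
   diagonal 2 sqrt(pi) M sum_c x_c^2 up to O(sum_c c x_c^2).
   On the other side the formula for Ramanujan sums turns sum_n a_n S(n,0;c) into
   the same expression c x_c with w = 1. The errors are controlled by
   b_d^2 <= (2N / d) sum_{d | n} a_n^2 and the divisor bound. *)

Set Implicit Arguments.
Unset Strict Implicit.
Unset Printing Implicit Defensive.

Import Order.TTheory GRing.Theory Num.Theory.
Import numFieldNormedType.Exports.

Local Open Scope classical_set_scope.
Local Open Scope ring_scope.
Local Open Scope complex_scope.

Local Notation nc := ComplexField.Normc.normc.
Local Notation Re := complex.Re.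
Local Notation Im := complex.Im.

(** * Complex powers and limits *)

(** The weight h has mass 2 sqrt(pi) M, with M possibly close to N, so 1 / |zeta|^2 must be
    approximated on Re s = 1 with an error that saves a factor M. Known zero-free regions do not
    give this for a sharply truncated Moebius sum. Extrapolation does: a J-th difference with step d
    is O(d^J) up to logarithms, a large power saving from a step that is itself only a small
    negative power of N. The price is a weight w decaying no faster than k^{-d}, hence factors (1 +
    1/d)^2, which are admissible powers of N. For the tail X^{-d} / d to be small, X must grow
    faster than any power of N; this is harmless, since all coefficient bounds are uniform in X, and
    since the Gaussian integral is explicit: c and c' interact essentially for |c - c'| of order c /
    M, whatever the length of the polynomial. Differences in place of derivatives keep the argument
    in Re s >= 1, where zeta is reached through its partial sums, without contours or Cauchy
    estimates. *)

Lemma eqW (R : numDomainType) (x y : R) : x = y -> x <= y.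
Proof. by move=> ->. Qed.

Section ComplexNorm.
Variable R : realType.
Implicit Types (x y : R) (z w s : R[i]) (u : nat -> R[i]).

Lemma nc_sqr z : nc z ^+ 2 = Re z ^+ 2 + Im z ^+ 2.
Proof. by case: z => x y /=; rewrite sqr_sqrtr // addr_ge0 ?sqr_ge0. Qed.

Lemma nc_ge0 z : 0 <= nc z.
Proof. by case: z => x y /=; exact: sqrtr_ge0. Qed.

Lemma nc_real x : nc x%:C = `|x|.
Proof. by rewrite /= expr0n addr0 sqrtr_sqr. Qed.

Lemma ncM z w : nc (z * w) = nc z * nc w.
Proof. exact: ComplexField.Normc.normcM. Qed.

Lemma ncV z : nc z^-1 = (nc z)^-1.
Proof. exact: ComplexField.Normc.normcV. Qed.

Lemma ncN z : nc (- z) = nc z.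
Proof. by case: z => x y /=; rewrite !sqrrN. Qed.

Lemma nc0 : nc (0 : R[i]) = 0.
Proof. exact: ComplexField.Normc.normc0. Qed.

Lemma nc1 : nc (1 : R[i]) = 1.
Proof. exact: ComplexField.Normc.normc1. Qed.

Lemma ncD z w : nc (z + w) <= nc z + nc w.
Proof.
rewrite -lecR rmorphD /=.
have E (v : R[i]) : (nc v)%:C = `|v| by rewrite normc_def; case: v.
by rewrite !E ler_normD.
Qed.

Lemma ncB z w : nc (z - w) <= nc z + nc w.
Proof. by rewrite -(ncN w) ncD. Qed.

Lemma ncBC z w : nc (z - w) = nc (w - z).
Proof. by rewrite -ncN opprB. Qed.

Lemma nc_leB z w : nc z - nc w <= nc (z - w).
Proof. by rewrite lerBlDr; have := ncD (z - w) w; rewrite subrK. Qed.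

Lemma nc_eq0 z : (nc z == 0) = (z == 0).
Proof.
apply/eqP/eqP => [|->]; last exact: nc0.
exact: ComplexField.Normc.eq0_normc.
Qed.

Lemma nc_gt0 z : (0 < nc z) = (z != 0).
Proof. by rewrite lt_def nc_eq0 nc_ge0 andbT. Qed.

Lemma ncX z n : nc (z ^+ n) = nc z ^+ n.
Proof. by elim: n => [|n IH]; rewrite ?expr0 ?nc1 // !exprS ncM IH. Qed.

Lemma nc_sum (I : Type) (r : seq I) (P : pred I) (f : I -> R[i]) :
  nc (\sum_(i <- r | P i) f i) <= \sum_(i <- r | P i) nc (f i).
Proof.
elim/big_rec2: _ => [|i y z _ IH]; first by rewrite nc0.
exact: le_trans (ncD _ _) (lerD _ _).
Qed.

Lemma nc_ge_Re z : `|Re z| <= nc z.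
Proof.
case: z => x y /=; rewrite -[leLHS]sqrtr_sqr; apply: ler_wsqrtr.
by rewrite lerDl sqr_ge0.
Qed.

Lemma nc_ge_Im z : `|Im z| <= nc z.
Proof.
case: z => x y /=; rewrite -[leLHS]sqrtr_sqr; apply: ler_wsqrtr.
by rewrite lerDr sqr_ge0.
Qed.

Lemma nc_leReIm z : nc z <= `|Re z| + `|Im z|.
Proof.
rewrite -(ler_pXn2r (_ : 0 < 2)%N) ?nnegrE ?nc_ge0 ?addr_ge0 //.
rewrite nc_sqr sqrrD !real_normK ?num_real //.
by rewrite lerD2r lerDl mulrn_wge0 // mulr_ge0.
Qed.

Lemma cReD z w : Re (z + w) = Re z + Re w. Proof. by case: z; case: w. Qed.
Lemma cImD z w : Im (z + w) = Im z + Im w. Proof. by case: z; case: w. Qed.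
Lemma cReN z : Re (- z) = - Re z. Proof. by case: z. Qed.
Lemma cImN z : Im (- z) = - Im z. Proof. by case: z. Qed.
Lemma cReB z w : Re (z - w) = Re z - Re w. Proof. by rewrite cReD cReN. Qed.
Lemma cImB z w : Im (z - w) = Im z - Im w. Proof. by rewrite cImD cImN. Qed.
Lemma cReMr x z : Re (x%:C * z) = x * Re z.
Proof. by case: z => a b /=; rewrite mul0r subr0. Qed.
Lemma cImMr x z : Im (x%:C * z) = x * Im z.
Proof. by case: z => a b /=; rewrite mul0r addr0. Qed.

Lemma cRe_sum (I : Type) (r : seq I) (P : pred I) (f : I -> R[i]) :
  Re (\sum_(i <- r | P i) f i) = \sum_(i <- r | P i) Re (f i).
Proof. exact: (big_morph _ cReD). Qed.

Lemma cIm_sum (I : Type) (r : seq I) (P : pred I) (f : I -> R[i]) :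
  Im (\sum_(i <- r | P i) f i) = \sum_(i <- r | P i) Im (f i).
Proof. exact: (big_morph _ cImD). Qed.

Lemma cexpD z w : cexp (z + w) = cexp z * cexp w.
Proof.
case: z => a b; case: w => c d; rewrite /cexp /= expRD cosD sinD.
by apply/eqP; rewrite eq_complex /=; apply/andP; split; apply/eqP; ring.
Qed.

Lemma nc_cexp z : nc (cexp z) = expR (Re z).
Proof.
by rewrite /cexp ncM nc_real ger0_norm ?expR_ge0 //= cos2Dsin2 sqrtr1 mulr1.
Qed.

Lemma cexp_real x : cexp x%:C = (expR x)%:C.
Proof. by rewrite /cexp /= cos0 sin0 mulr1. Qed.

Lemma cexp0 : cexp 0 = 1 :> R[i].
Proof. by rewrite (cexp_real 0) expR0. Qed.

End ComplexNorm.

(** * Powers of a real base and convergence of complex sequences *)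

Section ComplexPower.
Variable R : realType.
Implicit Types (x y : R) (z w s : R[i]) (u : nat -> R[i]).

(** The base is real so that one can differentiate in it; at a natural number [cpow] is convertible
    to [natpow]. *)
Definition cpow x s : R[i] := cexp (s * (ln x)%:C).

Lemma cpowD x s w : cpow x (s + w) = cpow x s * cpow x w.
Proof. by rewrite /cpow mulrDl cexpD. Qed.

Lemma cpow0 x : cpow x 0 = 1.
Proof. by rewrite /cpow mul0r cexp0. Qed.

Lemma cpow1x s : cpow 1 s = 1.
Proof. by rewrite /cpow ln1 mulr0 cexp0. Qed.

Lemma nc_cpow x s : nc (cpow x s) = expR (Re s * ln x).
Proof. by rewrite /cpow nc_cexp mulrC cReMr mulrC. Qed.

Lemma cpow_real x (r : R) : 0 < x -> cpow x r%:C = (x `^ r)%:C.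
Proof. by move=> x0; rewrite /cpow -rmorphM /= cexp_real /powR gt_eqF. Qed.

Lemma cpow_r1 x : 0 < x -> cpow x 1 = x%:C.
Proof. by move=> x0; rewrite (cpow_real 1 x0) powRr1 // ltW. Qed.

Lemma cpowN x s : cpow x (- s) * cpow x s = 1.
Proof. by rewrite -cpowD addNr cpow0. Qed.

Lemma cpow_neq0 x s : cpow x s != 0.
Proof. by rewrite -nc_eq0 nc_cpow gt_eqF ?expR_gt0. Qed.

Lemma cpowNV x s : cpow x (- s) = (cpow x s)^-1.
Proof. by apply: (mulIf (cpow_neq0 x s)); rewrite cpowN mulVf ?cpow_neq0. Qed.

Lemma cpowM x y s : 0 < x -> 0 < y -> cpow (x * y) s = cpow x s * cpow y s.
Proof. by move=> x0 y0; rewrite /cpow lnM ?posrE // rmorphD mulrDr cexpD. Qed.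

Lemma nc_cpow_powR x s : 0 < x -> nc (cpow x s) = x `^ Re s.
Proof. by move=> x0; rewrite nc_cpow /powR gt_eqF. Qed.

Lemma cvg_dist_le (f g : nat -> R) (l : R) :
  (\forall k \near \oo, `|f k - l| <= g k) -> g k @[k --> \oo] --> (0 : R) ->
  f k @[k --> \oo] --> l.
Proof.
move=> h g0; apply: (@squeeze_cvgr _ _ _ _ (fun k => l - g k) (fun k => l + g k)).
- near=> k; rewrite -ler_distlC distrC; near: k; exact: h.
- by rewrite -[X in _ --> X]subr0; apply: cvgB => //; exact: cvg_cst.
- by rewrite -[X in _ --> X]addr0; apply: cvgD => //; exact: cvg_cst.
Unshelve. all: by end_near.
Qed.

Lemma cvg_dist0 (f : nat -> R) (l : R) :
  f k @[k --> \oo] --> l -> `|f k - l| @[k --> \oo] --> (0 : R).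
Proof.
move=> fl; rewrite -[X in _ --> X](@normr0 _ R^o) -(subrr l).
by apply: cvg_norm; apply: cvgB => //; exact: cvg_cst.
Qed.

(** Convergence measured by the modulus, so that every complex limit reduces to a real null
    sequence. *)
Definition ccvg u w := nc (u k - w) @[k --> \oo] --> (0 : R).

Lemma ccvg_le u w (v : nat -> R) :
  (\forall k \near \oo, nc (u k - w) <= v k) -> v k @[k --> \oo] --> (0 : R) ->
  ccvg u w.
Proof.
move=> h v0; apply: (squeeze_cvgr _ (cvg_cst 0) v0).
by near do rewrite nc_ge0 /=.
Unshelve. all: by end_near.
Qed.

Lemma ccvg_Re u w : ccvg u w -> Re (u k) @[k --> \oo] --> Re w.
Proof.
by apply: cvg_dist_le; apply: nearW => k; rewrite -cReB nc_ge_Re.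
Unshelve. all: by end_near.
Qed.

Lemma ccvg_Im u w : ccvg u w -> Im (u k) @[k --> \oo] --> Im w.
Proof.
by apply: cvg_dist_le; apply: nearW => k; rewrite -cImB nc_ge_Im.
Unshelve. all: by end_near.
Qed.

Lemma ccvg_ReIm u w : Re (u k) @[k --> \oo] --> Re w ->
  Im (u k) @[k --> \oo] --> Im w -> ccvg u w.
Proof.
move=> hr hi; apply: (@ccvg_le _ _ (fun k => `|Re (u k) - Re w| + `|Im (u k) - Im w|)).
  by near=> k; rewrite -cReB -cImB nc_leReIm.
rewrite -[X in _ --> X]addr0.
by apply: cvgD; exact: cvg_dist0.
Unshelve. all: by end_near.
Qed.

Lemma ccvg_limC u w : ccvg u w -> limC u = w.
Proof.
move=> h; rewrite /limC (cvg_lim _ (ccvg_Re h)) // (cvg_lim _ (ccvg_Im h)) //.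
by case: (w).
Qed.

Lemma ccvgD u v w w' : ccvg u w -> ccvg v w' -> ccvg (fun k => u k + v k) (w + w').
Proof.
move=> h h'; apply: (@ccvg_le _ _ (fun k => nc (u k - w) + nc (v k - w'))).
  by near=> k; rewrite opprD addrACA ncD.
by rewrite -[X in _ --> X]addr0; exact: cvgD.
Unshelve. all: by end_near.
Qed.

Lemma ccvgN u w : ccvg u w -> ccvg (fun k => - u k) (- w).
Proof.
move=> h; apply: (@ccvg_le _ _ (fun k => nc (u k - w))) => //.
by near=> k; rewrite -opprD ncN.
Unshelve. all: by end_near.
Qed.

Lemma ccvgB u v w w' : ccvg u w -> ccvg v w' -> ccvg (fun k => u k - v k) (w - w').
Proof. by move=> h /ccvgN; exact: ccvgD. Qed.

Lemma ccvgZ u w z : ccvg u w -> ccvg (fun k => z * u k) (z * w).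
Proof.
move=> h; apply: (@ccvg_le _ _ (fun k => nc z * nc (u k - w))).
  by near=> k; rewrite -mulrBr ncM.
by rewrite -(mulr0 (nc z)); apply: cvgM => //; exact: cvg_cst.
Unshelve. all: by end_near.
Qed.

Lemma ccvg_uniq u w w' : ccvg u w -> ccvg u w' -> w = w'.
Proof. by move=> /ccvg_limC <- /ccvg_limC <-. Qed.

Lemma ccvg_nc_le u w (b : R) : ccvg u w ->
  (\forall k \near \oo, nc (u k) <= b) -> nc w <= b.
Proof.
move=> h hb.
have h2 : (fun k => b + nc (u k - w)) @ \oo --> (b + 0 : R).
  by apply: cvgD => //; exact: cvg_cst.
rewrite -(addr0 b); apply: (ler_cvg_to (cvg_cst (nc w)) h2).
near=> k; have kb : nc (u k) <= b by near: k.
apply: le_trans (lerD kb (lexx _)); rewrite ncBC -lerBlDl.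
by rewrite (le_trans (nc_leB _ _)).
Unshelve. all: by end_near.
Qed.

(** Steps dominated by the decrements of a null sequence give existence of the limit and its rate at
    once. All the series below (zeta, Dirichlet series, the series [sigma_bil]) are fed through this
    lemma. *)
Lemma ccvg_telescope u (v : nat -> R) n0 :
  (forall n, (n0 <= n)%N -> nc (u n.+1 - u n) <= v n - v n.+1) ->
  v k @[k --> \oo] --> (0 : R) ->
  exists2 w, ccvg u w & forall n, (n0 <= n)%N -> nc (w - u n) <= v n.
Proof.
move=> h v0.
have step n m : (n0 <= n)%N -> nc (u (n + m)%N - u n) <= v n - v (n + m)%N.
  move=> n0n; elim: m => [|m IH]; first by rewrite addn0 !subrr nc0.
  rewrite addnS; have := h (n + m)%N (leq_trans n0n (leq_addr _ _)).
  move=> h1; have -> : u (n + m).+1 - u n = (u (n + m).+1 - u (n + m)%N) + (u (n + m)%N - u n).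
    by rewrite addrA subrK.
  apply: le_trans (ncD _ _) _; apply: le_trans (lerD h1 IH) _.
  by rewrite addrC addrA subrK.
have vnonneg n : (n0 <= n)%N -> 0 <= v n.
  move=> n0n; have : (fun k => v n - v k) @ \oo --> (v n - 0 : R).
    by apply: cvgB => //; exact: cvg_cst.
  move=> hh; rewrite -(subr0 (v n)); apply: (ler_cvg_to (cvg_cst 0) hh).
  near=> k; have nk : (n <= k)%N by near: k; exact: nbhs_infty_ge.
  by rewrite -(subnKC nk); apply: le_trans (step _ (k - n)%N n0n); exact: nc_ge0.
have cauchy_cvg (f : R[i] -> R) : (forall z w, `|f z - f w| <= nc (z - w)) ->
    cvgn (fun k => f (u k)).
  move=> fl; apply/cauchy_cvgP/cauchy_exP => e e0.
  have [N _ hN] : \forall k \near \oo, v k < e.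
    move/cvgr0_norm_lt : v0 => /(_ _ e0); apply: filterS => k.
    exact: le_lt_trans (ler_norm _).
  pose m := maxn n0 N; exists (f (u m)); exists m => // k /= mk.
  rewrite /ball /= distrC; apply: le_lt_trans (fl _ _) _.
  rewrite -(subnKC mk); have n0m : (n0 <= m)%N by exact: leq_maxl.
  apply: le_lt_trans (step _ _ n0m) _.
  apply: le_lt_trans (hN m (leq_maxr _ _)).
  by rewrite gerBl vnonneg // (leq_trans n0m) // leq_addr.
have [] : cvgn (fun k => Re (u k)) /\ cvgn (fun k => Im (u k)).
  by split; apply: cauchy_cvg => z w; rewrite -?cReB -?cImB ?nc_ge_Re ?nc_ge_Im.
move=> /cvg_ex[a /= ha] /cvg_ex[b /= hb].
have cv : ccvg u (a +i* b) by exact: ccvg_ReIm.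
exists (a +i* b) => // n n0n.
have cc : ccvg (fun k => u k - u n) (a +i* b - u n).
  apply: ccvgB => //; apply: (@ccvg_le _ _ (fun=> 0)); last exact: cvg_cst.
  by apply: nearW => k; rewrite subrr nc0.
apply: (ccvg_nc_le cc); near=> k.
have nk : (n <= k)%N by near: k; exact: nbhs_infty_ge.
rewrite -(subnKC nk); apply: le_trans (step _ _ n0n) _.
by rewrite gerBl vnonneg // (leq_trans n0n) // leq_addr.
Unshelve. all: by end_near.
Qed.

Lemma cvg_natpowN (b : R) : 0 < b -> n%:R `^ (- b) @[n --> \oo] --> (0 : R).
Proof.
move=> b0; apply/cvgrPdist_lt => e e0; near=> n.
rewrite sub0r normrN ger0_norm ?powR_ge0 //.
have n0 : (0 : R) < n%:R by rewrite ltr0n; near: n; exact: nbhs_infty_gt.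
have en : e `^ (- b^-1) < n%:R by near: n; exact: nbhs_infty_gtr.
rewrite powRN invf_plt ?posrE ?powR_gt0 //.
have -> : e^-1 = (e `^ (- b^-1)) `^ b.
  by rewrite -powRrM mulNr mulVf ?gt_eqF // powR_inv1 // ltW.
by rewrite gt0_ltr_powR // nnegrE ?powR_ge0 // ltW.
Unshelve. all: by end_near.
Qed.

End ComplexPower.

(** * Arithmetic functions *)

Section Divisors.
Local Open Scope nat_scope.

Lemma perm_divisors_iota c Y : 0 < c <= Y ->
  perm_eq (divisors c) [seq d <- index_iota 1 Y.+1 | d %| c].
Proof.
case/andP=> c0 cY; apply: uniq_perm.
- exact: divisors_uniq.
- exact/filter_uniq/iota_uniq.
move=> d; rewrite -dvdn_divisors // mem_filter mem_index_iota.
case dc: (d %| c) => //=; rewrite (dvdn_gt0 c0 dc) /=.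
by rewrite ltnS (leq_trans (dvdn_leq c0 dc) cY).
Qed.

Lemma perm_divisors_div c : 0 < c ->
  perm_eq (divisors c) [seq c %/ d | d <- divisors c].
Proof.
move=> c0; apply: uniq_perm.
- exact: divisors_uniq.
- rewrite map_inj_in_uniq ?divisors_uniq // => x y.
  rewrite -!dvdn_divisors // => xc yc h.
  have : c %/ (c %/ x) = c %/ (c %/ y) by rewrite h.
  by rewrite !divnA // !mulKn.
move=> d; rewrite -dvdn_divisors //; apply/idP/mapP => [dc|[x]].
  exists (c %/ d); first by rewrite -dvdn_divisors // dvdn_div.
  by rewrite divnA // mulKn.
by rewrite -dvdn_divisors // => xc ->; rewrite dvdn_div.
Qed.

Lemma perm_multiples_divisors p n : 0 < n -> 0 < p -> p %| n ->
  perm_eq [seq d <- divisors n | p %| d] [seq p * d | d <- divisors (n %/ p)].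
Proof.
move=> n0 p0 pn.
have np0 : 0 < n %/ p by rewrite divn_gt0 // dvdn_leq.
apply: uniq_perm.
- exact/filter_uniq/divisors_uniq.
- rewrite map_inj_uniq ?divisors_uniq // => x y /eqP.
  by rewrite eqn_pmul2l // => /eqP.
move=> d; rewrite mem_filter -dvdn_divisors //.
apply/andP/mapP => [[pd dn]|[x]].
  exists (d %/ p); last by rewrite mulnC divnK.
  by rewrite -dvdn_divisors // dvdn_divRL // divnK.
rewrite -dvdn_divisors // => xn ->; rewrite dvdn_mulr //.
by rewrite mulnC -dvdn_divRL.
Qed.

Lemma perm_multiples_iota d Y : 0 < d ->
  perm_eq [seq c <- index_iota 1 Y.+1 | d %| c]
          [seq d * k | k <- [seq k <- index_iota 1 Y.+1 | d * k <= Y]].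
Proof.
move=> d0; apply: uniq_perm.
- exact/filter_uniq/iota_uniq.
- rewrite map_inj_uniq ?filter_uniq ?iota_uniq // => x y /eqP.
  by rewrite eqn_pmul2l // => /eqP.
move=> c; rewrite mem_filter mem_index_iota ltnS.
apply/and3P/mapP => [[dc c0 cY]|[k]].
  have e : d * (c %/ d) = c by rewrite mulnC divnK.
  exists (c %/ d) => //; rewrite mem_filter mem_index_iota e cY /= ltnS.
  by rewrite divn_gt0 // dvdn_leq //= (leq_trans (leq_div _ _)).
rewrite mem_filter mem_index_iota => /andP[dk /andP[k0 _]] ->.
by rewrite dvdn_mulr // muln_gt0 d0 k0.
Qed.

Lemma perm_multiples_iota0 d c : 0 < d -> d %| c ->
  perm_eq [seq a <- index_iota 0 c | d %| a]
          [seq d * k | k <- index_iota 0 (c %/ d)].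
Proof.
move=> d0 dc; apply: uniq_perm.
- exact/filter_uniq/iota_uniq.
- rewrite map_inj_uniq ?iota_uniq // => x y /eqP.
  by rewrite eqn_pmul2l // => /eqP.
move=> a; rewrite mem_filter mem_index_iota /=.
apply/andP/mapP => [[da ac]|[k]].
  exists (a %/ d); last by rewrite mulnC divnK.
  by rewrite mem_index_iota /= ltn_divRL // divnK.
rewrite mem_index_iota /= => kc ->; rewrite dvdn_mulr //.
by split => //; rewrite mulnC -ltn_divRL.
Qed.

Lemma perm_gcd_divisors a c : 0 < c ->
  perm_eq (divisors (gcdn a c)) [seq d <- divisors c | d %| a].
Proof.
move=> c0; have g0 : 0 < gcdn a c by rewrite gcdn_gt0 c0 orbT.
apply: uniq_perm; rewrite ?filter_uniq ?divisors_uniq // => d.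
by rewrite mem_filter -!dvdn_divisors // dvdn_gcd.
Qed.

Lemma sum_divisors_iota (V : nmodType) c Y (F : nat -> V) : 0 < c <= Y ->
  (\sum_(d <- divisors c) F d = \sum_(1 <= d < Y.+1 | (d %| c)%N) F d)%R.
Proof. by move=> h; rewrite (perm_big _ (perm_divisors_iota h)) big_filter. Qed.

Lemma sum_divisors_div (V : nmodType) c (F : nat -> nat -> V) : 0 < c ->
  (\sum_(d <- divisors c) F d (c %/ d)%N = \sum_(d <- divisors c) F (c %/ d)%N d)%R.
Proof.
move=> c0; rewrite (perm_big _ (perm_divisors_div c0)) big_map !big_seq.
apply: eq_bigr => d; rewrite -dvdn_divisors // => dc.
by rewrite divnA // mulKn.
Qed.

(** The passage between divisor sums over c <= Y and lattice points under the hyperbola d k <= Y;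
    each exchange of a Dirichlet convolution below goes through it. *)
Lemma dirichlet_regroup (V : nmodType) Y (f : nat -> nat -> V) :
  (\sum_(1 <= c < Y.+1) \sum_(d <- divisors c) f d (c %/ d)%N
   = \sum_(1 <= d < Y.+1) \sum_(1 <= k < Y.+1 | (d * k <= Y)%N) f d k)%R.
Proof.
transitivity (\sum_(1 <= c < Y.+1) \sum_(1 <= d < Y.+1 | (d %| c)%N) f d (c %/ d)%N)%R.
  by apply: eq_big_nat => c; rewrite ltnS => h; exact: sum_divisors_iota.
under eq_bigr do rewrite big_mkcond.
rewrite exchange_big /=; apply: eq_big_nat => d /andP[d0 _].
rewrite -big_mkcond -big_filter (perm_big _ (perm_multiples_iota Y d0)) big_map.
by rewrite big_filter; apply: eq_bigr => k _; rewrite mulKn.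
Qed.

End Divisors.

(** * The Moebius function *)

Section Moebius.

Definition moebius (n : nat) : int :=
  \prod_(p <- primes n) (if logn p n == 1 then -1 else 0).

Lemma moebius1 : moebius 1 = 1.
Proof. by rewrite /moebius big_nil. Qed.

Lemma norm_moebius_le1 n : `|moebius n| <= 1.
Proof.
rewrite /moebius; elim/big_rec: _ => [|p x _ IH] //.
by case: ifP => _; rewrite ?mul0r // mulN1r normrN.
Qed.

Lemma moebius_prime_mul p d : prime p -> (0 < d)%N -> ~~ (p %| d)%N ->
  moebius (p * d) = - moebius d.
Proof.
move=> pp d0 pd; have p0 := prime_gt0 pp.
have perm : perm_eq (primes (p * d)) (p :: primes d).
  apply: uniq_perm; rewrite /= ?primes_uniq ?mem_primes ?pp ?d0 //=.
    by rewrite (negbTE pd).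
  by move=> q; rewrite primesM // primes_prime // inE.
rewrite /moebius (perm_big _ perm) big_cons lognM // (logn_prime p pp) eqxx.
rewrite [X in (_ + X)%N](_ : _ = 0%N); last first.
  by apply/eqP; rewrite lognE pp d0 (negbTE pd).
rewrite addn0 /= mulN1r; congr (- _); apply: eq_big_seq => q.
rewrite mem_primes => /and3P[pq _ qd]; rewrite lognM // (logn_prime q pp).
have -> : (q == p) = false by apply: contraNF pd => /eqP <-.
by [].
Qed.

Lemma moebius_sqr_dvd p n : prime p -> (0 < n)%N -> (p * p %| n)%N -> moebius n = 0.
Proof.
move=> pp n0 ppn.
have pn : (p %| n)%N by apply: dvdn_trans ppn; exact: dvdn_mulr.
rewrite /moebius (big_rem p) /=; last by rewrite mem_primes pp n0.
have : (1 < logn p n)%N by rewrite -pfactor_dvdn // -mulnn in ppn *.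
by case: eqP => [->|] //; rewrite mul0r.
Qed.

(** For n > 1 fix a prime p dividing n. Divisors divisible by p^2 contribute 0, and those of the
    form p d with p not dividing d cancel the divisors d prime to p. *)
Lemma sum_moebius n : (0 < n)%N ->
  \sum_(d <- divisors n) moebius d = (n == 1%N)%:R.
Proof.
move=> n0; have [->|n1] := eqVneq n 1%N; first by rewrite big_seq1 moebius1.
pose p := pdiv n; have n1' : (1 < n)%N by rewrite ltn_neqAle eq_sym n1.
have pp : prime p by exact: pdiv_prime.
have pn : (p %| n)%N by exact: pdiv_dvd.
have p0 := prime_gt0 pp.
have np0 : (0 < n %/ p)%N by rewrite divn_gt0 // dvdn_leq.
rewrite (bigID (fun d => p %| d)%N) /= -big_filter.
rewrite (perm_big _ (perm_multiples_divisors n0 p0 pn)) big_map.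
rewrite (bigID (fun d => p %| d)%N) /= big_seq_cond big1 ?add0r; last first.
  move=> d /andP[]; rewrite -dvdn_divisors // => dn pd.
  apply: (moebius_sqr_dvd pp); last exact: dvdn_mul.
  by rewrite muln_gt0 p0 (dvdn_gt0 np0 dn).
have -> : \sum_(d <- divisors (n %/ p) | ~~ (p %| d)%N) moebius (p * d)
        = \sum_(d <- divisors (n %/ p) | ~~ (p %| d)%N) - moebius d.
  rewrite big_seq_cond [RHS]big_seq_cond; apply: eq_bigr => d /andP[].
  rewrite -dvdn_divisors // => dn pd.
  by rewrite moebius_prime_mul // (dvdn_gt0 np0 dn).
have perm : perm_eq [seq d <- divisors (n %/ p) | ~~ (p %| d)%N]
                    [seq d <- divisors n | ~~ (p %| d)%N].
  apply: uniq_perm; rewrite ?filter_uniq ?divisors_uniq // => d.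
  rewrite !mem_filter -!dvdn_divisors //; case: (boolP (p %| d)%N) => //= pd.
  rewrite -[in RHS](divnK pn) mulnC Gauss_dvdr //.
  by rewrite coprime_sym prime_coprime.
have E : \sum_(d <- divisors (n %/ p) | ~~ (p %| d)%N) moebius d
       = \sum_(d <- divisors n | ~~ (p %| d)%N) moebius d.
  by rewrite -big_filter (perm_big _ perm) big_filter.
by rewrite sumrN E addNr.
Qed.

Lemma sum_moebius_gcd a c : (0 < c)%N ->
  \sum_(d <- divisors c | (d %| a)%N) moebius d = (coprime a c)%:R.
Proof.
move=> c0; rewrite -big_filter -(perm_big _ (perm_gcd_divisors a c0)) sum_moebius //.
by rewrite gcdn_gt0 c0 orbT.
Qed.

End Moebius.

(** * Ramanujan sums *)

Section RamanujanSum.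
Variable R : realType.
Implicit Types (n c : nat).

Definition mu n : R := (moebius n)%:~R.

Lemma norm_mu_le1 n : `|mu n| <= 1.
Proof. by rewrite /mu -intr_norm (_ : 1 = 1%:~R) // ler_int norm_moebius_le1. Qed.

Lemma sum_mu n : (0 < n)%N -> \sum_(d <- divisors n) mu d = (n == 1%N)%:R.
Proof.
by move=> n0; rewrite -(rmorph_sum intr) /= sum_moebius // rmorph_nat.
Qed.

Lemma sum_mu_gcd a c : (0 < c)%N ->
  \sum_(d <- divisors c | (d %| a)%N) mu d = (coprime a c)%:R.
Proof.
by move=> c0; rewrite -(rmorph_sum intr) /= sum_moebius_gcd // rmorph_nat.
Qed.

Lemma eD (x y : R) : e (x + y) = e x * e y.
Proof.
rewrite /e -cexpD; congr cexp; apply/eqP; rewrite eq_complex /= addr0 eqxx /=.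
by rewrite mulrDr.
Qed.

Lemma e_nat (x : R) n : e (n%:R * x) = e x ^+ n.
Proof.
elim: n => [|n IH]; last by rewrite exprS -IH -eD -natr1 mulrDl mul1r addrC.
by rewrite expr0 mul0r /e mulr0 (cexp0 R).
Qed.

Lemma e_int n : e (n%:R : R) = 1.
Proof.
rewrite -[n%:R]mulr1 e_nat (_ : e 1 = 1) ?expr1n // /e mulr1 /cexp /= expR0 mul1r.
by rewrite mulr_natl cos2pi sin2pi.
Qed.

Lemma e_neq1 (x : R) : 0 < x < 1 -> e x != 1.
Proof.
move=> /andP[x0 x1]; rewrite /e /cexp /= expR0 mul1r eq_complex /= negb_and.
apply/orP; left; have -> : 2 * pi * x = (pi * x) *+ 2 by ring.
rewrite cos_mulr2n cos2sin2.
have s0 : 0 < sin (pi * x).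
  by apply: sin_gt0_pi; rewrite mulr_gt0 ?pi_gt0 //= gtr_pMr ?pi_gt0.
have s2 : 0 < sin (pi * x) ^+ 2 by rewrite exprn_gt0.
by rewrite -subr_eq0 lt_eqF //; lra.
Qed.

Lemma sum_e n c : (0 < c)%N ->
  \sum_(0 <= a < c) e (a%:R * n%:R / c%:R : R) = (if (c %| n)%N then c%:R else 0).
Proof.
move=> c0; have c0' : c%:R != 0 :> R by rewrite pnatr_eq0 -lt0n.
under eq_bigr do rewrite -mulrA e_nat.
case: ifP => cn.
  have -> : n%:R / c%:R = (n %/ c)%:R :> R.
    by rewrite -[in LHS](divnK cn) natrM mulfK.
  rewrite e_int; under eq_bigr do rewrite expr1n.
  by rewrite big_const_nat subn0 iter_addr_0.
have z1 : e (n%:R / c%:R : R) != 1.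
  rewrite [X in X%:R / _](divn_eq n c) natrD natrM mulrDl mulfK // eD e_int mul1r.
  apply: e_neq1; rewrite divr_gt0 ?ltr0n ?lt0n //=.
    by rewrite ltr_pdivrMr ?ltr0n // mul1r ltr_nat ltn_mod.
    by rewrite -/(dvdn c n) cn.
  by rewrite -lt0n.
have z2 : e (n%:R / c%:R : R) - 1 != 0 by rewrite subr_eq0; exact: z1.
apply: (mulfI z2).
rewrite mulr0 big_mkord -subrX1 -e_nat mulrCA divff // mulr1 e_int subrr //.
Qed.

(** Coprimality to c is detected by a Moebius sum over d; the multiples of d modulo c then form a
    complete exponential sum modulo c / d, and d is exchanged with c / d. *)
Lemma ramanujan_sum_divisors n c : (0 < c)%N ->
  ramanujan_sum R n c =
  \sum_(d <- divisors c) mu (c %/ d) * (if (d %| n)%N then d%:R else 0).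
Proof.
move=> c0; apply: complexI; rewrite ramanujan_sumE.
have -> : \sum_(0 <= a < c | coprime a c) e (a%:R * n%:R / c%:R : R)
   = \sum_(0 <= a < c) \sum_(d <- divisors c | (d %| a)%N)
       (mu d)%:C * e (a%:R * n%:R / c%:R : R).
  rewrite big_mkcond; apply: eq_bigr => a _.
  rewrite -mulr_suml -rmorph_sum /= sum_mu_gcd //.
  by case: (coprime a c); rewrite ?mul1r ?mul0r.
under eq_bigr do rewrite big_mkcond.
pose g d := if (d %| n)%N then d%:R else 0 : R.
rewrite exchange_big /= (sum_divisors_div (fun d k => mu k * g d)) // rmorph_sum /=.
apply: eq_big_seq => d; rewrite -dvdn_divisors // => dc.
have d0 : (0 < d)%N by exact: dvdn_gt0 dc.
have d0' : d%:R != 0 :> R by rewrite pnatr_eq0 -lt0n.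
rewrite -big_mkcond -big_filter (perm_big _ (perm_multiples_iota0 d0 dc)) big_map.
rewrite -mulr_sumr rmorphM /=; congr (_ * _); rewrite /g.
transitivity (\sum_(0 <= k < c %/ d) e (k%:R * n%:R / (c %/ d)%:R : R)).
  apply: eq_bigr => k _; congr e; rewrite -[c in LHS](divnK dc) !natrM.
  have q0 : (c %/ d)%:R != 0 :> R by rewrite pnatr_eq0 -lt0n divn_gt0 // dvdn_leq.
  have aux (x y z q : R) : x != 0 -> q != 0 -> x * y * z / (q * x) = y * z / q.
    by move=> x1 q1; field; rewrite x1 q1.
  exact: aux.
rewrite sum_e; last by rewrite divn_gt0 // dvdn_leq.
by case: ifP => _ //; rewrite rmorph_nat.
Qed.

End RamanujanSum.

(** * The divisor bound *)

Section DivisorBound.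
Local Open Scope nat_scope.

Definition tau n := size (divisors n).

(** The map d -> (gcd (d, x), d / gcd (d, x)) embeds the divisors of x y into pairs of divisors of x
    and y, d being the product of its image. *)
Lemma tau_mul x y : 0 < x -> 0 < y -> tau (x * y) <= tau x * tau y.
Proof.
move=> x0 y0; rewrite /tau -(size_allpairs muln).
apply: uniq_leq_size; first exact: divisors_uniq.
move=> d; rewrite -dvdn_divisors ?muln_gt0 ?x0 // => dxy.
have g0 : 0 < gcdn d x by rewrite gcdn_gt0 x0 orbT.
apply/allpairsP; exists (gcdn d x, d %/ gcdn d x); split => /=.
- by rewrite -dvdn_divisors // dvdn_gcdr.
- rewrite -dvdn_divisors //.
  have co : coprime (d %/ gcdn d x) (x %/ gcdn d x).
    rewrite /coprime -(eqn_pmul2r g0) muln_gcdl !divnK ?mul1n //.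
      exact: dvdn_gcdr.
    exact: dvdn_gcdl.
  rewrite -(Gauss_dvdr _ co) -(dvdn_pmul2r g0) divnK ?dvdn_gcdl //.
  by rewrite mulnAC divnK ?dvdn_gcdr.
- by rewrite mulnC divnK // dvdn_gcdl.
Qed.

Lemma tau_pfactor p a : prime p -> tau (p ^ a) <= a.+1.
Proof.
move=> pp; rewrite /tau -[leqRHS](size_iota 0) -[leqRHS](size_map (expn p)).
apply: uniq_leq_size; first exact: divisors_uniq.
move=> d; rewrite -dvdn_divisors ?expn_gt0 ?prime_gt0 //.
case/dvdn_pfactor => // k ka ->.
by apply: map_f; rewrite mem_iota.
Qed.

Lemma tau_dvd_le d n : 0 < n -> d %| n -> tau d <= tau n.
Proof.
move=> n0 dn; have d0 := dvdn_gt0 n0 dn; rewrite /tau; apply: uniq_leq_size.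
  exact: divisors_uniq.
by move=> k; rewrite -!dvdn_divisors // => /dvdn_trans; apply.
Qed.

End DivisorBound.

Section DivisorBoundReal.
Variable R : realType.

(** Prime powers are removed one at a time. For p >= 2^{1/k} one has a + 1 <= 2^a <= p^{a k}, so
    only the primes below this bound cost a constant, and there are boundedly many of them. *)
Lemma tau_le_powR (k : R) : 0 < k ->
  exists2 C : R, 1 <= C & forall n, (0 < n)%N -> (tau n)%:R <= C * n%:R `^ k.
Proof.
move=> k0; have ln2 : 0 < ln 2 :> R by rewrite ln_gt0 // ltr1n.
have kl : 0 < k * ln 2 by rewrite mulr_gt0.
(* With x = k ln 2, the factor [c1] = 1 + 1/x gives c1 (1 + x a) >= a + 1, and 2^{a k} >= 1 + x
   a. *)
pose c1 : R := 1 + (k * ln 2)^-1; pose B := (Num.truncn (2 `^ k^-1 : R)).+1.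
have c1_ge1 : 1 <= c1 by rewrite lerDl invr_ge0 ltW.
have powX p a : (p ^ a)%:R `^ k = (p%:R `^ k) ^+ a :> R.
  by rewrite natrX -powR_mulrn // -powRrM mulrC powRrM powR_mulrn ?powR_ge0.
have hsmall p a : (1 < p)%N -> a.+1%:R <= c1 * (p ^ a)%:R `^ k.
  move=> p1; rewrite powX; apply: (@le_trans _ _ (c1 * (2 `^ k) ^+ a)); last first.
    apply: ler_wpM2l; first exact: le_trans c1_ge1.
    apply: lerXn2r; rewrite ?nnegrE ?powR_ge0 //.
    by apply: ge0_ler_powR; rewrite ?nnegrE ?ler_nat // ltW.
  rewrite /powR gt_eqF // -expRM_natr.
  apply: (@le_trans _ _ (c1 * (1 + k * ln 2 * a%:R))); last first.
    by apply: ler_wpM2l; [exact: le_trans c1_ge1|exact: expR_ge1Dx].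
  rewrite /c1 -natr1; set x := k * ln 2 in kl *; set y := a%:R.
  have -> : (1 + x^-1) * (1 + x * y) = (y + 1) + (x * y + x^-1).
    by field; rewrite gt_eqF.
  by rewrite lerDl addr_ge0 // ?mulr_ge0 ?invr_ge0 // ltW.
have hbig p a : (B <= p)%N -> a.+1%:R <= (p ^ a)%:R `^ k.
  move=> Bp; rewrite powX; apply: (@le_trans _ _ (2 ^+ a)).
    by rewrite -natrX ler_nat ltn_expl.
  apply: lerXn2r; rewrite ?nnegrE ?powR_ge0 //.
  have -> : 2 = (2 `^ k^-1) `^ k :> R.
    by rewrite -powRrM mulVf ?gt_eqF // powRr1.
  apply: ge0_ler_powR; rewrite ?nnegrE ?powR_ge0 ?(ltW k0) //.
  by apply: ltW; apply: lt_le_trans (truncnS_gt _) _; rewrite ler_nat; exact: Bp.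
have main m : forall n, (0 < n <= m)%N ->
    (tau n)%:R <= c1 ^+ (count (fun p => p < B)%N (primes n)) * n%:R `^ k.
  elim: m => [|m IH] n /andP[n0 nm]; first by move: n0 nm; case: n.
  have [n1|n1] := leqP n 1.
    have -> : n = 1%N by apply/eqP; rewrite eqn_leq n1 n0.
    by rewrite powR1 mulr1 /= expr0.
  pose p := pdiv n; have pp : prime p by exact: pdiv_prime.
  have p0 := prime_gt0 pp; have p1 := prime_gt1 pp.
  have [q pq nE] := pfactor_coprime pp n0; set a := logn p n in nE.
  have q0 : (0 < q)%N by rewrite lt0n; apply: contraTneq n0 => q0; rewrite nE q0 mul0n.
  have a0 : (0 < a)%N by rewrite logn_gt0 mem_primes pp n0 pdiv_dvd.
  have pa0 : (0 < p ^ a)%N by rewrite expn_gt0 p0.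
  have qn : (q < n)%N by rewrite nE -{1}(muln1 q) ltn_pmul2l // -{1}(expn0 p) ltn_exp2l.
  have perm : perm_eq (primes n) (p :: primes q).
    apply: uniq_perm; rewrite /= ?primes_uniq ?andbT ?mem_primes ?pp ?q0 //=.
      by rewrite -prime_coprime.
    move=> r; rewrite nE primesM // primesX // (primes_prime pp).
    by rewrite !inE orbC.
  have IHq := IH q; rewrite q0 -ltnS (leq_trans qn nm) in IHq.
  have {IHq} IHq := IHq isT.
  have tn : (tau n)%:R <= a.+1%:R * (tau q)%:R :> R.
    rewrite -natrM ler_nat nE mulnC; apply: leq_trans (tau_mul _ _) _ => //.
    by rewrite leq_mul2r tau_pfactor // orbT.
  apply: le_trans tn _; move/permP: perm => ->; rewrite /= exprD.
  have -> : n%:R `^ k = q%:R `^ k * (p ^ a)%:R `^ k :> R by rewrite nE natrM powRM.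
  set X := c1 ^+ count _ _ in IHq *.
  have h : a.+1%:R <= c1 ^+ (p < B)%N * (p ^ a)%:R `^ k.
    by case: ltnP => pB; rewrite ?expr1 ?expr0 ?mul1r; [exact: hsmall|exact: hbig].
  rewrite (mulrC (q%:R `^ k)) mulrACA.
  by apply: ler_pM.
exists (c1 ^+ B); first exact: exprn_ege1.
move=> n n0; apply: le_trans (main n n _) _; first by rewrite n0 leqnn.
rewrite ler_wpM2r ?powR_ge0 // ler_weXn2l // -size_filter -[leqRHS](size_iota 0).
apply: uniq_leq_size; first by rewrite filter_uniq ?primes_uniq.
by move=> p; rewrite mem_filter mem_iota => /andP[].
Qed.

End DivisorBoundReal.

(** * Elementary inequalities *)

Section RealEstimates.
Variable R : realType.
Implicit Types (x y d k : R) (n m : nat).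

Lemma norm_sin_le x : `|sin x| <= `|x|.
Proof.
have main y : 0 <= y -> `|sin y| <= y.
  rewrite le_eqVlt => /predU1P[<-|y0]; first by rewrite sin0 normr0.
  have dsin z : z \in `]0, y[ -> is_derive z 1 (@sin R) (cos z) by move=> _; exact: is_derive_sin.
  have csin : {within `[0, y], continuous (@sin R)}.
    by apply: continuous_subspaceT => z; exact: continuous_sin.
  have [c _] := MVT y0 dsin csin; rewrite sin0 !subr0 => ->.
  rewrite normrM (gtr0_norm y0) -[leRHS]mul1r ler_wpM2r ?(ltW y0) //.
  exact: cos_max.
have [x0|/ltW x0] := leP 0 x; first by rewrite (ger0_norm x0) main.
by rewrite -normrN -sinN (ler0_norm x0) main // oppr_ge0.
Qed.

Lemma onem_cos_le x : 1 - cos x <= x ^+ 2 / 2.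
Proof.
have -> : cos x = 1 - (sin (x / 2) ^+ 2) *+ 2.
  rewrite [X in cos X](_ : x = (x / 2) *+ 2); last by rewrite -mulr_natr divfK.
  by rewrite cos_mulr2n cos2sin2; ring.
have : sin (x / 2) ^+ 2 <= (x / 2) ^+ 2.
  by rewrite -(real_normK (num_real (sin _))) -(real_normK (num_real (x / 2)))
    lerXn2r ?nnegrE // norm_sin_le.
by rewrite expr_div_n; lra.
Qed.

Lemma nc_cexpB1 (w : R[i]) : Re w <= 0 -> nc (cexp w - 1) <= nc w.
Proof.
case: w => a b a0; rewrite -(ler_pXn2r (_ : 0 < 2)%N) ?nnegrE ?nc_ge0 //.
rewrite !nc_sqr /cexp /=; have {}a0 : a <= 0 by [].
have h1 := expR_ge1Dx a; have h2 := expR_ge0 a.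
have h3 : expR a <= 1 by rewrite expR_le1.
have h4 := onem_cos_le b; have h5 := cos_le1 b; have h6 := cos2Dsin2 b.
set E := expR a in h1 h2 h3 *.
have -> : (E * cos b - 0 * sin b - 1) ^+ 2 + (E * sin b + 0 * cos b + - 0) ^+ 2
  = (1 - E) ^+ 2 + 2 * E * (1 - cos b) + E ^+ 2 * (cos b ^+ 2 + sin b ^+ 2 - 1).
  by ring.
rewrite h6 subrr mulr0 addr0; apply: lerD.
  by rewrite -(sqrrN a) lerXn2r ?nnegrE //; lra.
have : E * (1 - cos b) <= 1 * (b ^+ 2 / 2) by apply: ler_pM => //; lra.
by lra.
Qed.

Lemma ln_nat_ge0 n : 0 <= ln n%:R :> R.
Proof.
case: n => [|n]; first by rewrite ln0.
by rewrite ln_ge0 // ler1n.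
Qed.

Lemma ln_step n : (0 < n)%N -> n.+1%:R^-1 <= ln n.+1%:R - ln n%:R :> R.
Proof.
move=> n0; have n0' : 0 < n%:R :> R by rewrite ltr0n.
have n1' : 0 < n.+1%:R :> R by rewrite ltr0n.
rewrite -ln_div ?posrE //.
have h : -1 < - n.+1%:R^-1 :> R.
  by rewrite ltrN2 invf_lt1 // ltr1n.
have := le_ln1Dx h; have -> : 1 - n.+1%:R^-1 = n%:R / n.+1%:R :> R.
  apply: (mulIf (lt0r_neq0 n1')).
  by rewrite mulrBl mulVf ?lt0r_neq0 // divfK ?lt0r_neq0 // mul1r -natr1 addrK.
rewrite !ln_div ?posrE //; set u := ln _; set v := ln _; set z := _^-1; clearbody u v z; lra.
Qed.

Lemma harmonic_le n : (0 < n)%N ->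
  \sum_(1 <= m < n.+1) m%:R^-1 <= 1 + ln n%:R :> R.
Proof.
elim: n => // -[|n] IH _; first by rewrite big_nat1 ln1 invr1 addr0.
rewrite big_nat_recr //=; apply: le_trans (lerD (IH _) (ln_step _)) _ => //.
by lra.
Qed.

(** Comparison of n^{-1-d} with an integral, put as a difference of consecutive values: the form
    that [ccvg_telescope] asks for. *)
Lemma powR_step d n : 0 < d -> (0 < n)%N ->
  n.+1%:R `^ (- (1 + d)) <= d^-1 * (n%:R `^ (- d) - n.+1%:R `^ (- d)).
Proof.
move=> d0 n0; have n0' : 0 < n%:R :> R by rewrite ltr0n.
have n1' : 0 < n.+1%:R :> R by rewrite ltr0n.
have -> : n.+1%:R `^ (- (1 + d)) = n.+1%:R^-1 * n.+1%:R `^ (- d) :> R.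
  rewrite opprD powRD; last by rewrite (gt_eqF n1') implybT.
  by rewrite powR_inv1 // ltW.
have -> : n%:R `^ (- d) = n.+1%:R `^ (- d) * expR (d * (ln n.+1%:R - ln n%:R)).
  rewrite /powR !gt_eqF // -expRD; congr expR.
  by set u := ln _; set v := ln _; ring.
have h := expR_ge1Dx (d * (ln n.+1%:R - ln n%:R)).
have : d * n.+1%:R^-1 <= d * (ln n.+1%:R - ln n%:R).
  by rewrite ler_pM2l // ln_step.
set P := _ `^ _; set E := expR _ in h *; set L := d * (_ - _) in h *.
have P0 : 0 <= P by exact: powR_ge0.
set z := _^-1 => hz; rewrite ler_pdivlMl //.
have -> : P * E - P = (E - 1) * P by rewrite mulrBl mul1r mulrC.
by rewrite mulrA ler_wpM2r //; clearbody z L E; lra.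
Qed.

Lemma sum_powR_tail d K X : 0 < d -> (0 < K <= X)%N ->
  \sum_(K.+1 <= m < X.+1) m%:R `^ (- (1 + d)) <= d^-1 * K%:R `^ (- d).
Proof.
move=> d0 /andP[K0 KX].
apply: (@le_trans _ _ (d^-1 * (K%:R `^ (- d) - X%:R `^ (- d)))); last first.
  by rewrite ler_pM2l ?invr_gt0 // gerBl powR_ge0.
elim: X KX => [|X IH] KX; first by rewrite big_geq //; move: KX K0; case: (K).
move: KX; rewrite leq_eqVlt => /predU1P[->|KX].
  by rewrite big_geq // subrr mulr0.
rewrite big_nat_recr //=; apply: le_trans (lerD (IH KX) (powR_step d0 (leq_trans K0 KX))) _.
by rewrite -mulrDr addrA subrK.
Qed.

Lemma sum_powR_le d X : 0 < d ->
  \sum_(1 <= m < X.+1) m%:R `^ (- (1 + d)) <= 1 + d^-1.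
Proof.
move=> d0; case: X => [|X]; first by rewrite big_geq // addr_ge0 ?invr_ge0 // ltW.
rewrite big_ltn // powR1 lerD2l.
by have := @sum_powR_tail d 1 X.+1 d0 isT; rewrite powR1 mulr1.
Qed.

Lemma lnD1_powR k x : 0 < k -> 1 <= x -> 1 + ln x <= (1 + k^-1) * x `^ k.
Proof.
move=> k0 x1; have x0 : 0 < x by exact: lt_le_trans x1.
rewrite /powR gt_eqF //; have h := expR_ge1Dx (k * ln x); have l0 := ln_ge0 x1.
have k1 : 0 < k^-1 by rewrite invr_gt0.
apply: (@le_trans _ _ ((1 + k^-1) * (1 + k * ln x))); last first.
  by rewrite ler_pM2l // addr_gt0.
have -> : (1 + k^-1) * (1 + k * ln x) = (1 + ln x) + (k^-1 + k * ln x).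
  by field; rewrite gt_eqF.
by rewrite lerDl addr_ge0 // ?mulr_ge0 // ltW.
Qed.

Lemma lnD1X_powR k n : 0 < k ->
  exists2 c, 1 <= c & forall x, 1 <= x -> (1 + ln x) ^+ n <= c * x `^ k.
Proof.
move=> k0; case: n => [|n].
  exists 1 => // x x1; rewrite expr0 mul1r; have -> : 1 = 1 `^ k :> R by rewrite powR1.
  by apply: ge0_ler_powR; rewrite ?nnegrE ?(ltW k0) // (le_trans _ x1).
pose k' := k / n.+1%:R; have k'0 : 0 < k' by rewrite divr_gt0 // ltr0n.
exists ((1 + k'^-1) ^+ n.+1).
  by rewrite exprn_ege1 // lerDl invr_ge0 ltW.
move=> x x1; have -> : x `^ k = (x `^ k') ^+ n.+1.
  by rewrite -powR_mulrn ?powR_ge0 // -powRrM /k' divfK // pnatr_eq0.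
rewrite -exprMn lerXn2r ?nnegrE //.
- by rewrite addr_ge0 // ln_ge0.
- by rewrite mulr_ge0 ?powR_ge0 // addr_ge0 // invr_ge0 ltW.
- exact: lnD1_powR.
Qed.

End RealEstimates.

(** * Finite differences *)

Section FiniteDifferences.
Variable R : realType.
Implicit Types (x y d B K L : R) (s : R[i]) (z w : nat -> R[i]).

Definition fd z : nat -> R[i] := fun i => z i.+1 - z i.

Definition fdn k z : nat -> R[i] := iter k fd z.

Lemma fdnS k z : fdn k.+1 z = fdn k (fd z).
Proof. by rewrite /fdn iterSr. Qed.

Lemma fdnD k z w : fdn k (fun i => z i + w i) = fun i => fdn k z i + fdn k w i.
Proof.
elim: k z w => // k IH z w; rewrite !fdnS -IH; congr (fdn k _).
by apply/funext => i; rewrite /fd; ring.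
Qed.

Lemma fdnZ k (a : R[i]) z : fdn k (fun i => a * z i) = fun i => a * fdn k z i.
Proof.
elim: k z => // k IH z; rewrite !fdnS -IH; congr (fdn k _).
by apply/funext => i; rewrite /fd mulrBr.
Qed.

Lemma fdnB k z w : fdn k (fun i => z i - w i) = fun i => fdn k z i - fdn k w i.
Proof.
elim: k z w => // k IH z w; rewrite !fdnS -IH; congr (fdn k _).
by apply/funext => i; rewrite /fd; ring.
Qed.

Lemma fdnN k z : fdn k (fun i => - z i) = fun i => - fdn k z i.
Proof.
elim: k z => // k IH z; rewrite !fdnS -IH; congr (fdn k _).
by apply/funext => i; rewrite /fd; ring.
Qed.

Lemma fdn_sum k (I : Type) (r : seq I) (f : I -> nat -> R[i]) :
  fdn k (fun i => \sum_(j <- r) f j i) = fun i => \sum_(j <- r) fdn k (f j) i.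
Proof.
elim: k f => // k IH f; rewrite fdnS.
under [RHS]eq_fun do under eq_bigr do rewrite fdnS.
rewrite -IH; congr (fdn k _).
by apply/funext => i; rewrite /fd sumrB.
Qed.

Lemma fdn_shift k z n : fdn k (fun i => z (n + i)%N) = fun i => fdn k z (n + i)%N.
Proof.
elim: k z => // k IH z; rewrite !fdnS -IH; congr (fdn k _).
by apply/funext => i; rewrite /fd addnS.
Qed.

Lemma fdn_geometric k (a q : R[i]) i :
  fdn k (fun i => a * q ^+ i) i = a * q ^+ i * (q - 1) ^+ k.
Proof.
elim: k a => [|k IH] a; first by rewrite /= mulr1.
rewrite fdnS (_ : fd _ = fun i => (a * (q - 1)) * q ^+ i).
  by rewrite IH exprS; ring.
by apply/funext => j; rewrite /fd exprS; ring.
Qed.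

Lemma ccvg_fdn (u : nat -> nat -> R[i]) z k i :
  (forall i, ccvg (u ^~ i) (z i)) -> ccvg (fun n => fdn k (u n) i) (fdn k z i).
Proof.
elim: k u z => [|k IH] u z h; first exact: h.
rewrite fdnS; under eq_fun do rewrite fdnS.
by apply: IH => j; exact: ccvgB.
Qed.

(** The discrete counterpart of bounds K B^k for k-th derivatives, for a function sampled with step
    d. The window k + i <= J reflects that a k-th difference at i reads the values up to i + k. *)
Definition fdbound J z d B K :=
  forall k i, (k + i <= J)%N -> nc (fdn k z i) <= K * (d * B) ^+ k.

Lemma fdbound_fd J z d B K : fdbound J.+1 z d B K -> fdbound J (fd z) d B (K * (d * B)).
Proof.
move=> h k i kiJ; rewrite -fdnS; apply: le_trans (h k.+1 i kiJ) _.
by rewrite exprS mulrA.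
Qed.

Lemma fdbound_shift J z d B K :
  fdbound J.+1 z d B K -> fdbound J (fun i => z i.+1) d B K.
Proof.
move=> h k i kiJ; have -> : (fun i => z i.+1) = (fun i => z (1 + i)%N) by [].
by rewrite fdn_shift h // addnCA.
Qed.

Lemma fdboundS J z d B K : fdbound J.+1 z d B K -> fdbound J z d B K.
Proof. by move=> h k i kiJ; apply: h; rewrite (leq_trans kiJ). Qed.

(** Discrete Leibniz rule: the difference of z w at j is (fd z)(j) w(j + 1) + z(j) (fd w)(j). The
    rates B and B' add, as in the binomial expansion of (B + B')^k. *)
Lemma fdboundM J z w d B K B' K' : 0 <= d -> 0 <= B -> 0 <= B' -> 0 <= K -> 0 <= K' ->
  fdbound J z d B K -> fdbound J w d B' K' ->
  fdbound J (fun i => z i * w i) d (B + B') (K * K').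
Proof.
move=> d0 B0 B'0; elim: J z w K K' => [|J IH] z w K K' K0 K'0 hz hw k i.
  case: k i => [|k] [|i] // _; rewrite /= expr0 mulr1 ncM ler_pM ?nc_ge0 //.
    by have := hz 0%N 0%N isT; rewrite mulr1.
  by have := hw 0%N 0%N isT; rewrite mulr1.
case: k => [|k] kiJ.
  rewrite /= expr0 mulr1 ncM ler_pM ?nc_ge0 //.
    by have := hz 0%N i kiJ; rewrite mulr1.
  by have := hw 0%N i kiJ; rewrite mulr1.
rewrite fdnS (_ : fd _ = fun i => fd z i * w i.+1 + z i * fd w i); last first.
  by apply/funext => j; rewrite /fd; ring.
rewrite fdnD; apply: le_trans (ncD _ _) _.
have h1 := IH _ _ _ _ _ K'0 (fdbound_fd hz) (fdbound_shift hw).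
have h2 := IH _ _ _ _ K0 _ (fdboundS hz) (fdbound_fd hw).
have KB : 0 <= K * (d * B) by rewrite !mulr_ge0.
have KB' : 0 <= K' * (d * B') by rewrite !mulr_ge0.
apply: le_trans (lerD (h1 KB k i kiJ) (h2 KB' k i kiJ)) _.
apply: eqW.
by rewrite exprS; set E := _ ^+ k; ring.
Qed.

Lemma fdbound_le J z d B K B' K' : 0 <= d -> 0 <= B <= B' -> 0 <= K <= K' ->
  fdbound J z d B K -> fdbound J z d B' K'.
Proof.
move=> d0 /andP[B0 BB'] /andP[K0 KK'] h k i kiJ; apply: le_trans (h k i kiJ) _.
have dB := mulr_ge0 d0 B0.
apply: ler_pM => //; first exact: exprn_ge0.
by rewrite lerXn2r ?nnegrE ?ler_wpM2l // (le_trans dB) // ler_wpM2l.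
Qed.

(** The difference of 1/z is minus fd z divided by z(j) z(j + 1), to which [fdboundM] applies with
    the rates already known for 1/z at order J. Each order multiplies the rate by 3 K L. *)
Lemma fdboundV J z d B K L : 0 <= d -> 1 <= B -> 0 <= K -> 0 <= L -> 1 <= K * L ->
  fdbound J z d B K -> (forall i, (i <= J)%N -> z i != 0 /\ nc (z i)^-1 <= L) ->
  fdbound J (fun i => (z i)^-1) d (B * (3 * (K * L)) ^+ J) L.
Proof.
move=> d0 B1 K0 L0 KL1; elim: J z => [|J IH] z hz hL k i.
  by case: k i => [|k] [|i] // _; rewrite expr0 !mulr1 (hL 0%N isT).2.
case: k => [|k] kiJ; first by rewrite expr0 mulr1 (hL i kiJ).2.
have B0 : 0 <= B by exact: le_trans B1.
set B' := B * (3 * (K * L)) ^+ J.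
have B'B : B <= B'.
  by rewrite /B' ler_peMr // exprn_ege1 // mulr_ege1 // ler1n.
have B'0 : 0 <= B' by exact: le_trans B'B.
have hu : fdbound J (fun i => (z i)^-1) d B' L.
  by apply: IH => [|j jJ]; [exact: fdboundS|apply: hL; rewrite ltnW].
have hSu : fdbound J (fun i => (z i.+1)^-1) d B' L.
  by apply: (IH (fun i => z i.+1)) => [|j jJ]; [exact: fdbound_shift|exact: hL].
have KB : 0 <= K * (d * B) by rewrite !mulr_ge0.
have hm := fdboundM d0 B0 (addr_ge0 B'0 B'0) KB (mulr_ge0 L0 L0) (fdbound_fd hz)
  (fdboundM d0 B'0 B'0 L0 L0 hu hSu).
have step j : (j <= J)%N ->
   fd (fun i => (z i)^-1) j = - (fd z j * ((z j)^-1 * (z j.+1)^-1)).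
  move=> jJ; have [zj _] := hL j (leqW jJ); have [zj1 _] := hL j.+1 jJ.
  by rewrite /fd; field; rewrite zj zj1.
(* The formula for the difference of 1/z is available only where z is known not to vanish, so the
   two sequences are compared inside the window. *)
have loc : forall k (f g : nat -> R[i]) i, (k + i <= J)%N ->
    (forall j, (j <= J)%N -> f j = g j) -> fdn k f i = fdn k g i.
  elim=> [|m IHm] f g j mJ fg; first exact: fg.
  by rewrite /fdn !iterS /fd -/(fdn m f) -/(fdn m g) !(IHm f g) // ?addnS // ltnW.
rewrite fdnS (loc _ _ (fun j => - (fd z j * ((z j)^-1 * (z j.+1)^-1)))) //.
rewrite fdnN ncN; apply: le_trans (hm k i kiJ) _.
have le3 : B + (B' + B') <= 3 * B' by move: B'B; clear; lra.
have dB0 : 0 <= d * (B + (B' + B')) by rewrite mulr_ge0 // !addr_ge0.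
have X3 : B * (3 * (K * L)) ^+ J.+1 = 3 * B' * (K * L).
  by rewrite /B' exprS; set E := _ ^+ J; ring.
rewrite X3 exprS.
have -> : L * (d * (3 * B' * (K * L)) * (d * (3 * B' * (K * L))) ^+ k)
   = (K * (d * (3 * B')) * (L * L)) * (d * (3 * B' * (K * L))) ^+ k.
  by set E := _ ^+ k; ring.
apply: ler_pM => //; rewrite ?exprn_ge0 ?mulr_ge0 ?addr_ge0 //.
  rewrite ler_wpM2r ?mulr_ge0 // ler_wpM2l // ler_wpM2l //.
  by move: B'B B'0; clear; lra.
rewrite lerXn2r ?nnegrE //.
  by apply: mulr_ge0 => //; apply: mulr_ge0 => //; exact: mulr_ge0.
rewrite ler_wpM2l //; apply: le_trans le3 _.
by rewrite ler_peMr //; exact: mulr_ge0.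
Qed.

End FiniteDifferences.

(** * Complex-valued functions of a real variable *)

Section ComplexCalculus.
Variable R : realType.
Implicit Types (x y d : R) (s : R[i]) (f F : R -> R[i]).

Definition cderiv f (l : R[i]) x :=
  is_derive x 1 (fun y => Re (f y)) (Re l) /\ is_derive x 1 (fun y => Im (f y)) (Im l).

Lemma cderiv_ext f g l x : f =1 g -> cderiv f l x -> cderiv g l x.
Proof. by move=> /funext ->. Qed.

Lemma cderivB f g l m x : cderiv f l x -> cderiv g m x ->
  cderiv (fun y => f y - g y) (l - m) x.
Proof.
move=> [f1 f2] [g1 g2]; split.
  by rewrite cReB; under eq_fun do rewrite cReB; exact: is_deriveB.
by rewrite cImB; under eq_fun do rewrite cImB; exact: is_deriveB.
Qed.

Lemma cderivZ f l (a : R[i]) x : cderiv f l x -> cderiv (fun y => a * f y) (a * l) x.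
Proof.
have E1 (z w : R[i]) : Re (z * w) = Re z * Re w - Im z * Im w by case: z; case: w.
have E2 (z w : R[i]) : Im (z * w) = Re z * Im w + Im z * Re w by case: z; case: w.
move=> [f1 f2]; split.
  rewrite E1; under eq_fun do rewrite E1.
  by apply: is_deriveB; apply: is_deriveZ.
rewrite E2; under eq_fun do rewrite E2.
by apply: is_deriveD; apply: is_deriveZ.
Qed.

Lemma cderiv_linear (a : R[i]) x : cderiv (fun y => y%:C * a) a x.
Proof.
split.
  rewrite [X in is_derive _ _ X _](_ : _ = (Re a \*: id)); last first.
    by apply/funext => y; rewrite -[LHS]/(Re (y%:C * a)) cReMr mulrC.
  by rewrite -[X in is_derive _ _ _ X]mulr1; exact: is_deriveZ.
rewrite [X in is_derive _ _ X _](_ : _ = (Im a \*: id)); last first.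
  by apply/funext => y; rewrite -[LHS]/(Im (y%:C * a)) cImMr mulrC.
by rewrite -[X in is_derive _ _ _ X]mulr1; exact: is_deriveZ.
Qed.

Lemma cderiv_cpow s x : 0 < x -> cderiv (fun y => cpow y s) (s * cpow x (s - 1)) x.
Proof.
move=> x0; rewrite cpowD cpowNV cpow_r1 //.
case: s => a b.
have dl := is_derive1_ln x0.
have de : is_derive x 1 (fun y => expR (a * ln y)) (a * x^-1 * expR (a * ln x)).
  by rewrite mulrC; apply: (@is_derive1_comp _ expR (fun y => a * ln y)).
have dc : is_derive x 1 (fun y => cos (b * ln y)) (b * x^-1 * - sin (b * ln x)).
  by rewrite mulrC; apply: (@is_derive1_comp _ cos (fun y => b * ln y)).
have ds : is_derive x 1 (fun y => sin (b * ln y)) (b * x^-1 * cos (b * ln x)).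
  by rewrite mulrC; apply: (@is_derive1_comp _ sin (fun y => b * ln y)).
have xV : (x%:C)^-1 = (x^-1)%:C :> R[i] by rewrite -fmorphV.
have ReE y : Re (cpow y (a +i* b)) = expR (a * ln y) * cos (b * ln y).
  by rewrite /cpow /cexp /= !mulr0 !mul0r !subr0 add0r.
have ImE y : Im (cpow y (a +i* b)) = expR (a * ln y) * sin (b * ln y).
  by rewrite /cpow /cexp /= !mulr0 !mul0r !subr0 add0r addr0.
split.
  under eq_fun do rewrite ReE.
  apply: (is_derive_eq (is_deriveM de dc)).
  rewrite xV (mulrC (cpow _ _)) mulrCA cReMr; case E : (cpow x (a +i* b)) => [p q] /=.
  move: (ReE x) (ImE x); rewrite E /= => -> ->; rewrite /GRing.scale /=; ring.
under eq_fun do rewrite ImE.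
apply: (is_derive_eq (is_deriveM de ds)).
rewrite xV (mulrC (cpow _ _)) mulrCA cImMr; case E : (cpow x (a +i* b)) => [p q] /=.
move: (ReE x) (ImE x); rewrite E /= => -> ->; rewrite /GRing.scale /=; ring.
Qed.

Lemma cderiv_fdn (F f : R -> nat -> R[i]) x :
  (forall i, cderiv (F ^~ i) (f x i) x) ->
  forall k i, cderiv (fun y => fdn k (F y) i) (fdn k (f x) i) x.
Proof.
move=> h k; elim: k F f h => [|k IH] F f h i; first exact: h.
rewrite fdnS; apply: (@cderiv_ext (fun y => fdn k (fd (F y)) i)).
  by move=> y; rewrite fdnS.
apply: (IH (fun y => fd (F y)) (fun y => fd (f y))) => j.
exact: cderivB.
Qed.

(** The mean value theorem has no complex form with a single intermediate point; used for the real
    and imaginary parts separately it costs the factor 2. *)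
Lemma MVT_complex F f (c : R[i]) (B u v : R) : u < v ->
  (forall x, u <= x <= v -> cderiv F (f x) x) ->
  (forall x, u <= x <= v -> nc (f x - c) <= B) ->
  nc (F v - F u - (v - u)%:C * c) <= 2 * B * (v - u).
Proof.
move=> uv dF hB.
pose G x := F x - x%:C * c.
have dG x : u <= x <= v -> cderiv G (f x - c) x.
  by move=> h; apply: cderivB; [exact: dF|exact: cderiv_linear].
have -> : F v - F u - (v - u)%:C * c = G v - G u.
  by rewrite /G rmorphB /=; ring.
have real_part (p : R[i] -> R) : (forall z, `|p z| <= nc z) ->
    (forall z w, p (z - w) = p z - p w) ->
    (forall x, u <= x <= v -> is_derive x 1 (fun y => p (G y)) (p (f x - c))) ->
    `|p (G v - G u)| <= B * (v - u).
  move=> pn pB dp; rewrite pB.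
  have dp' x : x \in `]u, v[ -> is_derive x 1 (fun y => p (G y)) (p (f x - c)).
    by rewrite in_itv /= => /andP[ux xv]; apply: dp; rewrite !ltW.
  have cp : {within `[u, v], continuous (fun y => p (G y))}.
    apply: derivable_within_continuous => x; rewrite in_itv /= => hx.
    by case: (dp x hx).
  have [x xuv ->] := MVT uv dp' cp.
  rewrite normrM (gtr0_norm (_ : 0 < v - u)) ?subr_gt0 // ler_wpM2r ?subr_ge0 ?(ltW uv) //.
  apply: le_trans (pn _) (hB _ _).
  by move: xuv; rewrite in_itv /= => /andP[ux xv]; rewrite !ltW.
apply: le_trans (nc_leReIm _) _.
have h1 : `|Re (G v - G u)| <= B * (v - u).
  by apply: real_part => [z|z w|x h]; [exact: nc_ge_Re|exact: cReB|have [] := dG x h].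
have h2 : `|Im (G v - G u)| <= B * (v - u).
  by apply: real_part => [z|z w|x h]; [exact: nc_ge_Im|exact: cImB|have [] := dG x h].
by apply: le_trans (lerD h1 h2) _; rewrite -mulrA mulr_natl mulr2n.
Qed.

End ComplexCalculus.

(** * The zeta function to the right of the line Re s = 1 *)

Section ZetaDifferences.
Variable R : realType.
Implicit Types (x y d : R) (s : R[i]) (k n i J : nat).

(** The sequence whose limit is [zeta] by definition, written with [cpow]. *)
Definition zpartial s n : R[i] :=
  \sum_(1 <= k < n.+1) cpow k%:R (- s) - cpow n%:R (1 - s) / (1 - s).

Definition hstep s d i : R[i] := s + (i%:R * d)%:C.

Lemma hstep0 s d : hstep s d 0 = s.
Proof. by rewrite /hstep mul0r addr0. Qed.

Lemma Re_hstep s d i : Re (hstep s d i) = Re s + i%:R * d.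
Proof. by rewrite /hstep cReD. Qed.

Lemma Im_hstep s d i : Im (hstep s d i) = Im s.
Proof. by rewrite /hstep cImD /= addr0. Qed.

Lemma hstepD s d i j : hstep s d (i + j) = hstep (hstep s d i) d j.
Proof. by rewrite /hstep natrD mulrDl rmorphD addrA. Qed.

(** The values at s + i d form a geometric progression of ratio x^{-d}, on which the difference
    operator acts as multiplication by x^{-d} - 1. *)
Lemma fdn_cpow s d k x : 0 < x ->
  fdn k (fun i => cpow x (- hstep s d i)) 0
  = cpow x (- s) * ((x `^ (- d))%:C - 1) ^+ k.
Proof.
move=> x0; have := fdn_geometric k (cpow x (- s)) (x `^ (- d))%:C 0.
rewrite expr0 mulr1 => <-; congr (fdn k _ 0); apply/funext => i.
rewrite /hstep opprD cpowD; congr (_ * _); elim: i => [|i IH].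
  by rewrite mul0r oppr0 cpow0.
rewrite -natr1 mulrDl mul1r rmorphD opprD cpowD IH exprS mulrC; congr (_ * _).
by rewrite -rmorphN /= cpow_real.
Qed.

Lemma norm_subX_le (p q m r : R) k : 0 <= m -> 0 <= r ->
  `|p| <= m -> `|q| <= m -> `|p - q| <= m * r -> `|p ^+ k - q ^+ k| <= k%:R * m ^+ k * r.
Proof.
move=> m0 r0 pm qm pq; elim: k => [|k IH]; first by rewrite !expr0 subrr normr0 !mul0r.
have -> : p ^+ k.+1 - q ^+ k.+1 = p * (p ^+ k - q ^+ k) + (p - q) * q ^+ k.
  by rewrite !exprS; ring.
apply: le_trans (ler_normD _ _) _; rewrite !normrM normrX.
have h1 : `|p| * `|p ^+ k - q ^+ k| <= m * (k%:R * m ^+ k * r) by apply: ler_pM.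
have h2 : `|p - q| * `|q| ^+ k <= (m * r) * m ^+ k.
  by apply: ler_pM => //; rewrite ?exprn_ge0 // lerXn2r ?nnegrE.
apply: le_trans (lerD h1 h2) _; apply: eqW.
by rewrite exprS -natr1; set E := m ^+ k; ring.
Qed.

Lemma ln_diff_le x y : 0 < x -> x <= y -> 0 <= ln y - ln x <= (y - x) / x.
Proof.
move=> x0 xy; have y0 : 0 < y by exact: lt_le_trans xy.
rewrite subr_ge0 ler_ln ?posrE // xy /= -ln_div ?posrE //.
have -> : y / x = 1 + (y - x) / x by rewrite mulrBl divff ?gt_eqF // addrC subrK.
apply: le_ln1Dx; apply: (@lt_le_trans _ _ 0); first by rewrite ltrN10.
by rewrite divr_ge0 ?subr_ge0 // ltW.
Qed.

Lemma powRN_diff_le x y d : 1 <= x -> x <= y -> 0 <= d ->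
  `|y `^ (- d) - x `^ (- d)| <= d * (ln y - ln x).
Proof.
move=> x1 xy d0; have x0 : 0 < x by exact: lt_le_trans x1.
have y0 : 0 < y by exact: lt_le_trans xy.
have /andP[l0 _] := ln_diff_le x0 xy.
rewrite distrC ger0_norm; last first.
  rewrite subr_ge0 /powR !gt_eqF // ler_expR !mulNr lerN2 ler_wpM2l //.
  by rewrite -subr_ge0.
have -> : y `^ (- d) = x `^ (- d) * expR (- (d * (ln y - ln x))).
  rewrite /powR !gt_eqF // -expRD; congr expR.
  by set u := ln x; set v := ln y; ring.
rewrite -{1}[x `^ _]mulr1 -mulrBr -[leRHS]mul1r.
have h := expR_ge1Dx (- (d * (ln y - ln x))).
apply: ler_pM; rewrite ?powR_ge0 //.
- by rewrite subr_ge0 expR_le1 oppr_le0 mulr_ge0.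
- by rewrite /powR gt_eqF // expR_le1 mulNr oppr_le0 mulr_ge0 // ln_ge0.
- by move: h; set E := expR _; set L := d * _; move=> h; lra.
Qed.

Lemma nc_cpowN_le x s : 1 <= x -> 1 <= Re s -> nc (cpow x (- s)) <= x^-1.
Proof.
move=> x1 s1; have x0 : 0 < x by exact: lt_le_trans x1.
rewrite nc_cpow cReN -[leRHS](@lnK _ x^-1) ?posrE ?invr_gt0 //.
by rewrite ler_expR lnV ?posrE // mulNr lerN2 ler_peMl // ln_ge0.
Qed.

(** The variation over a unit interval of the k-th difference of x^{-s}: the factor x^{-s} moves by
    |s| / x^2, and the k-th power by k m^k / x. *)
Lemma phi_diff_le s d k x y : 1 <= x -> x <= y <= x + 1 -> 1 <= Re s -> 0 <= d ->
  nc (cpow y (- s) * ((y `^ (- d))%:C - 1) ^+ k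
      - cpow x (- s) * ((x `^ (- d))%:C - 1) ^+ k)
  <= (nc s + k%:R) * (d * (1 + ln y)) ^+ k / x ^+ 2.
Proof.
move=> x1 /andP[xy yx] s1 d0; have x0 : 0 < x by exact: lt_le_trans x1.
have y1 : 1 <= y by exact: le_trans xy.
have /andP[l0 l1] := ln_diff_le x0 xy.
have l2 : ln y - ln x <= x^-1.
  apply: le_trans l1 _; rewrite -[leRHS]mul1r ler_wpM2r ?invr_ge0 ?(ltW x0) //.
  by rewrite lerBlDl.
have ly := ln_ge0 y1; have lx := ln_ge0 x1.
(* The summand 1 gives m >= d, so that x^{-d} changes by at most d / x <= m / x, also near x = 1
   where ln x vanishes. *)
set m := d * (1 + ln y).
have m0 : 0 <= m by rewrite mulr_ge0 // addr_ge0.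
have pm z : 1 <= z -> z <= y -> `|z `^ (- d) - 1| <= m.
  move=> z1 zy; have := powRN_diff_le (lexx 1) z1 d0; rewrite powR1 ln1 subr0.
  move=> h; apply: le_trans h _; rewrite ler_wpM2l //.
  apply: (@le_trans _ _ (ln y)); last by rewrite lerDr.
  by rewrite ler_ln ?posrE // (lt_le_trans ltr01).
have dm : `|(y `^ (- d) - 1) - (x `^ (- d) - 1)| <= m * x^-1.
  rewrite opprB addrA subrK; apply: le_trans (powRN_diff_le x1 xy d0) _.
  rewrite -mulrA ler_wpM2l //; apply: le_trans l2 _.
  by rewrite ler_peMl ?invr_ge0 ?(ltW x0) // lerDl.
have xV0 : 0 <= x^-1 by rewrite invr_ge0 ltW.
have hp := norm_subX_le k m0 xV0 (pm y y1 (lexx y)) (pm x x1 xy) dm.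
have xs := nc_cpowN_le x1 s1.
have ds : nc (cpow y (- s) - cpow x (- s)) <= x^-1 * (nc s * x^-1).
  have -> : cpow y (- s) = cpow x (- s) * cexp (- s * (ln y - ln x)%:C).
    by rewrite /cpow -cexpD -mulrDr -rmorphD /= [ln x + _]addrC subrK.
  rewrite -{2}[cpow x (- s)]mulr1 -mulrBr ncM; apply: ler_pM; rewrite ?nc_ge0 //.
  apply: le_trans (nc_cexpB1 _) _.
    rewrite mulrC cReMr cReN mulrN oppr_le0 mulr_ge0 //.
    by rewrite (le_trans ler01).
  by rewrite ncM ncN nc_real (ger0_norm l0) ler_wpM2l ?nc_ge0.
have E z : ((z `^ (- d))%:C - 1) ^+ k = ((z `^ (- d) - 1) ^+ k)%:C :> R[i].
  by rewrite rmorphXn rmorphB.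
rewrite !E; set P := (y `^ _ - 1) in dm hp *; set Q := (x `^ _ - 1) in dm hp *.
have -> : cpow y (- s) * (P ^+ k)%:C - cpow x (- s) * (Q ^+ k)%:C
   = (cpow y (- s) - cpow x (- s)) * (P ^+ k)%:C + cpow x (- s) * (P ^+ k - Q ^+ k)%:C.
  by rewrite rmorphB /=; ring.
apply: le_trans (ncD _ _) _.
rewrite (ncM _ (P ^+ k)%:C) (ncM _ (P ^+ k - Q ^+ k)%:C) !nc_real.
have Pk : `|P ^+ k| <= m ^+ k by rewrite normrX lerXn2r ?nnegrE //; exact: pm.
have h1 := ler_pM (nc_ge0 _) (normr_ge0 _) ds Pk.
have h2 := ler_pM (nc_ge0 _) (normr_ge0 _) xs hp.
apply: le_trans (lerD h1 h2) _; apply: eqW.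
by rewrite -exprVn; set E1 := m ^+ k; set z := x^-1; set a := nc s; ring.
Qed.

(** The increment is (n + 1)^{-s} minus the integral of x^{-s} over [n, n + 1], that is first-order
    Euler-Maclaurin summation. Differencing in s commutes with this, and [MVT_complex] reduces the
    bound to the oscillation of the differenced integrand. *)
Lemma zpartial_increment s d k n : (0 < n)%N -> 1 <= Re s -> 0 <= d ->
  (forall i, hstep s d i != 1) ->
  nc (fdn k (fun i => zpartial (hstep s d i) n.+1) 0
      - fdn k (fun i => zpartial (hstep s d i) n) 0)
  <= 2 * ((nc s + k%:R) * (d * (1 + ln n.+1%:R)) ^+ k / n%:R ^+ 2).
Proof.
move=> n0 s1 d0 sn1; have n1 : 1 <= n%:R :> R by rewrite ler1n.
have npos : 0 < n%:R :> R by rewrite ltr0n.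
pose F x i := cpow x (1 - hstep s d i) / (1 - hstep s d i).
pose f x i := cpow x (- hstep s d i).
have dF x : 0 < x -> forall i, cderiv (F ^~ i) (f x i) x.
  move=> x0 i; have h0 : 1 - hstep s d i != 0 by rewrite subr_eq0 eq_sym.
  have h := cderivZ (1 - hstep s d i)^-1 (cderiv_cpow (1 - hstep s d i) x0).
  rewrite mulrA mulVf // mul1r addrAC subrr add0r in h.
  by apply: cderiv_ext h => y; rewrite /F mulrC.
have E : fdn k (fun i => zpartial (hstep s d i) n.+1) 0
      - fdn k (fun i => zpartial (hstep s d i) n) 0
   = - (fdn k (F n.+1%:R) 0 - fdn k (F n%:R) 0 - (n.+1%:R - n%:R)%:C * fdn k (f n.+1%:R) 0).
  rewrite -natr1 [X in X%:C](addrC) addKr mul1r natr1.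
  rewrite opprB -(congr1 (@^~ 0%N) (fdnB k _ _)).
  rewrite -[fdn k (F _) 0 - _](congr1 (@^~ 0%N) (fdnB k _ _)).
  rewrite -[RHS](congr1 (@^~ 0%N) (fdnB k _ _)); congr (fdn k _ 0).
  apply/funext => i; rewrite /zpartial big_nat_recr //= /F /f.
  by set a := \sum_(1 <= _ < _) _; ring.
rewrite E ncN.
have n1n : n.+1%:R - n%:R = 1 :> R by rewrite -natr1 addrC addKr.
have nn : n%:R < n.+1%:R :> R by rewrite ltr_nat.
have hB x : n%:R <= x <= n.+1%:R ->
   nc (fdn k (f x) 0 - fdn k (f n.+1%:R) 0)
   <= (nc s + k%:R) * (d * (1 + ln n.+1%:R)) ^+ k / n%:R ^+ 2.
  move=> /andP[nx xn]; have x0 : 0 < x by exact: lt_le_trans nx.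
  have x1 : 1 <= x by exact: le_trans nx.
  rewrite !fdn_cpow // ?ltr0n // ncBC.
  apply: le_trans (phi_diff_le k x1 _ s1 d0) _.
    by rewrite xn -natr1 lerD2r.
  rewrite ler_wpM2l //.
    apply: mulr_ge0; first by rewrite addr_ge0 ?nc_ge0.
    by rewrite exprn_ge0 // mulr_ge0 // addr_ge0 // ln_nat_ge0.
  by rewrite lef_pV2 ?posrE ?exprn_gt0 // lerXn2r ?nnegrE // ltW.
have hd x : n%:R <= x <= n.+1%:R ->
    cderiv (fun y => fdn k (F y) 0) (fdn k (f x) 0) x.
  move=> /andP[nx _]; exact: (cderiv_fdn (dF x (lt_le_trans npos nx)) k 0).
by have := MVT_complex nn hd hB; rewrite n1n mulr1.
Qed.

(** The increments are n^{-2} times k logarithms. Half a power of n absorbs the logarithms, and the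
    remaining n^{-3/2} telescopes to n^{-1/2}. Keeping d^k explicit is what later turns differences
    of zeta into a power saving. *)
Lemma zeta_fdn_tail J : exists2 c : R, 1 <= c &
  forall k d s, (k <= J)%N -> 0 <= d -> 1 <= Re s -> (forall i, hstep s d i != 1) ->
  forall n, (0 < n)%N ->
  nc (fdn k (fun i => zeta (hstep s d i)) 0 - fdn k (fun i => zpartial (hstep s d i) n) 0)
  <= c * d ^+ k * (nc s + 1) * n%:R `^ (- 2^-1).
Proof.
have h2 : 0 < 2^-1 :> R by rewrite invr_gt0.
have [c0 c01 hc0] := @lnD1X_powR R 2^-1 J h2.
(* 16 = 2 * 4 * 2: from [MVT_complex], from 1 / n^2 <= 4 / (n + 1)^2, and from [powR_step] with
   exponent 1/2; J + 1 comes from |s| + k <= (J + 1)(|s| + 1). *)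
pose cJ := 16 * c0 * J.+1%:R.
exists cJ.
  rewrite /cJ; apply: mulr_ege1; last by rewrite ler1n.
  by apply: mulr_ege1 => //; rewrite ler1n.
have c00 : 0 <= c0 by exact: le_trans c01.
have tele k d s : (k <= J)%N -> 0 <= d -> 1 <= Re s -> (forall i, hstep s d i != 1) ->
    exists2 w, ccvg (fun n => fdn k (fun i => zpartial (hstep s d i) n) 0) w &
    forall n, (1 <= n)%N -> nc (w - fdn k (fun i => zpartial (hstep s d i) n) 0)
      <= cJ * d ^+ k * (nc s + 1) * n%:R `^ (- 2^-1).
  move=> kJ d0 s1 sn1.
  have dk : 0 <= d ^+ k by exact: exprn_ge0.
  apply: ccvg_telescope => [n n0|]; last first.
    rewrite -(mulr0 (cJ * d ^+ k * (nc s + 1))).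
    by apply: cvgM; [exact: cvg_cst|exact: cvg_natpowN].
  apply: le_trans (zpartial_increment k n0 s1 d0 sn1) _.
  rewrite -mulrBr.
  have npos : 0 < n%:R :> R by rewrite ltr0n.
  have n1pos : 0 < n.+1%:R :> R by rewrite ltr0n.
  have hs := powR_step h2 n0; rewrite invrK in hs.
  have hl : (1 + ln n.+1%:R) ^+ k <= c0 * n.+1%:R `^ 2^-1.
    apply: le_trans (hc0 _ _); last by rewrite ler1n.
    by rewrite ler_weXn2l // lerDl ln_nat_ge0.
  have hn : (n%:R ^+ 2)^-1 <= 4 * (n.+1%:R ^+ 2)^-1 :> R.
    rewrite -[4]invrK -invfM lef_pV2 ?posrE ?exprn_gt0 ?mulr_gt0 ?invr_gt0 ?exprn_gt0 //.
    rewrite ler_pdivrMl // -[4]/(2 * 2)%N%:R -natrX -natrX -natrM ler_nat.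
    rewrite -mulnn -[(2 * 2 * _)%N]/((2 * 2) * (n ^ 2))%N -(mulnn n) mulnACA.
    by apply: leq_mul; rewrite mul2n -addnn -addn1 leq_add2l.
  have hp : n.+1%:R `^ 2^-1 * (n.+1%:R ^+ 2)^-1 = n.+1%:R `^ (- (1 + 2^-1)) :> R.
    rewrite -powR_invn ?(ltW n1pos) // -powRD; last by rewrite (gt_eqF n1pos) implybT.
    by congr (_ `^ _); field.
  have ks : nc s + k%:R <= J.+1%:R * (nc s + 1).
    have kJ' : k%:R <= J.+1%:R :> R by rewrite ler_nat leqW.
    have j1 : 1 <= J.+1%:R :> R by rewrite ler1n.
    by rewrite mulrDr mulr1 lerD // ler_peMl ?nc_ge0.
  rewrite exprMn.
  set A := nc s + k%:R in ks *; set l := (1 + ln _) ^+ k in hl *.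
  have A0 : 0 <= A by rewrite addr_ge0 ?nc_ge0.
  have l0 : 0 <= l by rewrite exprn_ge0 // addr_ge0 // ln_nat_ge0.
  set D := d ^+ k in dk *; set r := n.+1%:R `^ 2^-1 in hl hp.
  set u := (n%:R ^+ 2)^-1 in hn *; set v := (n.+1%:R ^+ 2)^-1 in hn hp.
  set P := _ - _ in hs *.
  have u0 : 0 <= u by rewrite invr_ge0 exprn_ge0 // ltW.
  have lu : l * u <= (c0 * 8) * P.
    apply: (@le_trans _ _ ((c0 * r) * (4 * v))); first exact: ler_pM.
    have -> : (c0 * r) * (4 * v) = c0 * 4 * (r * v) by ring.
    rewrite hp; have -> : c0 * 8 * P = c0 * 4 * (2 * P) by ring.
    by rewrite ler_wpM2l // mulr_ge0.
  have -> : 2 * (A * (D * l) * u) = 2 * D * (A * (l * u)) by ring.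
  have -> : cJ * D * (nc s + 1) * P
     = 2 * D * ((J.+1%:R * (nc s + 1)) * ((c0 * 8) * P)).
    by rewrite /cJ; set a := nc s; ring.
  rewrite ler_wpM2l ?mulr_ge0 //; apply: ler_pM => //.
  by rewrite mulr_ge0.
(* Taking k = 0 and d = 0 makes every shifted point equal to s, which yields plain convergence and
   identifies the limit with [zeta s]. *)
have cvz s : 1 <= Re s -> s != 1 -> ccvg (zpartial s) (zeta s).
  move=> s1 sn1; have [|w cw _] := tele 0%N 0 s isT (lexx 0) s1.
    by move=> i; rewrite /hstep mulr0 addr0.
  have {}cw : ccvg (zpartial s) w.
    by move: cw; rewrite /= /hstep mul0r addr0.
  by have -> : zeta s = w by rewrite /zeta; exact: ccvg_limC.
move=> k d s kJ d0 s1 sn1 n n0.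
have [w cw hw] := tele k d s kJ d0 s1 sn1.
suff -> : fdn k (fun i => zeta (hstep s d i)) 0 = w by exact: hw.
apply: ccvg_uniq cw; apply: (ccvg_fdn (u := fun n i => zpartial (hstep s d i) n)) => i.
apply: cvz => //; rewrite Re_hstep (le_trans s1) // lerDl mulr_ge0 //.
Qed.

Lemma zeta_cvg s : 1 <= Re s -> s != 1 -> ccvg (zpartial s) (zeta s).
Proof.
move=> s1 sn1; have [c c1 hc] := zeta_fdn_tail 0.
apply: (@ccvg_le _ _ _ (fun n => c * (nc s + 1) * n%:R `^ (- 2^-1))); last first.
  rewrite -(mulr0 (c * (nc s + 1))); apply: cvgM; first exact: cvg_cst.
  by apply: cvg_natpowN; rewrite invr_gt0.
near=> n; have n0 : (0 < n)%N by near: n; exact: nbhs_infty_gt.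
have := hc 0%N 0 s isT (lexx 0) s1 _ n n0; rewrite /= hstep0 expr0 mulr1 ncBC.
by apply => i; rewrite /hstep mulr0 addr0.
Unshelve. all: by end_near.
Qed.

End ZetaDifferences.

(** * Dirichlet series and the inverse of zeta for Re s > 1 *)

Section DirichletSeries.
Variable R : realType.
Implicit Types (x y : R) (s : R[i]) (k n i K d : nat).

Lemma nc_cpowN_nat s n : (0 < n)%N -> nc (cpow n%:R (- s)) = n%:R `^ (- Re s).
Proof. by move=> n0; rewrite nc_cpow_powR ?ltr0n // cReN. Qed.

Lemma dirichlet_cvg (f : nat -> R[i]) s : 1 < Re s -> (forall n, nc (f n) <= 1) ->
  exists2 w, ccvg (fun K => \sum_(1 <= n < K.+1) f n * cpow n%:R (- s)) w &
  forall K, (0 < K)%N -> nc (w - \sum_(1 <= n < K.+1) f n * cpow n%:R (- s))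
     <= (Re s - 1)^-1 * K%:R `^ (- (Re s - 1)).
Proof.
move=> s1 f1; have a0 : 0 < Re s - 1 by rewrite subr_gt0.
apply: ccvg_telescope => [n n0|]; last first.
  rewrite -(mulr0 (Re s - 1)^-1).
  by apply: cvgM; [exact: cvg_cst|exact: cvg_natpowN].
rewrite big_nat_recr //= addrAC subrr add0r (ncM (f _)) nc_cpowN_nat //.
rewrite -mulrBr; apply: le_trans (powR_step a0 n0).
have -> : 1 + (Re s - 1) = Re s by rewrite addrC subrK.
by rewrite -[leRHS]mul1r ler_wpM2r ?powR_ge0.
Qed.

Lemma zeta_series_cvg s : 1 < Re s ->
  ccvg (fun K => \sum_(1 <= n < K.+1) cpow n%:R (- s)) (zeta s).
Proof.
move=> s1; have sn1 : s != 1 by apply: contraTneq s1 => ->; rewrite ltxx.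
have E : (fun K => \sum_(1 <= n < K.+1) cpow n%:R (- s))
    = (fun K => zpartial s K + (1 - s)^-1 * cpow K%:R (1 - s)).
  by apply/funext => K; rewrite /zpartial [_^-1 * _]mulrC subrK.
rewrite E -[zeta s]addr0; apply: ccvgD; first by apply: zeta_cvg => //; exact: ltW.
rewrite -(mulr0 (1 - s)^-1); apply: ccvgZ.
apply: (@ccvg_le _ _ _ (fun K => K%:R `^ (- (Re s - 1)))).
  near=> K; have K0 : (0 < K)%N by near: K; exact: nbhs_infty_gt.
  by rewrite subr0 nc_cpow_powR ?ltr0n // cReB opprB.
by apply: cvg_natpowN; rewrite subr_gt0.
Unshelve. all: by end_near.
Qed.

Lemma zeta_series_tail s K : 1 < Re s -> (0 < K)%N ->
  nc (zeta s - \sum_(1 <= n < K.+1) cpow n%:R (- s))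
    <= (Re s - 1)^-1 * K%:R `^ (- (Re s - 1)).
Proof.
move=> s1 K0.
have [n|w cw hw] := @dirichlet_cvg (fun=> 1) s s1; first by rewrite nc1.
have E K' : \sum_(1 <= n < K'.+1) 1 * cpow n%:R (- s) = \sum_(1 <= n < K'.+1) cpow n%:R (- s).
  by apply: eq_bigr => n _; rewrite mul1r.
have -> : zeta s = w.
  by apply: ccvg_uniq (zeta_series_cvg s1) _; under eq_fun do rewrite -E.
by rewrite -E; exact: hw.
Qed.

Lemma nc_zeta_le s : 1 < Re s -> nc (zeta s) <= 1 + (Re s - 1)^-1.
Proof.
move=> s1; have := zeta_series_tail s1 (ltnSn 0).
rewrite big_nat1 powR1 mulr1 cpow1x => h.
by rewrite -lerBlDl; apply: le_trans h; rewrite -(nc1 R) nc_leB.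
Qed.

(** With the inner sum cut at K / d, the pairs (d, k) are exactly those with d k <= K, so every
    divisor sum of [mu] is complete and the identity has no error term. *)
Lemma moebius_convolution s K : (0 < K)%N ->
  \sum_(1 <= d < K.+1) (mu R d)%:C * cpow d%:R (- s)
     * (\sum_(1 <= k < (K %/ d).+1) cpow k%:R (- s)) = 1.
Proof.
move=> K0.
transitivity (\sum_(1 <= c < K.+1) \sum_(d <- divisors c) (mu R d)%:C * cpow c%:R (- s)).
  transitivity (\sum_(1 <= d < K.+1) \sum_(1 <= k < K.+1 | (d * k <= K)%N)
      (mu R d)%:C * cpow (d * k)%:R (- s)).
    apply: eq_big_nat => d /andP[d0 dK]; rewrite mulr_sumr.
    rewrite -[RHS]big_filter.
    have perm : perm_eq [seq k <- index_iota 1 K.+1 | (d * k <= K)%N]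
                       (index_iota 1 (K %/ d).+1).
      apply: uniq_perm; rewrite ?filter_uniq ?iota_uniq // => k.
      rewrite mem_filter !mem_index_iota !ltnS leq_divRL // mulnC.
      case: (posnP k) => [->|k0]; rewrite ?andbF //=.
      by case: leqP => // kdK; apply: leq_trans kdK; rewrite leq_pmulr.
    rewrite (perm_big _ perm); apply: eq_big_nat => k /andP[k0 _].
    by rewrite natrM cpowM ?ltr0n // mulrA.
  rewrite -(dirichlet_regroup K (fun d k => (mu R d)%:C * cpow (d * k)%:R (- s))).
  apply: eq_big_nat => c /andP[c0 _]; apply: eq_big_seq => d.
  by rewrite -dvdn_divisors // => dc; rewrite mulnC divnK.
rewrite big_ltn // [X in _ + X]big_nat [X in _ + X]big1 ?addr0.
  by rewrite big_seq1 cpow1x mulr1 /mu moebius1.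
move=> c /andP[c1 _]; rewrite -mulr_suml -rmorph_sum /= sum_mu 1?ltnW //.
by rewrite gtn_eqF // mul0r.
Qed.

(** Subtracting [moebius_convolution] leaves the tails of zeta beyond K / d. With a = Re s - 1,
    their weights d^{-1-a} turn (K / d)^{-a} into K^{-a} / d, and the harmonic sum costs a
    logarithm, paid for by half of the exponent a. *)
Lemma zeta_moebius_cvg s : 1 < Re s ->
  ccvg (fun K => zeta s * \sum_(1 <= d < K.+1) (mu R d)%:C * cpow d%:R (- s)) 1.
Proof.
move=> s1; set a := Re s - 1; have a0 : 0 < a by rewrite subr_gt0.
have a20 : 0 < a / 2 by rewrite divr_gt0.
have [c c1 hc] := @lnD1X_powR R (a / 2) 1 a20.
apply: (@ccvg_le _ _ _ (fun K => a^-1 * 2 `^ a * c * K%:R `^ (- (a / 2)))); last first.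
  rewrite -(mulr0 (a^-1 * 2 `^ a * c)); apply: cvgM; first exact: cvg_cst.
  exact: cvg_natpowN.
near=> K; have K0 : (0 < K)%N by near: K; exact: nbhs_infty_gt.
have Kpos : 0 < K%:R :> R by rewrite ltr0n.
rewrite -(moebius_convolution s K0) mulr_sumr -sumrB.
apply: le_trans (nc_sum _ _ _) _.
apply: (@le_trans _ _ (\sum_(1 <= d < K.+1) (a^-1 * 2 `^ a * K%:R `^ (- a)) * d%:R^-1)).
  rewrite big_nat [leRHS]big_nat; apply: ler_sum => d; rewrite ltnS => /andP[d0 dK].
  have dpos : 0 < d%:R :> R by rewrite ltr0n.
  rewrite mulrC -mulrBr (ncM ((mu R d)%:C * _)) (ncM (mu R d)%:C) nc_cpowN_nat // nc_real.
  have q0 : (0 < K %/ d)%N by rewrite divn_gt0.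
  have qpos : 0 < (K %/ d)%:R :> R by rewrite ltr0n.
  have h1 := zeta_series_tail s1 q0; rewrite -/a in h1.
  have h2 : (K %/ d)%:R `^ (- a) <= (2 * d%:R) `^ a * K%:R `^ (- a).
    rewrite !powRN ler_pdivlMr ?powR_gt0 // ler_pdivrMl ?powR_gt0 //.
    rewrite -powRM ?ler0n ?mulr_ge0 ?ler0n //.
    apply: ge0_ler_powR; rewrite ?nnegrE ?(ltW a0) ?ler0n ?mulr_ge0 ?ler0n //.
    rewrite -!natrM ler_nat {1}(divn_eq K d).
    have := ltn_pmod K d0; set q := (K %/ d)%N in q0 *; set r := (K %% d)%N => rd.
    rewrite mul2n -addnn mulnDr leq_add2l.
    by apply: leq_trans (ltnW rd) _; rewrite leq_pmull.
  apply: (@le_trans _ _ (1 * d%:R `^ (- Re s) * (a^-1 * ((2 * d%:R) `^ a * K%:R `^ (- a))))).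
    apply: ler_pM; rewrite ?nc_ge0 ?mulr_ge0 ?powR_ge0 //.
      by rewrite ler_wpM2r ?powR_ge0 // norm_mu_le1.
    by apply: le_trans h1 _; rewrite ler_pM2l ?invr_gt0.
  have -> : Re s = 1 + a by rewrite addrC subrK.
  rewrite opprD powRD; last by rewrite (gt_eqF dpos) implybT.
  rewrite powR_inv1 ?(ltW dpos) // powRM ?ler0n //.
  have dd : d%:R `^ (- a) * d%:R `^ a = 1.
    by rewrite powRN mulVf // gt_eqF // powR_gt0.
  set A := d%:R `^ (- a) in dd *; set B := d%:R `^ a in dd *.
  have -> : 1 * (d%:R^-1 * A) * (a^-1 * (2 `^ a * B * K%:R `^ (- a)))
    = a^-1 * 2 `^ a * K%:R `^ (- a) / d%:R * (A * B).
    by set u := 2 `^ a; set v := _ `^ (- a); set z := d%:R^-1; set t := a^-1; ring.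
  by rewrite dd mulr1.
rewrite -mulr_sumr.
have h := harmonic_le R K0; have := hc K%:R; rewrite expr1 ler1n => /(_ K0) h2.
have KK : K%:R `^ (- a) * K%:R `^ (a / 2) = K%:R `^ (- (a / 2)) :> R.
  rewrite -powRD; last by rewrite (gt_eqF Kpos) implybT.
  by congr (_ `^ _); field.
rewrite -KK; apply: (@le_trans _ _ (a^-1 * 2 `^ a * K%:R `^ (- a) * (c * K%:R `^ (a / 2)))).
  rewrite ler_wpM2l ?mulr_ge0 ?powR_ge0 ?invr_ge0 ?(ltW a0) //.
  exact: le_trans h h2.
by set u := 2 `^ a; set v := _ `^ (- a); set z := _ `^ (a / 2); set t := a^-1;
  apply: eqW; ring.
Unshelve. all: by end_near.
Qed.

Lemma zetaV_moebius s : 1 < Re s -> zeta s != 0 /\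
  forall K, (0 < K)%N ->
    nc ((zeta s)^-1 - \sum_(1 <= d < K.+1) (mu R d)%:C * cpow d%:R (- s))
      <= (Re s - 1)^-1 * K%:R `^ (- (Re s - 1)).
Proof.
move=> s1.
have [n|w cw hw] := @dirichlet_cvg (fun n => (mu R n)%:C) s s1.
  by rewrite nc_real norm_mu_le1.
have zw : zeta s * w = 1 by apply: ccvg_uniq (ccvgZ _ cw) (zeta_moebius_cvg s1).
have z0 : zeta s != 0.
  by apply/eqP => z0; move: zw; rewrite z0 mul0r => /esym/eqP; rewrite oner_eq0.
split => // K K0; have -> : (zeta s)^-1 = w by apply: (mulfI z0); rewrite mulfV.
exact: hw.
Qed.

Lemma nc_zetaV_le s : 1 < Re s -> nc (zeta s)^-1 <= 1 + (Re s - 1)^-1.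
Proof.
move=> s1; have [_ /(_ 1%N isT)] := zetaV_moebius s1.
rewrite big_nat1 powR1 mulr1 cpow1x mulr1 => h; rewrite -lerBlDl.
apply: le_trans h; apply: le_trans (nc_leB _ _); rewrite lerD2l lerN2 nc_real.
exact: norm_mu_le1.
Qed.

End DirichletSeries.

(** * Euler factors and the 3-4-1 inequality *)

Section ThreeFourOne.
Variable R : realType.
Implicit Types (x y : R) (s : R[i]) (k n i K d p : nat).

(* The Euler product enters here: passing from [b] to [b + 1] removes the Euler
   factor at [b] from the sum over [b]-rough integers. *)
Definition rough b n := all (leq b) (primes n).

Definition rough_term b s n : R[i] := (rough b n)%:R * cpow n%:R (- s).

Definition rough_sum b s K : R[i] := \sum_(1 <= n < K.+1) rough_term b s n.

Lemma rough_succ_nonprime b n : ~~ prime b -> rough b.+1 n = rough b n.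
Proof.
move=> pb; apply: eq_in_all => q; rewrite mem_primes => /and3P[pq _ _].
by rewrite ltn_neqAle; case: eqP pb pq => // -> /negbTE ->.
Qed.

Lemma rough_succ_prime b n : prime b -> (0 < n)%N ->
  rough b.+1 n = rough b n && ~~ (b %| n)%N.
Proof.
move=> pb n0; apply/allP/andP => [h|[/allP h bn] q qn].
  split; first by apply/allP => q /h; exact: ltnW.
  apply/negP => bn; have : b \in primes n by rewrite mem_primes pb n0.
  by move/h; rewrite ltnn.
rewrite ltn_neqAle (h q qn) andbT; apply: contraNneq bn => ->.
by move: qn; rewrite mem_primes => /and3P[].
Qed.

Lemma rough_mul b k : prime b -> (0 < k)%N -> rough b (b * k) = rough b k.
Proof.
move=> pb k0; have b0 := prime_gt0 pb; apply/allP/allP => h q qk.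
  by apply: h; rewrite primesM // qk orbT.
move: qk; rewrite primesM // => /orP[|]; last exact: h.
by rewrite primes_prime // inE => /eqP ->.
Qed.

Lemma rough_sum_step b s K : prime b ->
  rough_sum b.+1 s K = rough_sum b s K - cpow b%:R (- s) * rough_sum b s (K %/ b).
Proof.
move=> pb; have b0 := prime_gt0 pb.
apply/eqP; rewrite eq_sym subr_eq addrC; apply/eqP; rewrite /rough_sum.
rewrite [LHS](bigID (fun n => (b %| n)%N)) /=; congr (_ + _); last first.
  rewrite big_mkcond; apply: eq_big_nat => n /andP[n0 _].
  by rewrite /rough_term rough_succ_prime //; case: ifP => _;
    rewrite ?andbT // andbF mul0r.
rewrite -big_filter (perm_big _ (perm_multiples_iota K b0)) big_map.
have perm : perm_eq [seq k <- index_iota 1 K.+1 | (b * k <= K)%N]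
                   (index_iota 1 (K %/ b).+1).
  apply: uniq_perm; rewrite ?filter_uniq ?iota_uniq // => k.
  rewrite mem_filter !mem_index_iota !ltnS leq_divRL // mulnC.
  case: (posnP k) => [->|k0]; rewrite ?andbF //=.
  by case: leqP => // kdK; apply: leq_trans kdK; rewrite leq_pmulr.
rewrite (perm_big _ perm) mulr_sumr; apply: eq_big_nat => k /andP[k0 _].
by rewrite /rough_term rough_mul // natrM cpowM ?ltr0n // mulrCA.
Qed.

Lemma cvg_divn p : (0 < p)%N -> (fun K => (K %/ p)%N) K @[K --> \oo] --> \oo.
Proof.
move=> p0; apply/cvgnyPge => A; near=> K; rewrite leq_divRL //.
by near: K; exact: nbhs_infty_ge.
Unshelve. all: by end_near.
Qed.

(** The Euler product as a recursion, so that no infinite product is formed: w starts at zeta, each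
    prime multiplies by its factor, and what remains beyond Y tends to 1, since 1 is the only
    integer up to Y free of primes up to Y. *)
Lemma rough_limit s : 1 < Re s -> exists w : nat -> R[i],
  [/\ w 1%N = zeta s,
      forall b, w b.+1 = if prime b then (1 - cpow b%:R (- s)) * w b else w b &
      forall Y, (0 < Y)%N -> nc (w Y.+1 - 1) <= (Re s - 1)^-1 * Y%:R `^ (- (Re s - 1))].
Proof.
move=> s1.
have H b : exists w, ccvg (rough_sum b s) w /\ forall K, (0 < K)%N ->
    nc (w - rough_sum b s K) <= (Re s - 1)^-1 * K%:R `^ (- (Re s - 1)).
  have [n|w cw hw] := @dirichlet_cvg R (fun n => (rough b n)%:R) s s1.
    by case: (rough b n); rewrite ?nc1 ?nc0 ?ler01.
  by exists w.
have [w hw] := choice H; exists w; split.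
- have E : rough_sum 1 s = (fun K => \sum_(1 <= n < K.+1) cpow n%:R (- s)).
    apply/funext => K; apply: eq_big_nat => n _.
    rewrite /rough_term (_ : rough 1 n) ?mul1r //.
    by apply/allP => q; rewrite mem_primes => /and3P[/prime_gt0].
  apply: ccvg_uniq (zeta_series_cvg s1); rewrite -E; exact: (hw 1%N).1.
- move=> b; case: ifP => pb; last first.
    apply: ccvg_uniq (hw b.+1).1 _.
    rewrite (_ : rough_sum b.+1 s = rough_sum b s); first exact: (hw b).1.
    apply/funext => K; apply: eq_big_nat => n _.
    by rewrite /rough_term rough_succ_nonprime ?pb.
  apply: ccvg_uniq (hw b.+1).1 _.
  rewrite (_ : rough_sum b.+1 s = fun K => rough_sum b s K
     - cpow b%:R (- s) * rough_sum b s (K %/ b)); last first.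
    by apply/funext => K; exact: rough_sum_step.
  rewrite mulrBl mul1r; apply: ccvgB; first exact: (hw b).1.
  apply: ccvgZ; have := (hw b).1; rewrite /ccvg => h.
  exact: (cvg_comp _ (fun K => nc (rough_sum b s K - w b)) (cvg_divn (prime_gt0 pb)) h).
- move=> Y Y0; have := (hw Y.+1).2 Y Y0.
  rewrite (_ : rough_sum Y.+1 s Y = 1) //.
  rewrite /rough_sum big_ltn // big_nat big1 ?addr0.
    by rewrite /rough_term cpow1x mulr1.
  move=> n /andP[n1]; rewrite ltnS => nY; rewrite /rough_term (_ : rough Y.+1 n = false) ?mul0r //.
  apply/negP => /allP /(_ (pdiv n)).
  rewrite mem_primes pdiv_prime // pdiv_dvd ltnW // => /(_ isT).
  by rewrite ltnNge => /negP; apply; apply: leq_trans nY; apply: dvdn_leq; rewrite ?pdiv_dvd 1?ltnW.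
Qed.

(** By 1 + v <= exp v the logarithm of the product is at most 8 x^2 - 2 x (3 + 4 cos t + cos 2t),
    and the bracket is 2 (1 + cos t)^2 >= 0. The exponents 3, 4, 1 are doubled because squared
    moduli are compared. *)
Lemma euler_factor_341 (x t : R) (z1 z2 z3 : R[i]) :
  0 <= x ->
  nc (1 - z1) ^+ 2 = 1 - 2 * x + x ^+ 2 ->
  nc (1 - z2) ^+ 2 = 1 - 2 * x * cos t + x ^+ 2 ->
  nc (1 - z3) ^+ 2 = 1 - 2 * x * cos (t *+ 2) + x ^+ 2 ->
  nc (1 - z1) ^+ 6 * nc (1 - z2) ^+ 8 * nc (1 - z3) ^+ 2 <= expR (8 * x ^+ 2).
Proof.
move=> x0 h1 h2 h3.
have bnd c : 1 - 2 * x * c + x ^+ 2 <= expR (x ^+ 2 - 2 * x * c).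
  apply: le_trans (expR_ge1Dx _); apply: eqW; ring.
have b1 : nc (1 - z1) ^+ 2 <= expR (x ^+ 2 - 2 * x * 1).
  by have := bnd 1; rewrite h1 !mulr1.
have b2 : nc (1 - z2) ^+ 2 <= expR (x ^+ 2 - 2 * x * cos t) by rewrite h2.
have b3 : nc (1 - z3) ^+ 2 <= expR (x ^+ 2 - 2 * x * cos (t *+ 2)) by rewrite h3.
have sq (z : R[i]) : 0 <= nc z ^+ 2 by rewrite exprn_ge0 ?nc_ge0.
rewrite (exprM _ 2 3) (exprM _ 2 4).
have c1 : (nc (1 - z1) ^+ 2) ^+ 3 <= expR (x ^+ 2 - 2 * x * 1) ^+ 3.
  by rewrite lerXn2r ?nnegrE ?expR_ge0 ?sq.
have c2 : (nc (1 - z2) ^+ 2) ^+ 4 <= expR (x ^+ 2 - 2 * x * cos t) ^+ 4.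
  by rewrite lerXn2r ?nnegrE ?expR_ge0 ?sq.
apply: le_trans (ler_pM _ _ (ler_pM _ _ c1 c2) b3) _;
  rewrite ?mulr_ge0 ?exprn_ge0 ?expR_ge0 ?nc_ge0 //.
rewrite -!expRM_natl -!expRD ler_expR cos_mulr2n.
set c := cos t; have : 0 <= x * (1 + c) ^+ 2 by rewrite mulr_ge0 // sqr_ge0.
have -> : 3%:R * (x ^+ 2 - 2 * x * 1) + 4%:R * (x ^+ 2 - 2 * x * c) +
   (x ^+ 2 - 2 * x * (c ^+ 2 *+ 2 - 1)) = 8 * x ^+ 2 - 4 * (x * (1 + c) ^+ 2) by ring.
set u := x * _; set v := x ^+ 2; lra.
Qed.

Lemma nc_1Bcpow_sqr (sg t : R) p : (0 < p)%N ->
  nc (1 - cpow p%:R (- (sg +i* t))) ^+ 2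
  = 1 - 2 * p%:R `^ (- sg) * cos (t * ln p%:R) + (p%:R `^ (- sg)) ^+ 2.
Proof.
move=> p0; have p0' : p%:R == 0 :> R = false by rewrite pnatr_eq0 gtn_eqF.
rewrite nc_sqr cReB cImB /cpow /cexp /= /powR p0'.
rewrite !(mul0r, mulr0, subr0, add0r, addr0) !mulNr sinN cosN.
set E := expR _; set T := _ * ln _; have := cos2Dsin2 T.
set c := cos T; set z := sin T => h.
have -> : (1 - E * c) ^+ 2 + (- (E * - z)) ^+ 2
  = 1 - 2 * E * c + E ^+ 2 * (c ^+ 2 + z ^+ 2) by ring.
by rewrite h mulr1.
Qed.

(* The Euler factors are compared up to [exp (O(p^-2))], hence a small constant
   in place of the classical 1. *)
Lemma zeta_341 : exists2 c : R, 0 < c & forall sg t : R, 1 < sg ->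
  c <= nc (zeta (sg +i* 0)) ^+ 6 * nc (zeta (sg +i* t)) ^+ 8
       * nc (zeta (sg +i* (2 * t))) ^+ 2.
Proof.
exists (2^-1 ^+ 6 * 2^-1 ^+ 8 * 2^-1 ^+ 2 / expR 16).
  by rewrite divr_gt0 ?expR_gt0 // !mulr_gt0 // exprn_gt0 // invr_gt0.
move=> sg t sg1; rewrite ler_pdivrMr ?expR_gt0 //.
have [w1 [e1 st1 l1]] := @rough_limit (sg +i* 0) sg1.
have [w2 [e2 st2 l2]] := @rough_limit (sg +i* t) sg1.
have [w3 [e3 st3 l3]] := @rough_limit (sg +i* (2 * t)) sg1.
pose E b := nc (w1 b) ^+ 6 * nc (w2 b) ^+ 8 * nc (w3 b) ^+ 2.
have E0 b : 0 <= E b by rewrite !mulr_ge0 ?exprn_ge0 ?nc_ge0.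
have step b : (0 < b)%N -> E b.+1 <= expR (8 * b%:R `^ (- (1 + 1))) * E b.
  move=> b0; rewrite /E st1 st2 st3; case: ifP => pb; last first.
    by rewrite ler_peMl ?E0 // -expR0 ler_expR mulr_ge0 ?powR_ge0.
  rewrite !ncM !exprMn.
  set a1 := nc (1 - _) ^+ 6; set a2 := nc (1 - _) ^+ 8; set a3 := nc (1 - _) ^+ 2.
  set v1 := nc (w1 b) ^+ 6; set v2 := nc (w2 b) ^+ 8; set v3 := nc (w3 b) ^+ 2.
  have -> : a1 * v1 * (a2 * v2) * (a3 * v3) = (a1 * a2 * a3) * (v1 * v2 * v3) by ring.
  apply: ler_wpM2r; first exact: E0.
  pose x := b%:R `^ (- sg) : R.
  apply: (@le_trans _ _ (expR (8 * x ^+ 2))).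
    apply: (@euler_factor_341 x (t * ln b%:R)); first exact: powR_ge0.
    - by rewrite nc_1Bcpow_sqr // mul0r cos0 mulr1.
    - by rewrite nc_1Bcpow_sqr.
    - have -> : (t * ln b%:R) *+ 2 = 2 * t * ln b%:R by rewrite -mulrA [RHS]mulr_natl.
      by rewrite nc_1Bcpow_sqr.
  rewrite ler_expR ler_pM2l // /x -powR_mulrn ?powR_ge0 // -powRrM.
  apply: ler_powR; first by rewrite ler1n.
  by move: sg1; clear; lra.
have bound Y : E Y.+1 <= expR (8 * \sum_(1 <= b < Y.+1) b%:R `^ (- (1 + 1))) * E 1%N.
  elim: Y => [|Y IH]; first by rewrite big_geq // mulr0 expR0 mul1r.
  rewrite big_nat_recr //= mulrDr expRD mulrAC mulrC.
  apply: le_trans (step Y.+1 isT) _.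
  by rewrite ler_wpM2l ?expR_ge0.
have {}bound Y : E Y.+1 <= E 1%N * expR 16.
  apply: le_trans (bound Y) _; rewrite mulrC ler_wpM2l //.
  rewrite ler_expR -[16]/((8 * 2)%N%:R) natrM ler_pM2l //.
  by have := @sum_powR_le R 1 Y ltr01; rewrite invr1.
rewrite -e1 -e2 -e3 -/(E 1%N).
have a0 : 0 < sg - 1 by rewrite subr_gt0.
have lim0 : (fun Y : nat => (sg - 1)^-1 * Y%:R `^ (- (sg - 1))) @ \oo --> (0 : R).
  rewrite -(mulr0 (sg - 1)^-1); apply: cvgM; first exact: cvg_cst.
  exact: cvg_natpowN.
have h2 : (0 : R) < 2^-1 by rewrite invr_gt0.
move/cvgr0_norm_le : lim0 => /(_ _ h2)[N _ hN].
pose Y := N.+1; have NY : (N <= Y)%N by exact: leqnSn.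
have small (w : R[i]) : nc (w - 1) <= (sg - 1)^-1 * Y%:R `^ (- (sg - 1)) -> 2^-1 <= nc w.
  move=> h; have := le_trans (le_trans h (ler_norm _)) (hN Y NY).
  rewrite ncBC => h'; have := nc_leB 1 w; rewrite nc1 => h''.
  by have := le_trans h'' h'; clear; set u := nc w; lra.
apply: le_trans (bound Y); rewrite /E.
have hh (w : R[i]) n : 2^-1 <= nc w -> 2^-1 ^+ n <= nc w ^+ n.
  by move=> h; rewrite lerXn2r ?nnegrE ?nc_ge0 ?(ltW h2).
by apply: ler_pM; rewrite ?mulr_ge0 ?exprn_ge0 ?(ltW h2) //;
  [apply: ler_pM; rewrite ?exprn_ge0 ?(ltW h2) //|];
  apply: hh; apply: small; [exact: l1|exact: l2|exact: l3].
Qed.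

End ThreeFourOne.

(** * Bounds near the line Re s = 1 *)

Section ZetaBounds.
Variable R : realType.
Implicit Types (x y d : R) (s : R[i]) (k n i J X : nat).

Lemma nc_le_ReIm_bound s a b : `|Re s| <= a -> `|Im s| <= b -> nc s <= a + b.
Proof. by move=> h1 h2; apply: le_trans (nc_leReIm s) (lerD h1 h2). Qed.

Lemma hstep_neq1 s d : Im s != 0 -> forall i, hstep s d i != 1.
Proof.
move=> s0 i; apply: contraNneq s0 => h; have := Im_hstep s d i.
by rewrite h /= => <-.
Qed.

Lemma fdbound_hstep J s d : 0 <= d <= 1 -> Im s != 0 -> `|Re s - 1| <= J%:R + 1 ->
  fdbound J (fun i => (1 - hstep s d i)^-1) d
    ((3 * (1 + (2 * J%:R + 1) / `|Im s|)) ^+ J) `|Im s|^-1.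
Proof.
move=> /andP[d0 d1] s0 sJ; set t := `|Im s|.
have t0 : 0 < t by rewrite normr_gt0.
pose K := t + (2 * J%:R + 1); have K0 : 0 <= K by rewrite !addr_ge0 ?mulr_ge0 // ltW.
have KL : K * t^-1 = 1 + (2 * J%:R + 1) / t by rewrite mulrDl divff ?gt_eqF.
rewrite -KL -[X in fdbound _ _ _ X _]mul1r; apply: fdboundV => //.
- by rewrite invr_ge0 ltW.
- by rewrite KL lerDl divr_ge0 ?addr_ge0 ?mulr_ge0 // ltW.
- move=> k i kiJ.
  have constE m : fdn m (fun=> - d%:C) = fun=> if m is 0 then - d%:C else 0 : R[i].
    case: m => // m; rewrite fdnS (_ : fd _ = fun=> 0).
      elim: m => // m IH; rewrite fdnS (_ : fd _ = fun=> 0) //.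
      by apply/funext => j; rewrite /fd subrr.
    by apply/funext => j; rewrite /fd subrr.
  case: k kiJ => [|k] kiJ.
    rewrite expr0 mulr1 /=.
    have -> : 1 - hstep s d i = (1 - Re s - i%:R * d) +i* (- Im s).
      apply/eqP; rewrite eq_complex /= cReB Re_hstep cImB Im_hstep sub0r opprD addrA.
      by rewrite !eqxx.
    rewrite /K (addrC t); apply: nc_le_ReIm_bound => /=; last first.
      by rewrite normrN.
    have iJ : i%:R * d <= J%:R.
      rewrite -[leRHS]mulr1 ler_pM // ler_nat //.
    have id0 : 0 <= i%:R * d by rewrite mulr_ge0.
    rewrite distrC in sJ; apply: le_trans (ler_normB _ _) _.
    rewrite (ger0_norm id0); move: sJ iJ; set u := `|_|; set v := _ * d.
    by move=> h1 h2; lra.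
  rewrite mulr1 fdnS (_ : fd _ = fun=> - d%:C); last first.
    apply/funext => j; rewrite /fd /hstep -natr1 mulrDl mul1r rmorphD /=.
    by set u := (_ * d)%:C; ring.
  rewrite constE; case: (k) => [|m]; last by rewrite nc0 mulr_ge0 ?exprn_ge0.
  rewrite ncN nc_real ger0_norm // expr1 ler_peMl // /K.
  rewrite (le_trans (_ : 1 <= 2 * J%:R + 1)) // ?lerDr ?lerDl ?mulr_ge0 // ltW //.
- move=> i iJ; have h : 1 - hstep s d i != 0.
    by rewrite subr_eq0 eq_sym hstep_neq1.
  split => //; rewrite ncV lef_pV2 ?posrE ?nc_gt0 //.
  apply: le_trans (nc_ge_Im _); rewrite cImB Im_hstep /= sub0r normrN //.
Qed.

(** The discrete form of the bound log^{k+1} for the k-th derivative of zeta. With X at least (|t| +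
    2)^2 the remainder of [zeta_fdn_tail] is O(d^k); the Dirichlet sum gives L (d L)^k with L = 1 +
    ln X, and the term X^{1-s} / (1 - s) follows from the Leibniz rule, |t| >= th keeping away from
    the pole. *)
Lemma zeta_fdbound J (th : R) : 0 < th -> exists2 C : R, 1 <= C &
  forall s d X, 1 <= Re s <= 2 -> 0 <= d <= 1 -> th <= `|Im s| -> (0 < X)%N ->
    (`|Im s| + 2) ^+ 2 <= X%:R ->
  fdbound J (fun i => zeta (hstep s d i)) d (C * (1 + ln X%:R)) (C * (1 + ln X%:R)).
Proof.
move=> th0; have [c c1 hc] := zeta_fdn_tail R J.
pose q := (3 * (1 + (2 * J%:R + 1) / th)) ^+ J.
have q0 : 0 <= q.
  rewrite exprn_ge0 // mulr_ge0 // addr_ge0 // mulr_ge0 ?addr_ge0 ?mulr_ge0 //.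
  by rewrite invr_ge0 ltW.
pose C := 1 + q + th^-1 + c * (J%:R + 2).
have thV0 : 0 <= th^-1 by rewrite invr_ge0 ltW.
have cJ0 : 0 <= c * (J%:R + 2) by rewrite mulr_ge0 ?addr_ge0 // (le_trans _ c1).
have C1 : 1 <= C by rewrite /C -!addrA lerDl !addr_ge0.
exists C => // s d X /andP[s1 s2] /andP[d0 d1] ths X0 hX k i kiJ.
set L := 1 + ln X%:R.
have L1 : 1 <= L by rewrite lerDl ln_nat_ge0.
have L0 : 0 <= L by exact: le_trans L1.
have kJ : (k <= J)%N by apply: leq_trans kiJ; rewrite leq_addr.
have iJ : (i <= J)%N by apply: leq_trans kiJ; rewrite leq_addl.
have Xpos : 0 < X%:R :> R by rewrite ltr0n.
pose s' := hstep s d i.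
have -> : fdn k (fun i => zeta (hstep s d i)) i = fdn k (fun j => zeta (hstep s' d j)) 0.
  rewrite -[i in LHS]addn0 -(congr1 (@^~ 0%N) (fdn_shift k _ i)).
  by congr (fdn k _ 0); apply/funext => j; rewrite hstepD.
have Ims' : Im s' = Im s by rewrite Im_hstep.
have ims0 : 0 < `|Im s| by exact: lt_le_trans ths.
have Ims0 : Im s' != 0 by rewrite Ims' -normr_gt0.
have id0 : 0 <= i%:R * d by rewrite mulr_ge0.
have idJ : i%:R * d <= J%:R by rewrite -[leRHS]mulr1 ler_pM // ler_nat.
have Res' : 1 <= Re s' by rewrite Re_hstep (le_trans s1) // lerDl.
have Res'2 : Re s' <= J%:R + 2.
  by rewrite Re_hstep addrC; apply: lerD.
have hdiff := hc k d s' kJ d0 Res' (hstep_neq1 d Ims0) X X0.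
have dk0 : 0 <= d ^+ k by exact: exprn_ge0.
have t1 : c * d ^+ k * (nc s' + 1) * X%:R `^ (- 2^-1) <= c * (J%:R + 2) * d ^+ k.
  have hs : nc s' + 1 <= (J%:R + 2) * (`|Im s| + 2).
    have : nc s' <= (J%:R + 2) + `|Im s|.
      apply: nc_le_ReIm_bound; last by rewrite Ims'.
      by rewrite ger0_norm // (le_trans ler01).
    have j0 : 0 <= J%:R :> R by [].
    set a := nc s'; set b := `|Im s| in ims0 *; set j := J%:R in j0 * => h.
    have : 0 <= j * b by rewrite mulr_ge0 // ltW.
    have -> : (j + 2) * (b + 2) = j * b + 2 * j + 2 * b + 4 by ring.
    by clearbody a b j; lra.
  have hX2 : `|Im s| + 2 <= X%:R `^ 2^-1.
    have b0 : 0 <= `|Im s| + 2 by rewrite addr_ge0.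
    rewrite powR12_sqrt ?ler0n // -(ger0_norm b0) -sqrtr_sqr.
    exact: ler_wsqrtr.
  have hXX : X%:R `^ 2^-1 * X%:R `^ (- 2^-1) = 1 :> R.
    by rewrite powRN mulfV // gt_eqF // powR_gt0.
  have c0 : 0 <= c by exact: le_trans c1.
  apply: (@le_trans _ _ (c * d ^+ k * ((J%:R + 2) * X%:R `^ 2^-1) * X%:R `^ (- 2^-1))).
    rewrite ler_wpM2r ?powR_ge0 // ler_wpM2l ?mulr_ge0 //.
    by apply: le_trans hs _; rewrite ler_wpM2l // addr_ge0.
  rewrite -!mulrA hXX mulr1 mulrCA !mulrA le_eqVlt; apply/orP; left; apply/eqP.
  by set u := d ^+ k; set v := J%:R; ring.
pose Y := fdn k (fun j => cpow X%:R (1 - hstep s' d j) / (1 - hstep s' d j)) 0.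
pose S := \sum_(1 <= n < X.+1) fdn k (fun j => cpow n%:R (- hstep s' d j)) 0.
have E : fdn k (fun j => zpartial (hstep s' d j) X) 0 = S - Y.
  by rewrite /zpartial (congr1 (@^~ 0%N) (fdnB k _ _)) (congr1 (@^~ 0%N) (fdn_sum k _ _)).
have dl n : (0 < n <= X)%N -> nc ((n%:R `^ (- d))%:C - 1 : R[i]) <= d * L.
  move=> /andP[n0 nX]; have n1 : 1 <= n%:R :> R by rewrite ler1n.
  have -> : (n%:R `^ (- d))%:C - 1 = (n%:R `^ (- d) - 1)%:C :> R[i] by rewrite rmorphB.
  rewrite nc_real.
  have := powRN_diff_le (lexx 1) n1 d0; rewrite powR1 ln1 subr0 => h.
  apply: le_trans h _; rewrite ler_wpM2l // /L (le_trans (_ : _ <= ln X%:R)) ?lerDr //.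
  by rewrite ler_ln ?posrE ?ltr0n ?ler_nat.
have hS : nc S <= L * (d * L) ^+ k.
  apply: le_trans (nc_sum _ _ _) _.
  apply: (@le_trans _ _ (\sum_(1 <= n < X.+1) n%:R^-1 * (d * L) ^+ k)).
    rewrite big_nat [leRHS]big_nat; apply: ler_sum => n; rewrite ltnS => nX.
    have /andP[n0 _] := nX.
    rewrite fdn_cpow ?ltr0n // (ncM (cpow _ _)) ncX; apply: ler_pM; rewrite ?nc_ge0 //.
    - by rewrite exprn_ge0 ?nc_ge0.
    - by apply: nc_cpowN_le => //; rewrite ler1n.
    - by rewrite lerXn2r ?nnegrE ?nc_ge0 ?mulr_ge0 ?dl.
  rewrite -mulr_suml ler_wpM2r ?exprn_ge0 ?mulr_ge0 //.
  exact: harmonic_le.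
have hY : nc Y <= th^-1 * (d * (L + q)) ^+ k.
  have b1 : fdbound J (fun j => cpow X%:R (1 - hstep s' d j)) d L 1.
    move=> m j mjJ; rewrite mul1r.
    have -> : fdn m (fun j => cpow X%:R (1 - hstep s' d j)) j
       = X%:R%:C * fdn m (fun l => cpow X%:R (- hstep (hstep s' d j) d l)) 0.
      rewrite -[j in LHS]addn0 -(congr1 (@^~ 0%N) (fdn_shift m _ j)).
      rewrite -(congr1 (@^~ 0%N) (fdnZ m _ _)); congr (fdn m _ 0); apply/funext => l.
      by rewrite cpowD cpow_r1 // hstepD.
    rewrite fdn_cpow // (ncM X%:R%:C) (ncM (cpow _ _)) ncX nc_real ger0_norm ?ler0n //.
    have h1 : X%:R * nc (cpow X%:R (- hstep s' d j)) <= 1.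
      rewrite -ler_pdivlMl // mulr1; apply: nc_cpowN_le; first by rewrite ler1n.
      by rewrite Re_hstep (le_trans Res') // lerDl mulr_ge0.
    rewrite mulrA -[leRHS]mul1r; apply: ler_pM => //.
    - by rewrite mulr_ge0 ?nc_ge0 ?ler0n.
    - by rewrite exprn_ge0 ?nc_ge0.
    - by rewrite lerXn2r ?nnegrE ?nc_ge0 ?mulr_ge0 ?dl // X0 leqnn.
  have d01 : 0 <= d <= 1 by rewrite d0 d1.
  have rb : `|Re s' - 1| <= J%:R + 1.
    rewrite ger0_norm ?subr_ge0 //; move: Res'2; set u := Re _; set v := J%:R.
    by clear; lra.
  have b2 := fdbound_hstep d01 Ims0 rb.
  have b2' : fdbound J (fun i => (1 - hstep s' d i)^-1) d q th^-1.
    apply: (fdbound_le d0 _ _ b2); apply/andP; split.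
    - by rewrite exprn_ge0 // mulr_ge0 // addr_ge0 // mulr_ge0 ?addr_ge0 ?mulr_ge0.
    - rewrite /q; apply: lerXn2r; rewrite ?nnegrE.
      + by rewrite mulr_ge0 // addr_ge0 // mulr_ge0 ?addr_ge0 ?mulr_ge0.
      + by rewrite mulr_ge0 // addr_ge0 // mulr_ge0 ?addr_ge0 ?mulr_ge0.
      + rewrite ler_wpM2l // lerD2l ler_wpM2l ?addr_ge0 ?mulr_ge0 //.
        by rewrite lef_pV2 ?posrE ?Ims'.
    - by rewrite invr_ge0.
    - by rewrite lef_pV2 ?posrE ?Ims'.
  have := fdboundM d0 L0 q0 ler01 thV0 b1 b2'; rewrite mul1r => /(_ k 0%N).
  by rewrite addn0 => /(_ kJ).
have -> : fdn k (fun j => zeta (hstep s' d j)) 0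
   = (fdn k (fun j => zeta (hstep s' d j)) 0 - (S - Y)) + S - Y.
  by set u := fdn _ _ _; ring.
apply: le_trans (ncB _ _) _; apply: le_trans (lerD (ncD _ _) (lexx _)) _.
rewrite -E; apply: le_trans (lerD (lerD (le_trans hdiff t1) hS) hY) _.
set D := (d * (C * L)) ^+ k.
have D0 : 0 <= D by rewrite exprn_ge0 // !mulr_ge0 // (le_trans _ C1).
have CL1 : 1 <= C * L by rewrite mulr_ege1.
have CL0 : 0 <= C * L by exact: le_trans CL1.
have e x : 0 <= x <= C * L -> (d * x) ^+ k <= D.
  move=> /andP[x0 xC]; apply: lerXn2r; rewrite ?nnegrE.
  - exact: mulr_ge0.
  - exact: mulr_ge0.
  - exact: ler_wpM2l.
have e1 : d ^+ k <= D by rewrite -[d in d ^+ k]mulr1 e // ler01.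
have e2 : (d * L) ^+ k <= D by rewrite e // L0 ler_peMl.
have e3 : (d * (L + q)) ^+ k <= D.
  rewrite e // addr_ge0 //=; apply: (@le_trans _ _ ((1 + q) * L)).
    by rewrite mulrDl mul1r lerD2l ler_peMr.
  by rewrite ler_wpM2r // /C -addrA lerDl addr_ge0.
apply: (@le_trans _ _ (c * (J%:R + 2) * D + L * D + th^-1 * D)).
  by apply: lerD; [apply: lerD|]; rewrite ler_wpM2l.
rewrite -!mulrDl ler_wpM2r // /C.
have h1 : c * (J%:R + 2) <= c * (J%:R + 2) * L by rewrite ler_peMr.
have h2 : th^-1 <= th^-1 * L by rewrite ler_peMr.
have h3 : 0 <= q * L by rewrite mulr_ge0.
move: h1 h2 h3; rewrite !mulrDl mul1r; set u := c * _; set v := th^-1.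
set a := u * L; set b := v * L; set w := q * L.
by clearbody u v a b w; lra.
Qed.

End ZetaBounds.

(** * Lower bounds for zeta and differences of its inverse *)

Section ZetaInverse.
Variable R : realType.
Implicit Types (x y d : R) (s : R[i]) (k n i J X : nat).

(** At distance eta to the right of the line, 3-4-1 gives |zeta| >> eta^{3/4} L^{-1/4}, and moving
    back towards the line costs O(eta L^2) by the first-difference bound. The former wins for eta =
    q / L^9 with q small, whence the exponent 9. The condition on X involves 2 |Im s| because zeta
    is also bounded at height 2t. *)
Lemma zeta_lower (th : R) : 0 < th -> exists2 C : R, 1 <= C &
  forall s X, 1 <= Re s -> th <= `|Im s| -> (0 < X)%N ->
    (2 * `|Im s| + 2) ^+ 2 <= X%:R ->
  zeta s != 0 /\ nc (zeta s)^-1 <= C * (1 + ln X%:R) ^+ 9.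
Proof.
move=> th0; have [C C1 hC] := zeta_fdbound 1 th0.
have [c c0 hc] := zeta_341 R.
have C0 : 0 < C by exact: lt_le_trans C1.
(* The target (2 C^2 L^2 eta)^8 <= c eta^6 / (2^6 (C L)^2) becomes q^2 W <= c for eta = q / L^9: the
   powers of L cancel. *)
pose W := 2 ^+ 14 * C ^+ 18.
have W0 : 0 < W by rewrite mulr_gt0 // exprn_gt0.
pose q := Num.min 1 (c / W).
have q0 : 0 < q by rewrite lt_min ltr01 divr_gt0.
have q1 : q <= 1 by rewrite ge_min lexx.
have qW : q ^+ 2 * W <= c.
  rewrite -ler_pdivlMr // expr2 -[leRHS]mul1r.
  by apply: ler_pM; rewrite ?(ltW q0) // ge_min lexx orbT.
exists (2 / q); first by rewrite ler_pdivlMr // mul1r (le_trans q1) // ler1n.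
move=> [sg t] X s1 tht X0 hX.
have {}s1 : 1 <= sg by [].
have {}tht : th <= `|t| by [].
have {}hX : (2 * `|t| + 2) ^+ 2 <= X%:R by [].
set L := 1 + ln X%:R.
have L1 : 1 <= L by rewrite lerDl ln_nat_ge0.
have L0 : 0 < L by exact: lt_le_trans L1.
have L9 : 1 <= L ^+ 9 by exact: exprn_ege1.
have L90 : 0 < L ^+ 9 by exact: lt_le_trans L9.
pose eta := q / L ^+ 9.
have eta0 : 0 < eta by rewrite divr_gt0.
have eta1 : eta <= 1 by rewrite ler_pdivrMr // mul1r (le_trans q1).
have etaV : 2 * eta^-1 = 2 / q * L ^+ 9 by rewrite /eta invf_div mulrA mulrAC.
have t2 : `|2 * t| = 2 * `|t| by rewrite normrM ger0_norm.
have hX1 : (`|t| + 2) ^+ 2 <= X%:R.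
  apply: le_trans hX; apply: lerXn2r; rewrite ?nnegrE ?addr_ge0 ?mulr_ge0 //.
  by rewrite lerD2r ler_peMl // ler1n.
have upper (u : R) s' : 1 <= Re s' <= 2 -> Im s' = u -> th <= `|u| ->
    (`|u| + 2) ^+ 2 <= X%:R -> nc (zeta s') <= C * L.
  move=> rs ims thu hu; have d01 : 0 <= (0 : R) <= 1 by rewrite lexx ler01.
  have := hC s' 0 X rs d01; rewrite ims => /(_ thu X0 hu 0%N 0%N isT).
  by rewrite /= hstep0 expr0 mulr1.
have lip (x y : R) : 1 <= x -> x <= y -> y <= 2 ->
    nc (zeta (y +i* t) - zeta (x +i* t)) <= C * L * ((y - x) * (C * L)).
  move=> x1 xy y2; have d01 : 0 <= y - x <= 1.
    by rewrite subr_ge0 xy /=; move: x1 xy y2; clear; lra.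
  have x12 : 1 <= Re (x +i* t) <= 2 by rewrite /= x1 (le_trans xy).
  have := hC (x +i* t) (y - x) X x12 d01 tht X0 hX1 1%N 0%N isT.
  rewrite expr1 /= /fd hstep0.
  rewrite (_ : hstep _ _ 1 = y +i* t) //; apply/eqP; rewrite eq_complex /=.
  by rewrite mul1r addr0 addrC subrK !eqxx.
have low : 2 * (C ^+ 2 * L ^+ 2 * eta) <= nc (zeta ((1 + eta) +i* t)).
  have se : 1 < 1 + eta by rewrite ltrDl.
  have h := hc (1 + eta) t se.
  set z := nc (zeta (_ +i* t)) in h *.
  have z0 : 0 <= z by exact: nc_ge0.
  have h1 : nc (zeta ((1 + eta) +i* 0)) <= 2 / eta.
    apply: le_trans (nc_zeta_le _) _; first by [].
    rewrite /= addrAC subrr add0r -[leRHS]mulrC mulr_natr mulr2n lerD2r.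
    by rewrite invf_ge1.
  have h3 : nc (zeta ((1 + eta) +i* (2 * t))) <= C * L.
    apply: (@upper (2 * t)) => //.
    - by rewrite /= (ltW se) -[2]/(1 + 1) lerD2l.
    - by rewrite t2 (le_trans tht) // ler_peMl // ler1n.
    - by rewrite t2.
  have h' : c <= (2 / eta) ^+ 6 * z ^+ 8 * (C * L) ^+ 2.
    apply: le_trans h _; apply: ler_pM; rewrite ?mulr_ge0 ?exprn_ge0 ?nc_ge0 //.
      by rewrite ler_wpM2r ?exprn_ge0 // lerXn2r ?nnegrE ?nc_ge0 // divr_ge0 // (ltW eta0).
    by rewrite lerXn2r ?nnegrE ?nc_ge0 // mulr_ge0 // ltW.
  have CL0 : 0 < C * L by rewrite mulr_gt0.
  have y0 : 0 <= 2 * (C ^+ 2 * L ^+ 2 * eta).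
    by rewrite mulr_ge0 // ltW // mulr_gt0 // mulr_gt0 ?exprn_gt0.
  rewrite -(ler_pXn2r (_ : 0 < 8)%N) ?nnegrE //.
  have e6 : 0 < eta ^+ 6 / (2 ^+ 6 * (C * L) ^+ 2).
    apply: divr_gt0; first exact: exprn_gt0.
    by apply: mulr_gt0; exact: exprn_gt0.
  apply: (@le_trans _ _ (c * (eta ^+ 6 / (2 ^+ 6 * (C * L) ^+ 2)))); last first.
    rewrite -ler_pdivlMr // ; apply: le_trans h' _.
    apply: eqW.
    have cl0 := lt0r_neq0 CL0; have et0 := lt0r_neq0 eta0.
    move: cl0 et0; move: (C * L) (eta) => u v u0 v0.
    by field; rewrite u0 v0.
  apply: (@le_trans _ _ ((q ^+ 2 * W) * (eta ^+ 6 / (2 ^+ 6 * (C * L) ^+ 2)))).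
    apply: eqW; rewrite /W /eta.
    have c0' := lt0r_neq0 C0; have l0' := lt0r_neq0 L0.
    move: c0' l0'; move: (C) (L) (q) => u v w u0 v0.
    by field; rewrite u0 v0.
  by rewrite ler_wpM2r // ltW.
(* Left of 1 + eta the lower bound is transported by [lip]; to the right the Moebius series already
   bounds the inverse by 1 + 1 / eta. *)
have [sge|sge] := leP sg (1 + eta).
  have sg2 : 1 + eta <= 2 by rewrite -[2]/(1 + 1) lerD2l.
  have hl := lip sg (1 + eta) s1 sge sg2.
  have zl : C ^+ 2 * L ^+ 2 * eta <= nc (zeta (sg +i* t)).
    have h1 := nc_leB (zeta ((1 + eta) +i* t)) (zeta (sg +i* t)).
    have h2 : C * L * ((1 + eta - sg) * (C * L)) <= C ^+ 2 * L ^+ 2 * eta.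
      have -> : C * L * ((1 + eta - sg) * (C * L)) = C ^+ 2 * L ^+ 2 * (1 + eta - sg) by ring.
      rewrite ler_wpM2l ?mulr_ge0 ?exprn_ge0 ?(ltW L0) ?(ltW C0) //.
      by move: s1; clear; lra.
    move: low (le_trans h1 (le_trans hl h2)).
    move: (nc _) (nc _) (C ^+ 2 * L ^+ 2 * eta) => A B P; clear; lra.
  have zl0 : 0 < C ^+ 2 * L ^+ 2 * eta.
    by apply: mulr_gt0 => //; apply: mulr_gt0; exact: exprn_gt0.
  have z0 : 0 < nc (zeta (sg +i* t)) by exact: lt_le_trans zl.
  split; first by rewrite -nc_gt0.
  rewrite ncV; apply: (@le_trans _ _ eta^-1).
    rewrite lef_pV2 ?posrE //; apply: le_trans zl; rewrite ler_peMl ?(ltW eta0) //.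
    by rewrite mulr_ege1 // exprn_ege1.
  by rewrite -etaV ler_peMl ?invr_ge0 ?(ltW eta0) // ler1n.
have sg1 : 1 < sg by apply: lt_trans sge; rewrite ltrDl.
split; first by have [] := @zetaV_moebius R (sg +i* t) sg1.
apply: le_trans (nc_zetaV_le _) _; first by [].
rewrite /=; apply: (@le_trans _ _ (1 + eta^-1)).
  by rewrite lerD2l lef_pV2 ?posrE ?subr_gt0 // lerBrDl ltW.
apply: (@le_trans _ _ (2 * eta^-1)).
  by rewrite mulr_natl mulr2n lerD2r invf_ge1.
by rewrite etaV.
Qed.

Lemma zetaV_fdn J (th : R) : 0 < th -> exists2 C : R, 1 <= C & exists A : nat,
  forall s d X, 1 <= Re s <= 2 -> 0 <= d <= 1 -> th <= `|Im s| -> (0 < X)%N ->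
    (2 * `|Im s| + 2) ^+ 2 <= X%:R ->
  nc (zeta s)^-1 <= C * (1 + ln X%:R) ^+ A /\
  nc (fdn J (fun i => (zeta (hstep s d i))^-1) 0) <= C * d ^+ J * (1 + ln X%:R) ^+ A.
Proof.
move=> th0; have [C C1 hC] := zeta_fdbound J th0.
have [C' C'1 hC'] := zeta_lower th0.
have C'0 : 0 <= C' by exact: le_trans C'1.
pose B := C * (3 * (C * C')) ^+ J.
have CC1 : 1 <= C * C' by exact: mulr_ege1.
have B1 : 1 <= B by rewrite mulr_ege1 // exprn_ege1 // mulr_ege1 // ler1n.
exists (C' * B ^+ J); first by rewrite mulr_ege1 // exprn_ege1.
(* In [fdboundV] the rate is C L (3 C L C' L^9)^J, of degree 1 + 10 J in L; it is raised to the
   power J, and the inverse itself contributes L^9. *)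
exists (9 + (1 + 10 * J) * J)%N => s d X /andP[s1 s2] /andP[d0 d1] ths X0 hX.
set L := 1 + ln X%:R.
have L1 : 1 <= L by rewrite lerDl ln_nat_ge0.
have L0 : 0 <= L by exact: le_trans L1.
have hX1 : (`|Im s| + 2) ^+ 2 <= X%:R.
  apply: le_trans hX; apply: lerXn2r; rewrite ?nnegrE ?addr_ge0 ?mulr_ge0 //.
  by rewrite lerD2r ler_peMl // ler1n.
have hlow i : zeta (hstep s d i) != 0 /\ nc (zeta (hstep s d i))^-1 <= C' * L ^+ 9.
  apply: hC' => //; rewrite ?Im_hstep //.
  by rewrite Re_hstep (le_trans s1) // lerDl mulr_ge0.
split.
  have [_] := hlow 0%N; rewrite hstep0 => h; apply: le_trans h _.
  apply: ler_pM; rewrite ?exprn_ge0 //.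
    by rewrite ler_peMr // exprn_ege1.
  by apply: ler_weXn2l => //; rewrite leq_addr.
have s12 : 1 <= Re s <= 2 by rewrite s1 s2.
have d01 : 0 <= d <= 1 by rewrite d0 d1.
have hb := hC s d X s12 d01 ths X0 hX1; rewrite -/L in hb.
have L9 : 1 <= L ^+ 9 by exact: exprn_ege1.
have CL1 : 1 <= C * L by exact: mulr_ege1.
have CL0 : 0 <= C * L by exact: le_trans CL1.
have CL90 : 0 <= C' * L ^+ 9 by rewrite mulr_ge0 // exprn_ge0.
have KL1 : 1 <= C * L * (C' * L ^+ 9) by rewrite mulr_ege1 // mulr_ege1.
have := fdboundV d0 CL1 CL0 CL90 KL1 hb (fun i _ => hlow i).
move=> /(_ J 0%N); rewrite addn0 => /(_ (leqnn _)) h.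
apply: le_trans h _; apply: eqW.
have -> : C * L * (3 * (C * L * (C' * L ^+ 9))) ^+ J = B * L ^+ (1 + 10 * J).
  have -> : 3 * (C * L * (C' * L ^+ 9)) = (3 * (C * C')) * L ^+ 10.
    by clear; move: (C) (L) (C') => u v w; ring.
  by rewrite exprMn -exprM /B exprD expr1 mulrACA.
have -> : (d * (B * L ^+ (1 + 10 * J))) ^+ J = d ^+ J * (B ^+ J * L ^+ ((1 + 10 * J) * J)).
  by rewrite exprMn (exprMn _ B) -(exprM L).
rewrite (exprD L 9).
by move: (B ^+ J) (d ^+ J) (L ^+ ((1 + 10 * J) * J)) (L ^+ 9) => u v w y; ring.
Qed.

(** Near s = 1 the pole dominates: zeta differs from 1 + 1 / (s - 1) by at most c (|s| + 1) <= 3 c,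
    so |zeta| >= 1 once |s - 1| <= 2 th = 1 / (2 + 3 c). At the other points of the strip Re s - 1
    exceeds th. *)
Lemma zetaV_near1 : exists th : R, [/\ 0 < th, th <= 1 & exists2 C : R, 1 <= C &
  forall s, 1 <= Re s -> `|Im s| <= th -> nc (zeta s)^-1 <= C].
Proof.
have [c c1 hc] := zeta_fdn_tail R 0.
have c0 : 0 < c by exact: lt_le_trans c1.
pose th := (2 * (2 + 3 * c))^-1.
have D0 : 0 < 2 * (2 + 3 * c) by rewrite mulr_gt0 // addr_gt0 // mulr_gt0.
have th0 : 0 < th by rewrite invr_gt0.
have th4 : th <= 4^-1.
  rewrite lef_pV2 ?posrE //; move: c0; clear; lra.
have th1 : th <= 1 by move: th4; clear; lra.
have thV0 : 0 < th^-1 by rewrite invr_gt0.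
exists th; split => //.
(* At s = 1 the value of [zeta] is a default about which nothing is known; its inverse is put into
   the constant so that the bound holds at every point. *)
exists (1 + th^-1 + nc (zeta (1 : R[i]))^-1).
  by rewrite -addrA lerDl addr_ge0 ?nc_ge0 // ltW.
move=> s s1 sth; have [->|sn1] := eqVneq s 1.
  by rewrite lerDr addr_ge0 // ltW.
have [sm|sm] := leP (nc (s - 1)) (2 * th); last first.
  have h := nc_leReIm (s - 1); rewrite cReB cImB /= subr0 in h.
  have h' : th < Re s - 1.
    move: h; rewrite ger0_norm ?subr_ge0 // => h.
    by move: h sm sth; set u := nc _; set v := `|_|; set w := Re s; clear; lra.
  apply: le_trans (nc_zetaV_le _) _.
    by rewrite -subr_gt0; apply: lt_trans h'.
  rewrite -addrA lerD2l (@le_trans _ _ th^-1) ?lerDl ?nc_ge0 //.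
  by rewrite lef_pV2 ?posrE // ?(ltW h') // (lt_trans th0).
have hs := hc 0%N 0 s isT (lexx 0) s1 _ 1%N isT.
have {}hs : nc (zeta s - zpartial s 1) <= c * (nc s + 1).
  move: hs; rewrite /= hstep0 expr0 mulr1 powR1 mulr1; apply.
  by move=> i; rewrite /hstep mulr0 addr0.
have s10 : 0 < nc (s - 1) by rewrite nc_gt0 subr_eq0.
have E : zpartial s 1 = 1 + (s - 1)^-1.
  have sV : (1 - s)^-1 = - (s - 1)^-1 by rewrite -invrN opprB.
  by rewrite /zpartial big_nat1 !cpow1x div1r sV opprK.
have ns : nc s <= 2.
  have := ncD (s - 1) 1; rewrite subrK nc1 => h; apply: le_trans h _.
  by move: sm th4; set u := nc _; clear; lra.
have hz : 1 <= nc (zeta s).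
  have h1 : nc (s - 1)^-1 >= (2 * th)^-1.
    by rewrite ncV lef_pV2 ?posrE ?mulr_gt0.
  have h2 : (2 * th)^-1 = 2 + 3 * c.
    rewrite /th; have := lt0r_neq0 D0; clear; move: (2 + 3 * c) => u.
    by rewrite mulf_eq0 negb_or => /andP[_ u0]; field.
  have h3 : nc (s - 1)^-1 <= nc (zeta s) + 1 + c * 3.
    have -> : (s - 1)^-1 = zeta s - 1 - (zeta s - zpartial s 1).
      by rewrite E; set u := _^-1; ring.
    apply: le_trans (ncB _ _) _; apply: lerD.
      by apply: le_trans (ncB _ _) _; rewrite nc1.
    apply: le_trans hs _; rewrite ler_wpM2l ?(ltW c0) //.
    by move: ns; clear; lra.
  move: h1 h2 h3; set u := nc _; set v := nc _; set w := _^-1.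
  by clear; lra.
rewrite ncV -addrA (@le_trans _ _ 1) //.
  by rewrite invf_le1 // (lt_le_trans ltr01).
by rewrite lerDl addr_ge0 ?nc_ge0 // ltW.
Qed.

End ZetaInverse.

(** * Gaussian integrals *)

Section GaussianFourier.
Variable R : realType.
Implicit Types (T M t lam th : R).
Local Notation leb := (@lebesgue_measure R).

Definition gauss T M t : R := expR (- ((t - T) ^+ 2 / M ^+ 2)).

Lemma gauss_ge0 T M t : 0 <= gauss T M t.
Proof. exact: expR_ge0. Qed.

Lemma is_derive_gauss T M t :
  is_derive t 1 (gauss T M) (- (2 * (t - T) / M ^+ 2) * gauss T M t).
Proof.
have d1 : is_derive t 1 (fun t => - (M ^+ 2)^-1 * ((t - T) * (t - T))) (- (2 * (t - T) / M ^+ 2)).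
  have d0 : is_derive t 1 (fun t => t - T) 1.
    rewrite -[X in is_derive _ _ _ X]subr0.
    exact: (is_deriveB (is_derive_id t 1) (is_derive_cst T t 1)).
  apply: (is_derive_eq (is_deriveZ (- (M ^+ 2)^-1) (is_deriveM d0 d0))); rewrite /GRing.scale /=; set u := (M ^+ 2)^-1; ring.
have -> : gauss T M = expR \o (fun t => - (M ^+ 2)^-1 * ((t - T) * (t - T))).
  by apply/funext => x; rewrite /gauss /= expr2 mulNr [_ * (_ * _)]mulrC.
by rewrite mulrC; apply: is_derive1_comp.
Qed.

Lemma continuous_gauss T M : continuous (gauss T M).
Proof.
move=> t; apply: differentiable_continuous; apply/derivable1_diffP.
by case: (is_derive_gauss T M t).
Qed.

Lemma measurable_continuous (f : R -> R) : continuous f -> measurable_fun [set: R] f.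
Proof. exact: continuous_measurable_fun. Qed.

(** [gauss T M] is sqrt(pi) M times the normal density of mean T and variance M^2 / 2. *)
Lemma integral_gauss T M : 0 < M ->
  leb.-integrable [set: R] (EFin \o gauss T M) /\
  (\int[leb]_t (gauss T M t)%:E = (Num.sqrt pi * M)%:E)%E.
Proof.
move=> M0; pose s := M / Num.sqrt 2.
have s2 : s ^+ 2 *+ 2 = M ^+ 2.
  rewrite /s expr_div_n sqr_sqrtr ?ler0n //; set u := M ^+ 2.
  by rewrite -mulr_natr divfK.
have s0 : s != 0 by rewrite mulf_neq0 ?gt_eqF // invr_gt0 sqrtr_gt0.
have pk : normal_peak s = (Num.sqrt pi * M)^-1.
  rewrite /normal_peak -mulrnAl s2 mulrC sqrtrM ?pi_ge0 // sqrtr_sqr.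
  by rewrite gtr0_norm.
have pk0 : Num.sqrt pi * M != 0.
  by rewrite mulf_neq0 ?gt_eqF // sqrtr_gt0 pi_gt0.
have E : (fun t => (gauss T M t)%:E)
   = (fun t => (Num.sqrt pi * M)%:E * (normal_pdf T s t)%:E)%E.
  apply/funext => t; rewrite normal_pdfE // /normal_fun s2 -EFinM pk mulrA.
  by rewrite mulfV // mul1r /gauss mulNr.
have ip := integrable_normal_pdf T s.
split; first by rewrite /comp E; apply: integrableZl.
by rewrite E integralZl // integral_normal_pdf mule1.
Qed.

Lemma integrable_gauss_le (f : R -> R) (c : R) T M : 0 < M ->
  continuous f -> (forall t, `|f t| <= c * gauss T M t) ->
  leb.-integrable [set: R] (EFin \o f).
Proof.
move=> M0 cf hf; have [iG _] := integral_gauss T M0.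
apply: (@le_integrable _ _ _ leb _ measurableT _ (fun t => c%:E * (gauss T M t)%:E)%E).
- by apply/measurable_EFinP; exact: measurable_continuous.
- move=> t _; rewrite /= lee_fin; apply: le_trans (hf t) _; exact: ler_norm.
- exact: integrableZl.
Qed.

(** The fundamental theorem on growing intervals, followed by dominated convergence; this is the
    boundary-free integration by parts needed for the Fourier transform. *)
Lemma integral_derive0 (F f : R -> R) :
  (forall t, is_derive t 1 F (f t)) -> continuous f ->
  leb.-integrable [set: R] (EFin \o f) ->
  F n%:R @[n --> \oo] --> (0 : R) -> F (- n%:R) @[n --> \oo] --> (0 : R) ->
  (\int[leb]_t (f t)%:E = 0)%E.
Proof.
move=> dF cf fi Fp Fn.
(* The endpoints use n + 1 so that the interval is never reduced to a point. *)
pose A (n : nat) : set R := `[- n.+1%:R, n.+1%:R]%classic.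
pose g n t := (f t * \1_(A n) t)%:E.
have mA n : measurable (A n) by exact: measurable_itv.
have mf : measurable_fun [set: R] (EFin \o f) by exact: measurable_int fi.
have mg n : measurable_fun [set: R] (g n).
  apply/measurable_EFinP; apply: measurable_funM.
    exact: measurable_continuous.
  exact: measurable_indic.
have gcv t : g n t @[n --> \oo] --> (f t)%:E.
  apply: cvg_near_cst; near=> n; rewrite /g indicE mem_set ?mulr1 //.
  rewrite /A /= in_itv /= -ler_norml; apply: (@le_trans _ _ n%:R).
    by near: n; exact: nbhs_infty_ger.
  by rewrite ler_nat.
have gle t (n : nat) : (`|g n t| <= `|(f t)%:E|)%E.
  rewrite /g /= lee_fin normrM ler_piMr // indicE.
  by case: (_ \in _); rewrite ?normr0 ?normr1 ?ler01.
have gcv' : {ae leb, forall t, [set: R] t -> g ^~ t @ \oo --> (EFin \o f) t}.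
  by apply: aeW => t _; exact: gcv.
have fi' : leb.-integrable [set: R] (abse \o (EFin \o f)).
  exact: integrable_abse.
have gle' : {ae leb, forall t n, [set: R] t -> (`|g n t| <= (abse \o (EFin \o f)) t)%E}.
  by apply: aeW => t n _; exact: gle.
have [_ _ h] := @dominated_convergence _ _ _ leb [set: R] measurableT g
  (EFin \o f) (abse \o (EFin \o f)) mg mf gcv' fi' gle'.
have gE n : (\int[leb]_t g n t = (F n.+1%:R - F (- n.+1%:R))%:E)%E.
  rewrite (_ : g n = (EFin \o f) \_ (A n)); last first.
    apply/funext => t; rewrite /g patchE indicE.
    by case: (t \in A n); rewrite ?mulr1 ?mulr0.
  rewrite -integral_mkcond EFinB; apply: continuous_FTC2.
  - by rewrite (lt_le_trans (_ : _ < 0)) // ltrNl oppr0.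
  - exact: continuous_subspaceT.
  - have dc x : {for x, continuous F}.
      by apply: differentiable_continuous; apply/derivable1_diffP; case: (dF x).
    split.
    + by move=> x _; case: (dF x).
    + by apply: cvg_at_right_filter; exact: dc.
    + by apply: cvg_at_left_filter; exact: dc.
  - by move=> x _; rewrite derive1E; case: (dF x).
have lim0 : (\int[leb]_t g n t)%E @[n --> \oo] --> (0 : R)%:E.
  under eq_fun do rewrite gE.
  apply: cvg_EFin; first by near=> n.
  rewrite /= -[X in _ --> X](subr0 (0 : R)).
  by apply: cvgB; [rewrite (cvg_shiftS (fun n => F n%:R))
                  |rewrite (cvg_shiftS (fun n => F (- n%:R)))].
exact: (cvg_unique _ h lim0).
Unshelve. all: by end_near.
Qed.

End GaussianFourier.

(** * The Fourier transform of a Gaussian *)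

Section GaussianFourierTransform.
Variable R : realType.
Variables (T M th : R).
Hypothesis M0 : 0 < M.
Local Notation leb := (@lebesgue_measure R).
Implicit Types t lam : R.

Let G := gauss T M.
(** The free phase [th] serves to recentre one and the same cosine at T and at -T, the two bumps of
    h. *)
Let phase lam t := lam * (t - T) + th.

Let is_derive_phase_t lam t : is_derive t 1 (phase lam) lam.
Proof.
have d0 : is_derive t 1 (fun t => t - T) 1.
  rewrite -[X in is_derive _ _ _ X]subr0.
  exact: (is_deriveB (is_derive_id t 1) (is_derive_cst T t 1)).
apply: (is_derive_eq (is_deriveD (is_deriveZ lam d0) (is_derive_cst th t 1))).
by rewrite addr0 /GRing.scale /= mulr1.
Qed.

Let is_derive_phase_lam lam t : is_derive lam 1 (phase ^~ t) (t - T).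
Proof.
have E : phase ^~ t = (fun x => (t - T) * x + th).
  by apply/funext => x; rewrite /phase mulrC.
rewrite E; apply: (is_derive_eq (is_deriveD (is_deriveZ (t - T) (is_derive_id lam 1))
  (is_derive_cst th lam 1))).
by rewrite addr0 /GRing.scale /= mulr1.
Qed.

Let continuous_of_derive (f : R -> R) : (forall t, exists l, is_derive t 1 f l) -> continuous f.
Proof.
move=> h t; apply: differentiable_continuous; apply/derivable1_diffP.
by have [l] := h t; case.
Qed.

Let is_derive_sin_t lam t :
  is_derive t 1 (fun t => sin (phase lam t)) (lam * cos (phase lam t)).
Proof. by rewrite mulrC; apply: (@is_derive1_comp _ sin (phase lam)). Qed.

Let is_derive_cos_t lam t :
  is_derive t 1 (fun t => cos (phase lam t)) (lam * - sin (phase lam t)).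
Proof. by rewrite mulrC; apply: (@is_derive1_comp _ cos (phase lam)). Qed.

Let f lam t := G t * cos (phase lam t).
Let g lam t := (t - T) * G t * sin (phase lam t).

Let continuous_f lam : continuous (f lam).
Proof.
move=> t; apply: cvgM; first exact: continuous_gauss.
by apply: continuous_of_derive => x; eexists; exact: is_derive_cos_t.
Qed.

Let continuous_g lam : continuous (g lam).
Proof.
move=> t; apply: cvgM; last first.
  by apply: continuous_of_derive => x; eexists; exact: is_derive_sin_t.
apply: cvgM; last exact: continuous_gauss.
by apply: cvgB; [exact: cvg_id|exact: cvg_cst].
Qed.

Let M2_gt0 : 0 < M * Num.sqrt 2.
Proof. by rewrite mulr_gt0 // sqrtr_gt0. Qed.

(** With y = (t - T) / M this is |y| exp (-y^2) <= exp (-y^2 / 2): widening the Gaussian by sqrt 2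
    pays for the linear factor and leaves an integrable majorant, uniform in the frequency. *)
Lemma gauss_moment_le t : `|(t - T) * gauss T M t| <= M * gauss T (M * Num.sqrt 2) t.
Proof.
rewrite normrM (ger0_norm (gauss_ge0 _ _ _)) /gauss exprMn sqr_sqrtr ?ler0n //.
pose y := (t - T) / M; have yE : t - T = M * y by rewrite /y mulrC divfK ?gt_eqF.
have e1 : (t - T) ^+ 2 / M ^+ 2 = y ^+ 2 by rewrite /y expr_div_n.
have e2 : (t - T) ^+ 2 / (M ^+ 2 * 2) = y ^+ 2 / 2 by rewrite -e1 invfM mulrA.
rewrite e1 e2 [X in `|X|]yE normrM gtr0_norm // -mulrA ler_pM2l //.
have h1 := expR_ge1Dx (y ^+ 2 / 2).
have h2 : `|y| <= 1 + y ^+ 2 / 2.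
  have := sqr_ge0 (`|y| - 1); rewrite -(real_normK (num_real y)).
  by move: `|y| => u; rewrite sqrrB; nra.
have -> : - (y ^+ 2 / 2) = y ^+ 2 / 2 + - y ^+ 2 by field.
by rewrite expRD ler_wpM2r ?expR_ge0 // (le_trans h2).
Qed.

Let integrable_f lam : leb.-integrable [set: R] (EFin \o f lam).
Proof.
apply: (@integrable_gauss_le _ _ 1 T M) => // t.
rewrite mul1r /f normrM (ger0_norm (gauss_ge0 _ _ _)) ler_piMr ?gauss_ge0 //.
exact: cos_max.
Qed.

Let g_le lam t : `|g lam t| <= M * gauss T (M * Num.sqrt 2) t.
Proof.
rewrite /g normrM; apply: le_trans (gauss_moment_le t).
by rewrite ler_piMr // sin_max.
Qed.

Let integrable_g lam : leb.-integrable [set: R] (EFin \o g lam).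
Proof. exact: (@integrable_gauss_le _ _ M T (M * Num.sqrt 2)). Qed.

Let cvg_gauss (u : nat -> R) : (forall n, `|u n| = n%:R) -> G (u n) @[n --> \oo] --> (0 : R).
Proof.
move=> hu; apply: (@cvg_dist_le _ _ (fun n => 4 * M ^+ 2 * n%:R `^ (- 1))); last first.
  rewrite -(mulr0 (4 * M ^+ 2)); apply: cvgM; first exact: cvg_cst.
  exact: cvg_natpowN.
near=> n; rewrite subr0 (ger0_norm (gauss_ge0 _ _ _)).
have n1 : (1 : R) <= n%:R by near: n; exact: nbhs_infty_ger.
have nT : 2 * `|T| <= n%:R by near: n; exact: nbhs_infty_ger.
have n0 : 0 < n%:R :> R by exact: lt_le_trans n1.
have h : n%:R / 2 <= `|u n - T|.
  have := lerB_dist (u n) T; rewrite hu; move: nT; set a := `|T|; set b := `|_|.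
  by move: (n%:R : R) => v; lra.
have h2 : n%:R / 4 <= (u n - T) ^+ 2.
  rewrite -(real_normK (num_real (u n - T))).
  apply: (@le_trans _ _ ((n%:R / 2) ^+ 2)).
    by move: (n%:R : R) n1 => v v1; nra.
  by rewrite lerXn2r ?nnegrE // divr_ge0 // ltW.
have x0 : 0 < n%:R / 4 / M ^+ 2 by rewrite !divr_gt0 // exprn_gt0.
rewrite /G /gauss expRN; apply: (@le_trans _ _ (n%:R / 4 / M ^+ 2)^-1).
  rewrite lef_pV2 ?posrE ?expR_gt0 //; apply: (@le_trans _ _ ((u n - T) ^+ 2 / M ^+ 2)).
    by rewrite ler_wpM2r ?invr_ge0 ?exprn_ge0 // ltW.
  by apply: le_trans (expR_ge1Dx _); rewrite lerDr.
rewrite powR_inv1 ?(ltW n0) //.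
have := lt0r_neq0 M0; have := lt0r_neq0 n0; move: (n%:R : R) (M) => a b a0 b0.
by apply: eqW; field; rewrite a0 b0.
Unshelve. all: by end_near.
Qed.

Let by_parts lam :
  \int[leb]_t g lam t = M ^+ 2 / 2 * lam * \int[leb]_t f lam t.
Proof.
pose F t := G t * sin (phase lam t).
pose df t := - 2 / M ^+ 2 * g lam t + lam * f lam t.
have dF t : is_derive t 1 F (df t).
  apply: (is_derive_eq (is_deriveM (is_derive_gauss T M t) (is_derive_sin_t lam t))).
  rewrite /df /g /f /GRing.scale /=; set u := (M ^+ 2)^-1; set x := G t.
  rewrite -/(G t) -/x; ring.
have cdf : continuous df.
  move=> t; apply: cvgD; (apply: cvgM; first exact: cvg_cst).
    exact: continuous_g.
  exact: continuous_f.
have i1 : leb.-integrable [set: R] (fun t => (- 2 / M ^+ 2)%:E * (EFin \o g lam) t)%E.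
  exact: integrableZl.
have i2 : leb.-integrable [set: R] (fun t => lam%:E * (EFin \o f lam) t)%E.
  exact: integrableZl.
have idf : leb.-integrable [set: R] (EFin \o df).
  by apply: eq_integrable (integrableD measurableT i1 i2).
have cv u : (forall n, `|u n| = n%:R) -> F (u n) @[n --> \oo] --> (0 : R).
  move=> hu; apply: cvg_dist_le (cvg_gauss hu); near=> n.
  rewrite subr0 /F normrM (ger0_norm (gauss_ge0 _ _ _)).
  by rewrite ler_piMr ?gauss_ge0 // sin_max.
have cvp : F n%:R @[n --> \oo] --> (0 : R).
  by apply: (cv (fun n => n%:R)) => n; rewrite normr_nat.
have cvn : F (- n%:R) @[n --> \oo] --> (0 : R).
  by apply: (cv (fun n => - n%:R)) => n; rewrite normrN normr_nat.
have := integral_derive0 dF cdf idf cvp cvn.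
have -> : (\int[leb]_t (df t)%:E)%E =
   (- 2 / M ^+ 2 * \int[leb]_t g lam t + lam * \int[leb]_t f lam t)%:E.
  have -> : (\int[leb]_t (df t)%:E)%E = (\int[leb]_t (df t))%R%:E.
    by rewrite fineK //; exact: integrable_fin_num.
  congr (_%:E); rewrite RintegralD //; congr (_ + _).
    by rewrite RintegralZl.
  by rewrite RintegralZl.
move=> [] h; have := lt0r_neq0 M0; move: h.
move: (\int[leb]_t g lam t) (\int[leb]_t f lam t) => a b h m0.
have -> : a = a + M ^+ 2 / 2 * (- 2 / M ^+ 2 * a + lam * b) by rewrite h mulr0 addr0.
by field.
Unshelve. all: by end_near.
Qed.

Let U lam := \int[leb]_t f lam t.

Let is_derive_U lam : is_derive lam 1 U (- (M ^+ 2 / 2 * lam) * U lam).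
Proof.
have df (x t : R) : is_derive x 1 (f ^~ t) (- g x t).
  have dc : is_derive x 1 (fun x : R => cos (phase x t)) (- sin (phase x t) * (t - T)).
    exact: (@is_derive1_comp _ cos (phase ^~ t)).
  apply: (is_derive_eq (is_deriveZ (G t) dc)).
  by rewrite /g /GRing.scale /=; move: (G t) (sin _) => a b; ring.
have p1 (x t : R) : partial1of2 f x t = - g x t.
  by rewrite /partial1of2 derive1E; case: (df x t).
have Iu : `]lam - 1, lam + 1[%classic lam by rewrite /= in_itv /= gtrBl ltrDl ltr01.
pose Gb t := M * gauss T (M * Num.sqrt 2) t.
have Gb0 t : 0 <= Gb t by rewrite mulr_ge0 ?gauss_ge0 // ltW.
have iGb : leb.-integrable [set: R] (EFin \o Gb).
  have [ig _] := integral_gauss T M2_gt0.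
  by apply: eq_integrable (integrableZl measurableT M ig).
have hint (x : R) : `]lam - 1, lam + 1[%classic x -> leb.-integrable [set: R] (EFin \o f x).
  by move=> _; exact: integrable_f.
have hder (x t : R) : `]lam - 1, lam + 1[%classic x -> [set: R] t -> derivable (f ^~ t) x 1.
  by move=> _ _; case: (df x t).
have hub (x t : R) : `]lam - 1, lam + 1[%classic x -> [set: R] t ->
    `|partial1of2 f x t| <= Gb t.
  by move=> _ _; rewrite p1 normrN.
have dU := @derivable_under_integral R _ _ leb f [set: R] measurableT lam
  (lam - 1) (lam + 1) Iu hint hder Gb Gb0 iGb hub.
have eU := @differentiation_under_integral R _ _ leb f [set: R] measurableT lam
  (lam - 1) (lam + 1) Iu hint hder Gb Gb0 iGb hub.
apply: DeriveDef; first exact: dU.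
rewrite -derive1E eU (_ : (fun t => _) = (fun t => (- 1) * g lam t)).
  rewrite RintegralZl //; rewrite by_parts /U; ring.
by apply/funext => t; rewrite p1 mulN1r.
Qed.

(** Differentiation under the integral and integration by parts give U' = - (M^2 / 2) lam U, so
    U(lam) exp (M^2 lam^2 / 4) is constant, equal to its value at lam = 0. *)
Lemma gauss_cos_transform lam :
  leb.-integrable [set: R] (fun t => (gauss T M t * cos (lam * (t - T) + th))%:E) /\
  (\int[leb]_t (gauss T M t * cos (lam * (t - T) + th))%:E
   = (Num.sqrt pi * M * (cos th * expR (- (M ^+ 2 * lam ^+ 2 / 4))))%:E)%E.
Proof.
split; first exact: integrable_f.
pose E lam := expR (M ^+ 2 / 4 * (lam * lam)).
have dE (x : R) : is_derive x 1 E (M ^+ 2 / 4 * (x + x) * E x).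
  have d2 : is_derive x 1 (fun x => M ^+ 2 / 4 * (x * x)) (M ^+ 2 / 4 * (x + x)).
    apply: (is_derive_eq (is_deriveZ (M ^+ 2 / 4)
      (is_deriveM (is_derive_id x 1) (is_derive_id x 1)))).
    by rewrite /GRing.scale /= !mulr1.
  by rewrite mulrC; apply: (@is_derive1_comp _ expR (fun x => M ^+ 2 / 4 * (x * x))).
have dV (x : R) : is_derive x 1 (fun x => U x * E x) 0.
  apply: (is_derive_eq (is_deriveM (is_derive_U x) (dE x))).
  by rewrite /GRing.scale /=; move: (U x) (E x) => a b; field.
have := is_derive_0_is_cst lam 0 dV; rewrite {2}/E mulr0 mulr0 expR0 mulr1.
have U0 : U 0 = cos th * (Num.sqrt pi * M).
  have [ig eg] := integral_gauss T M0.
  rewrite /U /f (_ : (fun t => _) = (fun t => cos th * G t)).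
    by rewrite RintegralZl // /Rintegral /G eg.
  by apply/funext => t; rewrite /phase mul0r add0r mulrC.
rewrite U0 => h.
have -> : (\int[leb]_t (f lam t)%:E)%E = (U lam)%:E.
  by rewrite /U fineK //; exact: (integrable_fin_num measurableT (integrable_f lam)).
congr (_%:E).
have -> : - (M ^+ 2 * lam ^+ 2 / 4) = - (M ^+ 2 / 4 * (lam * lam)) by field.
rewrite expRN -/(E lam); apply: (mulIf (lt0r_neq0 (expR_gt0 _ : 0 < E lam))).
rewrite h; have := lt0r_neq0 (expR_gt0 _ : 0 < E lam).
by move: (E lam) (cos th) (Num.sqrt pi) (M) => a b c d a0; field.
Qed.

End GaussianFourierTransform.

(** * Off-diagonal terms of a quadratic form *)

Section QuadraticSums.
Variable R : realType.
Implicit Types (x y M r : R) (c d k n Y D : nat).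

Lemma sqr_sum_le (I : Type) (s : seq I) (f : I -> R) :
  (\sum_(i <- s) f i) ^+ 2 <= (size s)%:R * \sum_(i <- s) f i ^+ 2.
Proof.
elim: s => [|i s IH]; first by rewrite !big_nil expr0n mul0r.
rewrite !big_cons /= -natr1; set S := \sum_(j <- s) f j in IH *.
set Q := \sum_(j <- s) _ in IH *; set m := (size s)%:R in IH *.
suff h : 2 * (f i * S) <= m * f i ^+ 2 + Q.
  have -> : (f i + S) ^+ 2 = f i ^+ 2 + 2 * (f i * S) + S ^+ 2 by ring.
  have -> : (m + 1) * (f i ^+ 2 + Q) = f i ^+ 2 + (m * f i ^+ 2 + Q) + m * Q by ring.
  by rewrite lerD // lerD2l.
have -> : m * f i ^+ 2 + Q = \sum_(j <- s) (f i ^+ 2 + f j ^+ 2).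
  rewrite big_split /=; congr (_ + _).
  by rewrite big_const_seq count_predT iter_addr_0 -mulr_natl.
rewrite /S !mulr_sumr; apply: ler_sum => j _.
by have := sqr_ge0 (f i - f j); rewrite sqrrB; move: (f i) (f j) => u v; lra.
Qed.

(** Gaussian decay in the logarithm is traded for decay like 1 / (1 + (j / r)^2) with r = c / M. For
    y = M l >= l the quantity M (e^l - 1) is at most y e^l, and 2 l <= 2 + l^2 / 2 together with y^2
    <= 2 exp (y^2 / 2) bounds its square by 2 e^2 exp (y^2). *)
Lemma gauss_log_decay M c j : 1 <= M -> (0 < c)%N -> forall l : R, 0 <= l ->
  j%:R / c%:R <= expR l - 1 ->
  expR (- (M ^+ 2 * l ^+ 2)) <= (1 + 2 * expR 2) *
    ((c%:R / M) ^+ 2 / ((c%:R / M) ^+ 2 + j%:R ^+ 2)).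
Proof.
move=> M1 c0 l l0 jl; have M0 : 0 < M by exact: lt_le_trans M1.
have cpos : 0 < c%:R :> R by rewrite ltr0n.
set r := c%:R / M; have r0 : 0 < r by rewrite divr_gt0.
set J := j%:R in jl *; have J0 : 0 <= J by exact: ler0n.
pose u := M * (expR l - 1).
have ju : J / r <= u.
  have -> : J / r = M * (J / c%:R).
    rewrite /r; have := lt0r_neq0 M0; have := lt0r_neq0 cpos.
    by move: (c%:R : R) => a a0 m0; field; rewrite a0 m0.
  by rewrite ler_pM2l.
have jr0 : 0 <= J / r by rewrite divr_ge0 // ltW.
have -> : r ^+ 2 / (r ^+ 2 + J ^+ 2) = (1 + (J / r) ^+ 2)^-1.
  have := lt0r_neq0 r0; have rJ : r ^+ 2 + J ^+ 2 != 0.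
    by rewrite lt0r_neq0 // ltr_pwDl ?exprn_gt0 // sqr_ge0.
  move: (r) (J) rJ => a b ab a0; field; rewrite a0 ab andbT.
  by move: ab; rewrite addrC.
rewrite expRN ler_pdivlMr; last by rewrite ltr_pwDl // sqr_ge0.
rewrite mulrC ler_pdivrMr ?expR_gt0 //.
apply: (@le_trans _ _ (1 + u ^+ 2)).
  by rewrite lerD2l lerXn2r ?nnegrE // (le_trans jr0).
pose y := M * l; have y0 : 0 <= y by rewrite mulr_ge0 // ltW.
have ly : l <= y by rewrite ler_peMl.
have ul : u <= y * expR l.
  rewrite /u /y -mulrA ler_pM2l //.
  have := expR_ge1Dx (- l); rewrite expRN => h.
  have e0 := expR_gt0 l.
  have : expR l * (1 - l) <= 1 by rewrite mulrC -ler_pdivlMr // div1r.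
  by move: (expR l) => e; lra.
have u0 : 0 <= u by exact: le_trans jr0 ju.
have -> : M ^+ 2 * l ^+ 2 = y ^+ 2 by rewrite /y exprMn.
have u2 : u ^+ 2 <= y ^+ 2 * expR (2 * l).
  have -> : expR (2 * l) = expR l ^+ 2 by rewrite -expRM_natl.
  by rewrite -exprMn lerXn2r ?nnegrE // mulr_ge0 ?expR_ge0.
have hl : expR (2 * l) <= expR 2 * expR (y ^+ 2 / 2).
  rewrite -expRD ler_expR; have : l ^+ 2 <= y ^+ 2 by rewrite lerXn2r ?nnegrE.
  by have := sqr_ge0 (l - 2); rewrite sqrrB; nra.
have hy : y ^+ 2 <= 2 * expR (y ^+ 2 / 2).
  by have := expR_ge1Dx (y ^+ 2 / 2); move: (expR (y ^+ 2 / 2)) => e; lra.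
have hE : expR (y ^+ 2 / 2) * expR (y ^+ 2 / 2) = expR (y ^+ 2).
  by rewrite -expRD; congr expR; field.
have h3 : y ^+ 2 * expR (2 * l) <= 2 * expR 2 * expR (y ^+ 2).
  apply: (@le_trans _ _ (2 * expR (y ^+ 2 / 2) * (expR 2 * expR (y ^+ 2 / 2)))).
    by apply: ler_pM; rewrite ?sqr_ge0 ?expR_ge0.
  by rewrite -hE; move: (expR (y ^+ 2 / 2)) (expR 2) => a b; lra.
have h4 : 1 <= expR (y ^+ 2) by rewrite -[X in X <= _](@expR0 R) ler_expR sqr_ge0.
by move: u2 h3 h4; move: (u ^+ 2) (y ^+ 2 * _) (expR (y ^+ 2)) (expR 2) => a b e f; nra.
Qed.

Lemma ln_ratio_ge c c' : (0 < c)%N -> (0 < c')%N ->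
  (`|c%:Z - c'%:Z|%N)%:R / c%:R <= expR `|ln c%:R - ln c'%:R| - 1 :> R.
Proof.
move=> c0 c'0; have cpos : 0 < c%:R :> R by rewrite ltr0n.
have c'pos : 0 < c'%:R :> R by rewrite ltr0n.
have [cc'|c'c] := leqP c c'.
  rewrite distrC ger0_norm ?subr_ge0 ?ler_ln ?posrE ?ler_nat //.
  rewrite -ln_div ?posrE // lnK ?posrE ?divr_gt0 //.
  have -> : `|c%:Z - c'%:Z|%N = (c' - c)%N by rewrite distnC distnEl.
  by rewrite natrB // mulrBl divff // gt_eqF.
have cc' := ltnW c'c.
rewrite ger0_norm ?subr_ge0 ?ler_ln ?posrE ?ler_nat //.
rewrite -ln_div ?posrE // lnK ?posrE ?divr_gt0 //.
have -> : `|c%:Z - c'%:Z|%N = (c - c')%N by rewrite distnEl.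
rewrite natrB // mulrBl divff ?gt_eqF //.
have : c'%:R <= c%:R :> R by rewrite ler_nat.
move: (c%:R : R) (c'%:R : R) cpos c'pos => a b a0 b0 ba.
rewrite -subr_ge0.
have -> : a / b - 1 - (1 - b / a) = (a - b) ^+ 2 / (a * b).
  by field; rewrite (lt0r_neq0 a0) (lt0r_neq0 b0).
by rewrite divr_ge0 ?sqr_ge0 // mulr_ge0 // ltW.
Qed.

(** As (r + j)^2 <= 2 (r^2 + j^2), each term is dominated by a telescoping one. The bound must be
    O(r) without an additive constant, since r = c / M may be small and a term O(1) for each c would
    be as large as the diagonal. *)
Lemma sum_resolvent r m : 0 < r ->
  \sum_(1 <= j < m) r ^+ 2 / (r ^+ 2 + j%:R ^+ 2) <= 2 * r.
Proof.
move=> r0.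
have step (j : R) : 1 <= j ->
    r ^+ 2 / (r ^+ 2 + j ^+ 2) <= 2 * r ^+ 2 * ((r + j - 1)^-1 - (r + j)^-1).
  move=> j1; have j0 : 0 <= j by exact: le_trans j1.
  have a0 : 0 < r + j - 1 by move: r0 j1; clear; lra.
  have b0 : 0 < r + j by rewrite ltr_pwDl.
  have e0 : 0 < r ^+ 2 + j ^+ 2 by rewrite ltr_pwDl ?exprn_gt0 // sqr_ge0.
  have -> : (r + j - 1)^-1 - (r + j)^-1 = ((r + j - 1) * (r + j))^-1.
    by field; rewrite (lt0r_neq0 a0) (lt0r_neq0 b0).
  rewrite -mulrA [leRHS]mulrCA ler_pM2l ?exprn_gt0 //.
  rewrite ler_pdivlMr ?mulr_gt0 // mulrC ler_pdivrMr //.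
  have := sqr_ge0 (r - j); rewrite !expr2; move: r0 j1; clear; nra.
suff h : \sum_(1 <= j < m) r ^+ 2 / (r ^+ 2 + j%:R ^+ 2)
    <= 2 * r ^+ 2 * (r^-1 - (r + m.-1%:R)^-1).
  apply: le_trans h _.
  have -> : 2 * r = 2 * r ^+ 2 * r^-1 by field; rewrite lt0r_neq0.
  apply: ler_wpM2l; first by rewrite mulr_ge0 // sqr_ge0.
  by rewrite gerBl invr_ge0 addr_ge0 ?ler0n // ltW.
elim: m => [|m IH]; first by rewrite big_geq //= addr0 subrr mulr0.
case: m IH => [|m] IH; first by rewrite big_geq //= addr0 subrr mulr0.
rewrite big_nat_recr //=; have s1 := @step m.+1%:R; rewrite ler1n in s1.
apply: le_trans (lerD IH (s1 isT)) _.
rewrite -mulrDr /=.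
have -> : r + m.+1%:R - 1 = r + m%:R by rewrite -natr1 addrA addrK.
by rewrite addrA subrK.
Qed.

Lemma sum_gauss_log M c Y : 1 <= M -> (0 < c)%N ->
  \sum_(1 <= c' < Y.+1 | c' != c) expR (- (M ^+ 2 * (ln c%:R - ln c'%:R) ^+ 2))
  <= 4 * (1 + 2 * expR 2) * (c%:R / M).
Proof.
move=> M1 c0; have M0 : 0 < M by exact: lt_le_trans M1.
set r := c%:R / M; have r0 : 0 < r by rewrite divr_gt0 // ltr0n.
set K := 1 + 2 * expR 2; have K0 : 0 <= K by rewrite addr_ge0 ?mulr_ge0 ?expR_ge0.
pose phi j := r ^+ 2 / (r ^+ 2 + j%:R ^+ 2) : R.
have phi0 j : 0 <= phi j by rewrite divr_ge0 ?addr_ge0 ?sqr_ge0.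
pose F c' := if c' == c then 0 else phi `|c%:Z - c'%:Z|%N.
have F0 c' : 0 <= F c' by rewrite /F; case: ifP.
have sF : \sum_(1 <= c' < (c + Y).+1) F c' <= 4 * r.
  rewrite (big_cat_nat (n := c)) //=; last by rewrite ltnW // ltnS leq_addr.
  rewrite [X in _ + X]big_ltn ?ltnS ?leq_addr // {2}/F eqxx add0r.
  have -> : 4 * r = 2 * r + 2 * r by ring.
  apply: lerD.
    rewrite big_nat_rev; apply: le_trans (sum_resolvent c r0).
    rewrite big_nat [leRHS]big_nat; apply: ler_sum => i /andP[i1 ic].
    rewrite add1n subSS /F; case: eqP => [e|_]; first exact: phi0.
    have -> : `|c%:Z - (c - i)%N%:Z|%N = i by rewrite distnEl ?leq_subr // subKn // ltnW.
    exact: lexx.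
  rewrite -[X in \sum_(X <= _ < _) _]add1n big_addn; apply: le_trans (sum_resolvent _ r0).
  rewrite big_nat [leRHS]big_nat; apply: ler_sum => i /andP[i1 ic].
  rewrite /F; case: eqP => [e|_]; first exact: phi0.
  by rewrite distnC distnEl ?leq_addl // addnK.
apply: (@le_trans _ _ (K * \sum_(1 <= c' < Y.+1) F c')).
  rewrite big_mkcond mulr_sumr big_nat [leRHS]big_nat.
  apply: ler_sum => c' /andP[c'0 _]; rewrite /F; case: eqP => /= [_|_].
    by rewrite mulr0.
  rewrite -(real_normK (num_real (ln _ - _))).
  by apply: gauss_log_decay => //; exact: ln_ratio_ge.
rewrite -mulrA mulrCA ler_wpM2l //; apply: le_trans sF.
rewrite [leRHS](big_cat_nat (n := Y.+1)) //=; last by rewrite ltnS leq_addl.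
by rewrite lerDl sumr_ge0.
Qed.

(** Schur's test: |x_c x_c'| <= (x_c^2 + x_c'^2) / 2, and the symmetric kernel has row sums O(c /
    M). *)
Lemma offdiagonal_le M Y (x : nat -> R) (w : nat -> nat -> R) : 1 <= M ->
  (forall c c', `|w c c'| <= expR (- (M ^+ 2 * (ln c%:R - ln c'%:R) ^+ 2))) ->
  `|\sum_(1 <= c < Y.+1) \sum_(1 <= c' < Y.+1 | c' != c) x c * x c' * w c c'|
  <= 4 * (1 + 2 * expR 2) / M * \sum_(1 <= c < Y.+1) c%:R * x c ^+ 2.
Proof.
move=> M1 hw; pose E c c' : R := expR (- (M ^+ 2 * (ln c%:R - ln c'%:R) ^+ 2)).
have Esym c c' : E c c' = E c' c by rewrite /E -[(ln _ - ln _) ^+ 2]sqrrN opprB.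
apply: le_trans (ler_norm_sum _ _ _) _.
apply: (@le_trans _ _ (\sum_(1 <= c < Y.+1) \sum_(1 <= c' < Y.+1 | c' != c)
    (x c ^+ 2 * E c c' / 2 + x c' ^+ 2 * E c c' / 2))).
  apply: ler_sum => c _; apply: le_trans (ler_norm_sum _ _ _) _.
  apply: ler_sum => c' _.
  have -> : x c ^+ 2 * E c c' / 2 + x c' ^+ 2 * E c c' / 2
    = (x c ^+ 2 + x c' ^+ 2) / 2 * E c c'.
    by move: (x c) (x c') (E c c') => u v z; field.
  rewrite normrM.
  apply: ler_pM => //.
  rewrite ler_norml; have h1 := sqr_ge0 (x c - x c'); have h2 := sqr_ge0 (x c + x c').
  by move: h1 h2; rewrite sqrrB sqrrD; move: (x c) (x c') => u v h1 h2; apply/andP; split; lra.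
under eq_bigr do rewrite big_split /=.
rewrite big_split /=.
have -> : \sum_(1 <= c < Y.+1) \sum_(1 <= c' < Y.+1 | c' != c) x c' ^+ 2 * E c c' / 2
   = \sum_(1 <= c < Y.+1) \sum_(1 <= c' < Y.+1 | c' != c) x c ^+ 2 * E c c' / 2.
  under eq_bigr do rewrite big_mkcond; rewrite exchange_big /=.
  apply: eq_bigr => c _; rewrite [RHS]big_mkcond; apply: eq_bigr => c' _.
  by rewrite eq_sym Esym.
rewrite -big_split /= mulr_sumr big_nat [leRHS]big_nat; apply: ler_sum => c /andP[c0 _].
rewrite -big_split /=.
rewrite (eq_bigr (fun c' => x c ^+ 2 * E c c')); last by move=> c' _; field.
rewrite -mulr_sumr.
apply: (@le_trans _ _ (x c ^+ 2 * (4 * (1 + 2 * expR 2) * (c%:R / M)))).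
  by rewrite ler_wpM2l ?sqr_ge0 //; exact: sum_gauss_log.
apply: eqW.
by move: (expR 2) (M^-1) (x c) (c%:R : R) => a b e f; ring.
Qed.

End QuadraticSums.

(** * Dirichlet polynomials and the form Sigma *)

Section DivisorCoefficients.
Variable R : realType.
Variables (a : nat -> R) (N : R).
Hypothesis N1 : 1 <= N.
Implicit Types (c d k n m X Y : nat).

Let S := dyadic N.
Let D := Num.truncn (2 * N).

Definition bcoef d : R := \sum_(n <- dyadic N | (d %| n)%N) a n.
Definition bsq d : R := \sum_(n <- dyadic N | (d %| n)%N) a n ^+ 2.

Lemma dyadic_bounds n : n \in dyadic N -> (0 < n <= Num.truncn (2 * N))%N.
Proof.
rewrite mem_dyadic => /andP[Nn n2].
rewrite truncn_ge_nat ?n2 ?andbT; last by rewrite (le_trans _ n2).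
by rewrite -(ltr0n R) (lt_trans _ Nn) // (lt_le_trans ltr01).
Qed.

Lemma dyadic_uniq : uniq (dyadic N).
Proof. exact/filter_uniq/iota_uniq. Qed.

Let D_le : D%:R <= 2 * N.
Proof. by rewrite truncn_le // mulr_ge0 // (le_trans ler01). Qed.

Lemma size_dyadic_multiples d : (0 < d)%N ->
  (size [seq n <- dyadic N | d %| n] <= Num.truncn (2 * N) %/ d)%N.
Proof.
move=> d0; rewrite -[leqRHS](size_iota 1) -[leqRHS](size_map (muln d)).
apply: uniq_leq_size; first exact/filter_uniq/dyadic_uniq.
move=> n; rewrite mem_filter => /andP[dn /dyadic_bounds /andP[n0 nD]].
apply/mapP; exists (n %/ d)%N; last by rewrite mulnC divnK.
by rewrite mem_iota add1n ltnS divn_gt0 // dvdn_leq //= leq_div2r.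
Qed.

Lemma size_dyadic_le : (size (dyadic N))%:R <= 2 * N.
Proof.
apply: le_trans D_le; rewrite ler_nat.
have := @size_dyadic_multiples 1 isT; rewrite divn1.
by rewrite (@eq_filter _ _ predT) ?filter_predT // => n; rewrite dvd1n.
Qed.

Lemma bsq_ge0 d : 0 <= bsq d.
Proof. by apply: sumr_ge0 => n _; exact: sqr_ge0. Qed.

Lemma bcoef_sqr_le d : (0 < d)%N -> (d%:R * bcoef d) ^+ 2 <= 2 * N * (d%:R * bsq d).
Proof.
move=> d0; rewrite exprMn.
have h : bcoef d ^+ 2 <= (D %/ d)%:R * bsq d.
  rewrite /bcoef /bsq -big_filter -[in leRHS]big_filter.
  apply: le_trans (sqr_sum_le _ _) _; rewrite ler_wpM2r //.
    by apply: sumr_ge0 => n _; exact: sqr_ge0.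
  by rewrite ler_nat size_dyadic_multiples.
apply: le_trans (ler_wpM2l (sqr_ge0 _) h) _.
rewrite expr2 mulrACA ler_wpM2r // ?mulr_ge0 ?bsq_ge0 //.
apply: le_trans D_le; rewrite -natrM ler_nat mulnC.
exact: leq_trunc_div.
Qed.

Lemma bcoef_eq0 d : (Num.truncn (2 * N) < d)%N -> bcoef d = 0.
Proof.
move=> dD; rewrite /bcoef big_seq_cond big1 // => n /andP[/dyadic_bounds /andP[n0 nD] dn].
by have := leq_trans (leq_ltn_trans nD dD) (dvdn_leq n0 dn); rewrite ltnn.
Qed.

Lemma sum_tau_bsq (tm : R) Y : (forall n, n \in dyadic N -> (tau n)%:R <= tm) ->
  \sum_(1 <= d < Y.+1) (tau d)%:R * bsq d <= tm ^+ 2 * normsq a N.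
Proof.
move=> htm; rewrite /bsq /normsq mulr_sumr.
under eq_bigr do rewrite mulr_sumr big_mkcond.
rewrite exchange_big /= big_seq [leRHS]big_seq; apply: ler_sum => n nS.
have /andP[n0 _] := dyadic_bounds nS; have tn := htm n nS.
rewrite -big_mkcond /= -mulr_suml ler_wpM2r ?sqr_ge0 //.
apply: (@le_trans _ _ ((tau n)%:R * (tau n)%:R)); last first.
  by rewrite expr2; apply: ler_pM; rewrite ?ler0n.
apply: (@le_trans _ _ (\sum_(d <- divisors n) (tau d)%:R)).
  rewrite (@sum_divisors_iota _ n (Y + n)); last by rewrite n0 leq_addl.
  rewrite [leRHS](big_cat_nat (n := Y.+1)) //=; last by rewrite ltnS leq_addr.
  by rewrite lerDl sumr_ge0.
rewrite -natr_sum -natrM ler_nat.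
apply: (@leq_trans (\sum_(d <- divisors n) tau n)%N).
  rewrite big_seq [leqRHS]big_seq; apply: leq_sum => d; rewrite -dvdn_divisors // => dn.
  exact: tau_dvd_le.
by rewrite big_const_seq count_predT iter_addn_0.
Qed.

(** A common majorant for [acoef] and for c times the smoothed coefficients, whose weights are
    compared with v in [sum_weighted_le]. *)
Definition weighted (v : nat -> R) c : R :=
  \sum_(d <- divisors c) d%:R * `|bcoef d| * v (c %/ d)%N.

(** Cauchy-Schwarz over the divisors costs tau (c) <= tau (d) tau (k) with c = d k, after which the
    sums over d and k separate. [tm] bounds tau on the dyadic range; tau (k) stays under the sum,
    because k will not be bounded by a fixed power of N. *)
Lemma weighted_sqr_sum (v : nat -> R) (tm : R) Y :
  (forall n, n \in dyadic N -> (tau n)%:R <= tm) ->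
  \sum_(1 <= c < Y.+1) weighted v c ^+ 2 / c%:R
  <= 2 * N * (tm ^+ 2 * normsq a N) * \sum_(1 <= k < Y.+1) (tau k)%:R * (v k ^+ 2 / k%:R).
Proof.
move=> htm; have N0 : 0 <= N by exact: le_trans N1.
pose f d k := 2 * N * ((tau d)%:R * bsq d * ((tau k)%:R * (v k ^+ 2 / k%:R))).
have f0 d k : 0 <= f d k.
  apply: mulr_ge0; first exact: mulr_ge0.
  apply: mulr_ge0; first by rewrite mulr_ge0 ?bsq_ge0.
  by apply: mulr_ge0 => //; rewrite divr_ge0 ?sqr_ge0.
apply: (@le_trans _ _ (\sum_(1 <= c < Y.+1) \sum_(d <- divisors c) f d (c %/ d)%N)).
  rewrite big_nat [leRHS]big_nat; apply: ler_sum => c /andP[c0 _].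
  have cpos : 0 < c%:R :> R by rewrite ltr0n.
  rewrite ler_pdivrMr // mulr_suml.
  apply: le_trans (sqr_sum_le _ _) _; rewrite -/(tau c) mulr_sumr.
  rewrite big_seq [leRHS]big_seq; apply: ler_sum => d; rewrite -dvdn_divisors // => dc.
  have d0 := dvdn_gt0 c0 dc; set k := (c %/ d)%N.
  have k0 : (0 < k)%N by rewrite divn_gt0 // dvdn_leq.
  have cE : c = (d * k)%N by rewrite mulnC divnK.
  have kpos : 0 < k%:R :> R by rewrite ltr0n.
  have tc : (tau c)%:R <= (tau d)%:R * (tau k)%:R :> R.
    by rewrite -natrM ler_nat cE tau_mul.
  have hb : (d%:R * `|bcoef d| * v k) ^+ 2 <= 2 * N * (d%:R * bsq d) * v k ^+ 2.
    rewrite exprMn ler_wpM2r ?sqr_ge0 //.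
    by rewrite exprMn real_normK ?num_real // -exprMn bcoef_sqr_le.
  apply: le_trans (ler_pM (ler0n _ _) (sqr_ge0 _) tc hb) _.
  apply: eqW; rewrite /f [in RHS]cE natrM.
  have := lt0r_neq0 kpos; move: (k%:R : R) (d%:R : R) (bsq d) (v k) (tau d)%:R (tau k)%:R.
  by move=> u w b z t1 t2 u0; field.
rewrite dirichlet_regroup.
apply: (@le_trans _ _ (\sum_(1 <= d < Y.+1) \sum_(1 <= k < Y.+1) f d k)).
  apply: ler_sum => d _; rewrite big_mkcond; apply: ler_sum => k _.
  by case: ifP.
rewrite /f; under eq_bigr do rewrite -!mulr_sumr.
rewrite -mulr_sumr -mulr_suml mulrA ler_wpM2r //.
  by apply: sumr_ge0 => k _; rewrite mulr_ge0 ?ler0n // divr_ge0 ?sqr_ge0 ?ler0n.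
by rewrite ler_wpM2l ?mulr_ge0 //; exact: sum_tau_bsq.
Qed.

(** The series of tau is the square of that of zeta at 1 + dl; the bound is uniform in Y. *)
Lemma tau_series_le (dl : R) Y : 0 < dl ->
  \sum_(1 <= k < Y.+1) (tau k)%:R * k%:R `^ (- (1 + dl)) <= (1 + dl^-1) ^+ 2.
Proof.
move=> dl0.
have -> : \sum_(1 <= k < Y.+1) (tau k)%:R * k%:R `^ (- (1 + dl))
   = \sum_(1 <= c < Y.+1) \sum_(d <- divisors c)
     (d%:R `^ (- (1 + dl)) * (c %/ d)%:R `^ (- (1 + dl)) : R).
  apply: eq_big_nat => c /andP[c0 _].
  rewrite /tau -sum1_size natr_sum mulr_suml; apply: eq_big_seq => d.
  rewrite -dvdn_divisors // => dc; rewrite mul1r -powRM ?ler0n // -natrM.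
  by rewrite mulnC divnK.
rewrite (dirichlet_regroup Y (fun d k => d%:R `^ (- (1 + dl)) * k%:R `^ (- (1 + dl)))).
apply: (@le_trans _ _ (\sum_(1 <= d < Y.+1) \sum_(1 <= k < Y.+1)
     d%:R `^ (- (1 + dl)) * k%:R `^ (- (1 + dl)))).
  apply: ler_sum => d _; rewrite big_mkcond; apply: ler_sum => k _.
  by case: ifP => // _; rewrite mulr_ge0 ?powR_ge0.
under eq_bigr do rewrite -mulr_sumr.
rewrite -mulr_suml expr2; have h := sum_powR_le Y dl0.
by apply: ler_pM => //; apply: sumr_ge0 => k _; exact: powR_ge0.
Qed.

End DivisorCoefficients.

(** * Products and squares of Dirichlet polynomials *)

Section DirichletPolynomials.
Variable R : realType.
Implicit Types (c d k n m X Y : nat) (s : R[i]).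

Lemma sum_extend (V : nmodType) (f : nat -> V) X Y : (X <= Y)%N ->
  (forall k, (X < k)%N -> f k = 0) ->
  \sum_(1 <= k < Y.+1) f k = \sum_(1 <= k < X.+1) f k.
Proof.
move=> XY f0; rewrite (big_cat_nat (n := X.+1)) //=.
rewrite [X in _ + X]big_nat [X in _ + X]big1 ?addr0 // => k /andP[Xk _].
exact: f0.
Qed.

Definition dirpoly (x : nat -> R) Y s : R[i] :=
  \sum_(1 <= c < Y.+1) (x c)%:C * cpow c%:R s.

Definition dirconv (x u : nat -> R) c : R :=
  \sum_(d <- divisors c) x d * u (c %/ d)%N.

(** Y may be any bound from D X upwards: the integral does not depend on it, and Sigma is reached by
    letting Y tend to infinity. *)
Lemma dirpolyM (x u : nat -> R) D X Y s : (0 < D)%N -> (0 < X)%N -> (D * X <= Y)%N ->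
  (forall d, (D < d)%N -> x d = 0) -> (forall k, (X < k)%N -> u k = 0) ->
  dirpoly x D s * dirpoly u X s = dirpoly (dirconv x u) Y s.
Proof.
move=> D0 X0 DXY x0 u0; rewrite /dirpoly.
have DY : (D <= Y)%N by apply: leq_trans DXY; rewrite leq_pmulr.
have XY : (X <= Y)%N by apply: leq_trans DXY; rewrite leq_pmull.
rewrite -(sum_extend DY); last by move=> d Dd; rewrite x0 // mul0r.
rewrite -(sum_extend XY); last by move=> k Xk; rewrite u0 // mul0r.
pose f d k := (x d)%:C * (u k)%:C * cpow (d * k)%N%:R s.
transitivity (\sum_(1 <= c < Y.+1) \sum_(d <- divisors c) f d (c %/ d)%N); last first.
  apply: eq_big_nat => c /andP[c0 _]; rewrite /dirconv rmorph_sum mulr_suml.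
  apply: eq_big_seq => d; rewrite -dvdn_divisors // => dc.
  by rewrite rmorphM /f mulnC divnK.
rewrite dirichlet_regroup mulr_suml big_nat [RHS]big_nat; apply: eq_bigr => d /andP[d0 _].
rewrite mulr_sumr [RHS]big_mkcond; apply: eq_big_nat => k /andP[k0 _].
have -> : (x d)%:C * cpow d%:R s * ((u k)%:C * cpow k%:R s) = f d k.
  by rewrite /f natrM cpowM ?ltr0n // mulrACA.
case: ifP => // /negbT; rewrite -ltnNge => Ydk; rewrite /f.
have [Dd|dD] := ltnP D d; first by rewrite x0 // !mul0r.
have [Xk|kX] := ltnP X k; first by rewrite u0 // mulr0 mul0r.
by have := leq_trans (leq_trans Ydk (leq_mul dD kX)) DXY; rewrite ltnn.
Qed.

Lemma cpow_imag c (t : R) : cpow c%:R (0 +i* t) = cos (t * ln c%:R) +i* sin (t * ln c%:R).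
Proof.
rewrite /cpow /cexp /= !(mul0r, mulr0, subr0, addr0, add0r, oppr0) expR0.
by apply/eqP; rewrite eq_complex /= !(mul0r, mulr0, mul1r, subr0, addr0) !eqxx.
Qed.

Lemma dirpoly_sqr (x : nat -> R) Y (t : R) :
  nc (dirpoly x Y (0 +i* t)) ^+ 2 =
  \sum_(1 <= c < Y.+1) \sum_(1 <= c' < Y.+1) x c * x c' * cos (t * (ln c%:R - ln c'%:R)).
Proof.
rewrite nc_sqr /dirpoly cRe_sum cIm_sum.
under eq_bigr do rewrite cReMr cpow_imag.
under [X in _ + X ^+ 2]eq_bigr do rewrite cImMr cpow_imag.
rewrite !expr2 !mulr_suml -big_split /=; apply: eq_bigr => c _.
rewrite !mulr_sumr -big_split /=; apply: eq_bigr => c' _.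
by rewrite mulrBr cosB; move: (cos _) (cos _) (sin _) (sin _) (x c) (x c') => e f g h i j; ring.
Qed.

Lemma sum_diagonal (f : nat -> nat -> R) Y :
  \sum_(1 <= c < Y.+1) \sum_(1 <= c' < Y.+1) f c c' =
  \sum_(1 <= c < Y.+1) f c c + \sum_(1 <= c < Y.+1) \sum_(1 <= c' < Y.+1 | c' != c) f c c'.
Proof.
rewrite -big_split /= big_nat [RHS]big_nat; apply: eq_bigr => c cY.
by rewrite (bigD1_seq c) ?iota_uniq // mem_index_iota.
Qed.

End DirichletPolynomials.

(** * Mean squares against the weight h *)

Section GaussianMeanSquare.
Variable R : realType.
Local Notation leb := (@lebesgue_measure R).
Implicit Types (c d k n m X Y : nat).

Lemma integral_h_dirpoly (T M : R) (x : nat -> R) Y : 0 < M ->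
  leb.-integrable [set: R]
    (fun t => (h T M t * nc (dirpoly x Y (0 +i* (2 * t))) ^+ 2)%:E) /\
  (\int[leb]_t (h T M t * nc (dirpoly x Y (0 +i* (2 * t))) ^+ 2)%:E
   = (2 * (Num.sqrt pi * M) * \sum_(1 <= c < Y.+1) \sum_(1 <= c' < Y.+1)
       x c * x c' * (cos (2 * (ln c%:R - ln c'%:R) * T)
         * expR (- (M ^+ 2 * (ln c%:R - ln c'%:R) ^+ 2))))%:E)%E.
Proof.
move=> M0.
pose lam c c' : R := 2 * (ln c%:R - ln c'%:R).
(* The cosine cos (lam t) is rewritten around T with phase lam T and around -T with phase - lam T;
   by parity both bumps then give the same value cos (lam T). *)
pose F c c' (t : R) := ((x c * x c')%:E *
   ((gauss T M t * cos (lam c c' * (t - T) + lam c c' * T))%:E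
    + (gauss (- T) M t * cos (lam c c' * (t - - T) + - (lam c c' * T)))%:E))%E.
pose val c c' := 2 * (Num.sqrt pi * M) * (x c * x c' * (cos (2 * (ln c%:R - ln c'%:R) * T)
         * expR (- (M ^+ 2 * (ln c%:R - ln c'%:R) ^+ 2)))).
have hF c c' : leb.-integrable [set: R] (F c c') /\ (\int[leb]_t F c c' t = (val c c')%:E)%E.
  have [i1 e1] := gauss_cos_transform T (lam c c' * T) M0 (lam c c').
  have [i2 e2] := gauss_cos_transform (- T) (- (lam c c' * T)) M0 (lam c c').
  have i12 := integrableD measurableT i1 i2.
  split; first exact: integrableZl.
  rewrite /F integralZl // integralD // e1 e2 -EFinD -EFinM; congr (_%:E).
  rewrite cosN /val /lam.
  have -> : M ^+ 2 * (2 * (ln c%:R - ln c'%:R)) ^+ 2 / 4 = M ^+ 2 * (ln c%:R - ln c'%:R) ^+ 2.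
    by move: (ln c%:R - ln c'%:R) => l; field.
  by move: (expR _) (cos _) (Num.sqrt pi) => u v w; ring.
have E : (fun t => (h T M t * nc (dirpoly x Y (0 +i* (2 * t))) ^+ 2)%:E)
   = (fun t => \sum_(1 <= c < Y.+1) \sum_(1 <= c' < Y.+1) F c c' t)%E.
  apply/funext => t; rewrite dirpoly_sqr mulr_sumr -sumEFin; apply: eq_bigr => c _.
  rewrite mulr_sumr -sumEFin; apply: eq_bigr => c' _.
  rewrite /F -EFinD -EFinM; congr (_%:E); rewrite /h opprK -/(gauss T M t).
  have -> : expR (- ((t + T) ^+ 2 / M ^+ 2)) = gauss (- T) M t by rewrite /gauss opprK.
  have -> : lam c c' * (t - T) + lam c c' * T = 2 * t * (ln c%:R - ln c'%:R).
    by rewrite /lam; move: (ln c%:R) (ln c'%:R) => u v; ring.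
  have -> : lam c c' * (t + T) + - (lam c c' * T) = 2 * t * (ln c%:R - ln c'%:R).
    by rewrite /lam; move: (ln c%:R) (ln c'%:R) => u v; ring.
  by move: (gauss _ _ _) (gauss _ _ _) (cos _) (x c) (x c') => u v w y z; ring.
have iin c : leb.-integrable [set: R] (fun t => \sum_(1 <= c' < Y.+1) F c c' t)%E.
  by apply: integrable_sum => // c' _; exact: (hF c c').1.
rewrite E; split; first by apply: integrable_sum => // c _; exact: iin.
rewrite integral_sum // mulr_sumr -sumEFin; apply: eq_bigr => c _.
rewrite integral_sum //; last by move=> c'; exact: (hF c c').1.
rewrite mulr_sumr -sumEFin; apply: eq_bigr => c' _.
exact: (hF c c').2.
Qed.

(** The factor M of the mean square cancels the 1 / M of [offdiagonal_le], so the off-diagonal error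
    is free of both M and T. *)
Lemma h_dirpoly_diagonal (T M : R) (x : nat -> R) Y : 1 <= M ->
  exists Q : R, leb.-integrable [set: R]
    (fun t => (h T M t * nc (dirpoly x Y (0 +i* (2 * t))) ^+ 2)%:E) /\
  (\int[leb]_t (h T M t * nc (dirpoly x Y (0 +i* (2 * t))) ^+ 2)%:E = Q%:E)%E /\
  `|Q - 2 * (Num.sqrt pi * M) * \sum_(1 <= c < Y.+1) x c ^+ 2|
    <= 8 * Num.sqrt pi * (1 + 2 * expR 2) * \sum_(1 <= c < Y.+1) c%:R * x c ^+ 2.
Proof.
move=> M1; have M0 : 0 < M by exact: lt_le_trans M1.
have [iP eP] := integral_h_dirpoly T x Y M0.
eexists; split; first exact: iP.
split; first exact: eP.
rewrite sum_diagonal mulrDr addrAC -mulrBr -sumrB.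
rewrite big1 ?mulr0 ?add0r; last first.
  move=> c _; rewrite subrr mulr0 mul0r cos0 expr0n mulr0 oppr0 expR0 !mulr1.
  by rewrite expr2 subrr.
rewrite normrM ger0_norm; last by rewrite !mulr_ge0 ?sqrtr_ge0 // ltW.
pose w c c' : R := cos (2 * (ln c%:R - ln c'%:R) * T)
         * expR (- (M ^+ 2 * (ln c%:R - ln c'%:R) ^+ 2)).
have hw c c' : `|w c c'| <= expR (- (M ^+ 2 * (ln c%:R - ln c'%:R) ^+ 2)).
  by rewrite normrM (ger0_norm (expR_ge0 _)) ler_piMl ?expR_ge0 // cos_max.
have := offdiagonal_le Y x M1 hw; set A := \sum_(1 <= c < Y.+1) _.
set B := \sum_(1 <= c < Y.+1) _ => hAB.
apply: le_trans (ler_wpM2l _ hAB) _; first by rewrite !mulr_ge0 ?sqrtr_ge0 // ltW.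
apply: eqW; have := lt0r_neq0 M0.
by move: (Num.sqrt pi) (expR 2) (M) => u v m m0; field.
Qed.

End GaussianMeanSquare.

(** * The form Sigma as a series of squares *)

Section SigmaForm.
Variable R : realType.

Lemma cvg_sum_seq (I : eqType) (s : seq I) (f : I -> nat -> R) (l : I -> R) :
  (forall i, i \in s -> f i @ \oo --> l i) ->
  (fun k => \sum_(i <- s) f i k) @ \oo --> \sum_(i <- s) l i.
Proof.
elim: s => [|i s IH] h.
  by rewrite big_nil; under eq_fun do rewrite big_nil; exact: cvg_cst.
rewrite big_cons; under eq_fun do rewrite big_cons.
apply: cvgD; first by apply: h; rewrite mem_head.
by apply: IH => j js; apply: h; rewrite inE js orbT.
Qed.

Variables (a : nat -> R) (N : R).
Hypothesis N1 : 1 <= N.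
Implicit Types (c d k n m X Y : nat) (s : R[i]).

Lemma divsigma_dirpoly s :
  \sum_(n <- dyadic N) (a n)%:C * divsigma s n
  = dirpoly (bcoef a N) (Num.truncn (2 * N)) s.
Proof.
set D := Num.truncn _; rewrite /dirpoly /bcoef /divsigma.
transitivity (\sum_(n <- dyadic N) \sum_(1 <= d < D.+1)
   if (d %| n)%N then (a n)%:C * cpow d%:R s else 0).
  rewrite big_seq [RHS]big_seq; apply: eq_bigr => n nS.
  have nD := dyadic_bounds N1 nS.
  by rewrite (sum_divisors_iota _ nD) mulr_sumr big_mkcond.
rewrite exchange_big /=; apply: eq_bigr => d _.
by rewrite -big_mkcond /= rmorph_sum mulr_suml.
Qed.

Definition acoef c : R := \sum_(d <- divisors c) mu R (c %/ d)%N * (d%:R * bcoef a N d).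

Lemma acoefE c : (0 < c)%N -> acoef c = \sum_(n <- dyadic N) a n * ramanujan_sum R n c.
Proof.
move=> c0; under [RHS]eq_bigr do rewrite ramanujan_sum_divisors // mulr_sumr.
rewrite exchange_big /=; apply: eq_bigr => d _; rewrite /bcoef !mulr_sumr big_mkcond /=.
apply: eq_bigr => n _; case: ifP => _; last by rewrite mulr0 mulr0.
by rewrite mulrA mulrC.
Qed.

Lemma norm_ramanujan_sum_le n c : (0 < n)%N -> (0 < c)%N ->
  `|ramanujan_sum R n c| <= \sum_(d <- divisors n) d%:R.
Proof.
move=> n0 c0; rewrite ramanujan_sum_divisors //; apply: le_trans (ler_norm_sum _ _ _) _.
have cc : (0 < c <= n + c)%N by rewrite c0 leq_addl.
have nn : (0 < n <= n + c)%N by rewrite n0 leq_addr.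
rewrite (sum_divisors_iota _ cc) (sum_divisors_iota _ nn) big_mkcond [leRHS]big_mkcond.
apply: ler_sum => d _; case: (d %| c)%N; last by case: (d %| n)%N.
case: (d %| n)%N; last by rewrite mulr0 normr0.
by rewrite normrM normr_nat ler_piMl ?ler0n // norm_mu_le1.
Qed.

(** A Ramanujan sum is bounded by the sum of the divisors of its argument, uniformly in c, so the
    terms are O(c^{-2}). [ccvg_telescope] is reused by embedding the real partial sums. *)
Lemma sigma_bil_cvg m n : (0 < m)%N -> (0 < n)%N ->
  (fun Y => \sum_(1 <= c < Y.+1) ramanujan_sum R m c * ramanujan_sum R n c / c%:R ^+ 2)
    @ \oo --> sigma_bil R m n.
Proof.
move=> m0 n0; pose t c := ramanujan_sum R m c * ramanujan_sum R n c / c%:R ^+ 2.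
pose K : R := (\sum_(d <- divisors m) d%:R) * (\sum_(d <- divisors n) d%:R).
pose u Y := (\sum_(1 <= c < Y.+1) t c)%:C.
have hu k : (1 <= k)%N -> nc (u k.+1 - u k) <= K * k%:R `^ (- 1) - K * k.+1%:R `^ (- 1).
  move=> kk; rewrite /u -rmorphB nc_real big_nat_recr //= addrAC subrr add0r -mulrBr.
  have h := @powR_step R 1 k ltr01 kk; rewrite invr1 mul1r in h.
  rewrite /t normrM normrM normfV normrX normr_nat.
  apply: ler_pM; rewrite ?mulr_ge0 ?invr_ge0 ?exprn_ge0 //.
    by apply: ler_pM => //; exact: norm_ramanujan_sum_le.
  by apply: le_trans h; rewrite -[1 + 1]/(2%:R) powR_invn.
have K0 : K * k%:R `^ (- 1) @[k --> \oo] --> (0 : R).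
  rewrite -(mulr0 K); apply: cvgM; first exact: cvg_cst.
  exact: cvg_natpowN.
have [w cw _] := ccvg_telescope hu K0.
have {}cw := ccvg_Re cw.
have -> : sigma_bil R m n = Re w.
  rewrite /sigma_bil; apply: cvg_lim => //.
  by rewrite -(cvg_shiftS (fun k => \sum_(1 <= c < k) t c)).
exact: cw.
Qed.

Lemma Sigma_form_cvg M :
  (fun Y => M * \sum_(1 <= c < Y.+1) (acoef c / c%:R) ^+ 2) @ \oo --> Sigma_form a N M.
Proof.
rewrite /Sigma_form; apply: cvgM; first exact: cvg_cst.
have E : (fun Y => \sum_(1 <= c < Y.+1) (acoef c / c%:R) ^+ 2)
  = (fun Y => \sum_(m <- dyadic N) \sum_(n <- dyadic N) a m * a n *
      \sum_(1 <= c < Y.+1) ramanujan_sum R m c * ramanujan_sum R n c / c%:R ^+ 2).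
  apply/funext => Y.
  transitivity (\sum_(1 <= c < Y.+1) \sum_(m <- dyadic N) \sum_(n <- dyadic N)
     a m * a n * (ramanujan_sum R m c * ramanujan_sum R n c / c%:R ^+ 2)).
    apply: eq_big_nat => c /andP[c0 _]; rewrite acoefE // expr_div_n expr2.
    rewrite !mulr_suml; apply: eq_bigr => m _.
    rewrite mulr_sumr mulr_suml; apply: eq_bigr => n _.
    by move: (ramanujan_sum R m c) (ramanujan_sum R n c) (a m) (a n) (_^-1) => e f g i j; ring.
  rewrite exchange_big /=; apply: eq_bigr => m _.
  rewrite exchange_big /=; apply: eq_bigr => n _.
  by rewrite mulr_sumr.
rewrite E; apply: cvg_sum_seq => m mS; have /andP[m0 _] := dyadic_bounds N1 mS.
apply: cvg_sum_seq => n nS; have /andP[n0 _] := dyadic_bounds N1 nS.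
by apply: cvgM; [exact: cvg_cst|exact: sigma_bil_cvg].
Qed.

End SigmaForm.

(** * Replacing 1 / zeta by a Dirichlet polynomial *)

Section SmoothedMoebius.
Variable R : realType.
Implicit Types (x y d : R) (s : R[i]) (k n i J X : nat).

Definition smooth d J k : R := 1 - (1 - k%:R `^ (- d)) ^+ J.

Definition smooth_cut d J X k : R := if (k <= X)%N then smooth d J k else 0.

Lemma powRN_01 d k : 0 <= d -> (0 < k)%N -> 0 <= k%:R `^ (- d) <= 1.
Proof.
move=> d0 k0; rewrite powR_ge0 /= /powR pnatr_eq0 gtn_eqF // expR_le1 mulNr oppr_le0.
by rewrite mulr_ge0 // ln_nat_ge0.
Qed.

Lemma smooth_01 d J k : 0 <= d -> (0 < k)%N -> 0 <= smooth d J k <= 1.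
Proof.
move=> d0 k0; have /andP[q0 q1] := powRN_01 d0 k0; rewrite /smooth.
have h0 : 0 <= 1 - k%:R `^ (- d) :> R by rewrite subr_ge0.
by rewrite subr_ge0 exprn_ile1 // gerBl exprn_ge0.
Qed.

Lemma smooth_cut_01 d J X k : 0 <= d -> (0 < k)%N -> 0 <= smooth_cut d J X k <= 1.
Proof.
move=> d0 k0; rewrite /smooth_cut; case: ifP => _; first exact: smooth_01.
by rewrite lexx ler01.
Qed.

Lemma bernoulli_le (q : R) J : 0 <= q <= 1 -> 1 - J%:R * q <= (1 - q) ^+ J.
Proof.
move=> /andP[q0 q1]; elim: J => [|J IH]; first by rewrite mul0r subr0 expr0.
rewrite exprS; apply: le_trans (ler_wpM2l _ IH); last by rewrite subr_ge0.
have J0 : 0 <= J%:R :> R by exact: ler0n.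
have : 0 <= J%:R * q * q by rewrite !mulr_ge0.
by rewrite -natr1; move: (J%:R : R) J0 => j j0; nra.
Qed.

Lemma smooth_cut_le d J X k : 0 <= d -> (0 < k)%N ->
  smooth_cut d J X k <= J%:R * k%:R `^ (- d).
Proof.
move=> d0 k0; have q01 := powRN_01 d0 k0; have /andP[q0 _] := q01.
rewrite /smooth_cut; case: ifP => _; last by rewrite mulr_ge0.
by rewrite /smooth lerBlDr -lerBlDl; exact: bernoulli_le.
Qed.

(** Up to X, 1 - w = (1 - k^{-d})^J is at most (d (1 + ln k))^J. Beyond X the weight is 0, and X is
    large enough for d^J k^{1/2} to exceed 1, so that one bound covers both ranges. *)
Lemma onem_smooth_cut_le J : exists2 c : R, 1 <= c & forall d X, 0 < d ->
  1 <= d ^+ J * X%:R `^ 2^-1 -> forall k, (0 < k)%N ->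
  1 - smooth_cut d J X k <= c * d ^+ J * k%:R `^ 2^-1.
Proof.
have h2 : 0 < 2^-1 :> R by rewrite invr_gt0.
have [c c1 hc] := @lnD1X_powR R 2^-1 J h2.
exists c => // d X d0 hX k k0; have k1 : 1 <= k%:R :> R by rewrite ler1n.
have dJ : 0 <= d ^+ J by rewrite exprn_ge0 // ltW.
rewrite /smooth_cut; case: leqP => [_|Xk].
  rewrite /smooth opprB addrC subrK.
  have /andP[q0 q1] := powRN_01 (ltW d0) k0.
  have h : 1 - k%:R `^ (- d) <= d * (1 + ln k%:R).
    have := powRN_diff_le (lexx 1) k1 (ltW d0); rewrite powR1 ln1 subr0 distrC => h.
    apply: le_trans (ler_norm _) (le_trans h _).
    by rewrite ler_wpM2l ?(ltW d0) // lerDr.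
  apply: (@le_trans _ _ ((d * (1 + ln k%:R)) ^+ J)).
    apply: lerXn2r; rewrite ?nnegrE ?subr_ge0 //.
    by rewrite mulr_ge0 ?(ltW d0) // addr_ge0 // ln_ge0.
  by rewrite exprMn [c * _]mulrC -mulrA ler_wpM2l //; exact: hc.
rewrite subr0; apply: le_trans hX _.
rewrite -mulrA mulrCA ler_wpM2l // -[leLHS]mul1r; apply: ler_pM; rewrite ?powR_ge0 //.
by apply: ge0_ler_powR; rewrite ?nnegrE ?ler0n ?(ltW h2) // ler_nat ltnW.
Qed.

Lemma nc_fdn_le J (z : nat -> R[i]) (B : R) i :
  (forall j, nc (z j) <= B) -> nc (fdn J z i) <= 2 ^+ J * B.
Proof.
move=> hB; elim: J i => [|J IH] i; first by rewrite expr0 mul1r.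
rewrite /fdn iterS -/(fdn J z) /fd; apply: le_trans (ncB _ _) _.
by apply: le_trans (lerD (IH _) (IH _)) _; rewrite exprS -mulrA mulr_natl mulr2n.
Qed.

Lemma fdn_delta J (c : R[i]) : fdn J (fun j => if j == 0%N then c else 0) 0 = (-1) ^+ J * c.
Proof.
elim: J c => [|J IH] c; first by rewrite mul1r.
rewrite fdnS (_ : fd _ = fun j => if j == 0%N then - c else 0).
  by rewrite IH exprS mulN1r mulrN mulNr.
by apply/funext => -[|j]; rewrite /fd /= ?sub0r ?oppr0.
Qed.

Lemma fdn_delete0 J (z : nat -> R[i]) :
  fdn J (fun j => if j == 0%N then 0 else z j) 0 = fdn J z 0 - (-1) ^+ J * z 0.
Proof.
rewrite -(fdn_delta J (z 0)) -(congr1 (@^~ 0%N) (fdnB J _ _)).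
by congr (fdn J _ 0); apply/funext => -[|j] /=; rewrite ?subrr ?subr0.
Qed.

Definition mertens X s : R[i] := \sum_(1 <= k < X.+1) (mu R k)%:C * cpow k%:R (- s).

(* The weight [smooth d J] is [1 - (-1)^J] times the [J]-th difference of
   [k^(-jd)] in [j]: smoothing the Moebius sum amounts to extrapolating from
   the shifted points [s + jd], [1 <= j <= J], where the series converges. *)
Definition smoothed_moebius d J X s : R[i] :=
  \sum_(1 <= k < X.+1) (mu R k * smooth_cut d J X k)%:C * cpow k%:R (- s).

Lemma smoothed_moebiusE d J X s :
  smoothed_moebius d J X s
  = - (-1) ^+ J * fdn J (fun j => if j == 0%N then 0 else mertens X (hstep s d j)) 0.
Proof.
rewrite fdn_delete0 mulrBr hstep0.
have -> : - (-1) ^+ J * ((-1) ^+ J * mertens X s) = - mertens X s.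
  by rewrite mulrA mulNr -expr2 sqrr_sign mulN1r.
rewrite opprK.
have -> : fdn J (fun j => mertens X (hstep s d j)) 0
  = \sum_(1 <= k < X.+1) (mu R k)%:C * (cpow k%:R (- s) * ((k%:R `^ (- d))%:C - 1) ^+ J).
  rewrite /mertens (congr1 (@^~ 0%N) (fdn_sum J _ _)); apply: eq_big_nat => k /andP[k0 _].
  by rewrite (congr1 (@^~ 0%N) (fdnZ J _ _)) fdn_cpow ?ltr0n.
rewrite /smoothed_moebius mulr_sumr /mertens -big_split /=.
apply: eq_big_nat => k /andP[k0 kX]; rewrite /smooth_cut -ltnS kX /smooth.
have -> : ((k%:R `^ (- d))%:C - 1) ^+ J = (-1) ^+ J * ((1 - k%:R `^ (- d)) ^+ J)%:C :> R[i].
  by rewrite rmorphXn rmorphB /= -exprMn mulN1r opprB.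
rewrite rmorphM rmorphB /=.
set e := (-1) ^+ J; have ee : e * e = 1 by rewrite -expr2 sqrr_sign.
set q := (_ ^+ J)%:C; set m := (mu R k)%:C; set p := cpow _ _.
have -> : - e * (m * (p * (e * q))) = - (e * e) * (m * p * q) by ring.
by rewrite ee; ring.
Qed.

(** The truncated Moebius sum and 1 / zeta are compared only at the shifted points with j >= 1,
    where the real part is at least 1 + d and the tail at most X^{-d} / d; the binomial coefficients
    add up to at most 2^J. *)
Lemma smoothed_moebius_approx d J X s : 0 < d -> 1 <= Re s -> (0 < X)%N ->
  nc (smoothed_moebius d J X s
      + (-1) ^+ J * fdn J (fun j => if j == 0%N then 0 else (zeta (hstep s d j))^-1) 0)
  <= 2 ^+ J * (d^-1 * X%:R `^ (- d)).
Proof.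
move=> d0 s1 X0; rewrite smoothed_moebiusE mulNr addrC -mulrBr.
rewrite -(congr1 (@^~ 0%N) (fdnB J _ _)) ncM ncX ncN nc1 expr1n mul1r.
apply: nc_fdn_le => -[|j]; cbv beta; rewrite ?eqxx.
  by rewrite subrr nc0 mulr_ge0 ?powR_ge0 // invr_ge0 ltW.
have jd : d <= Re (hstep s d j.+1) - 1.
  have j1 : 1 <= j.+1%:R :> R by rewrite ler1n.
  rewrite Re_hstep; have : d <= j.+1%:R * d by rewrite ler_peMl // ltW.
  by move: s1; move: (Re s) (_ * d) => u v; lra.
have s1' : 1 < Re (hstep s d j.+1) by rewrite -subr_gt0 (lt_le_trans d0).
have [_ /(_ X X0) h] := zetaV_moebius s1'.
apply: le_trans h _; apply: ler_pM; rewrite ?invr_ge0 ?powR_ge0 ?subr_ge0 ?(ltW s1') //.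
  by rewrite lef_pV2 ?posrE ?subr_gt0.
by apply: ler_powR; rewrite ?ler1n // lerN2.
Qed.

Lemma sqr_diff_le (p q e A : R) : 0 <= p <= A -> 0 <= q -> `|p - q| <= e -> e <= A ->
  `|p ^+ 2 - q ^+ 2| <= 3 * A * e.
Proof.
move=> /andP[p0 pA] q0 pq eA; rewrite subr_sqr normrM mulrC; apply: ler_pM => //.
rewrite ger0_norm ?addr_ge0 //; move: pq; rewrite ler_norml => /andP[h1 h2]; lra.
Qed.

(** Away from the pole the error is a J-th difference of 1 / zeta. For |t| <= th mere boundedness is
    used, recorded by exp (- t^2): a range of bounded length adds O(1), not O(M), to the
    integral. *)
Lemma zeta_square_approx J (k : R) : 0 < k -> exists2 C : R, 1 <= C &
  forall d X, 0 < d <= 1 -> (0 < X)%N -> 2 ^+ J * (d^-1 * X%:R `^ (- d)) <= d ^+ J ->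
  forall t : R,
  `| (nc (zeta (1 +i* t)))^-1 ^+ 2 - nc (smoothed_moebius d J X (1 +i* t)) ^+ 2 |
    <= C * (expR (- t ^+ 2) + d ^+ J * (1 + `|t|) `^ k).
Proof.
move=> k0; have [th [th0 th1 [C1 C11 hC1]]] := zetaV_near1 R.
have [C C_1 [A hA]] := zetaV_fdn J th0.
have k20 : 0 < k / 2 by rewrite divr_gt0.
have [c c1 hc] := @lnD1X_powR R (k / 2) (A + A) k20.
have C10 : 0 <= C1 by exact: le_trans C11.
have C0 : 0 <= C by exact: le_trans C_1.
have c0 : 0 <= c by exact: le_trans c1.
pose B := 2 ^+ J * C1 + C1 + 1.
have J1 : 1 <= 2 ^+ J :> R by rewrite exprn_ege1 // ler1n.
have B1 : 1 <= B by rewrite /B lerDr addr_ge0 // mulr_ge0.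
have B0 : 0 <= B by exact: le_trans B1.
(* The factor e comes from 1 <= e exp (- t^2) for |t| <= th <= 1, and 3 B B from [sqr_diff_le]. *)
pose C2 := 3 * B * B * expR 1.
pose C3 := 3 * (2 * C) * (2 * C) * (c * 4 `^ k).
have C20 : 0 <= C2 by rewrite /C2 !mulr_ge0 ?expR_ge0.
have C30 : 0 <= C3 by rewrite /C3 !mulr_ge0 ?powR_ge0.
exists (1 + C2 + C3); first by rewrite -addrA lerDl addr_ge0.
move=> d X /andP[d0 d1] X0 hX t; set s : R[i] := 1 +i* t.
have s1 : 1 <= Re s by rewrite /=.
have dJ0 : 0 <= d ^+ J by rewrite exprn_ge0 // ltW.
have dJ1 : d ^+ J <= 1 by rewrite exprn_ile1 // ltW.
set p := (nc (zeta s))^-1; have p0 : 0 <= p by rewrite invr_ge0 nc_ge0.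
have pE : p = nc (zeta s)^-1 by rewrite ncV.
set q := nc (smoothed_moebius d J X s); have q0 : 0 <= q by exact: nc_ge0.
have approx := smoothed_moebius_approx J d0 s1 X0.
have [tth|tth] := leP `|t| th.
  have hz j : nc (zeta (hstep s d j))^-1 <= C1.
    apply: hC1; last by rewrite Im_hstep.
    by rewrite Re_hstep lerDl mulr_ge0 // ltW.
  have pC : p <= C1 by rewrite pE -(hstep0 s d); exact: hz.
  have qB : q <= 2 ^+ J * C1 + 1.
    set W := fdn J _ 0 in approx.
    have hW : nc W <= 2 ^+ J * C1.
      by apply: nc_fdn_le => -[|j]; cbv beta; [rewrite eqxx nc0|exact: hz].
    rewrite /q; have -> : smoothed_moebius d J X s = (smoothed_moebius d J X s + (-1) ^+ J * W)
       - (-1) ^+ J * W by rewrite addrK.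
    apply: le_trans (ncB _ _) _; rewrite addrC; apply: lerD.
      by rewrite ncM ncX ncN nc1 expr1n mul1r.
    exact: le_trans approx (le_trans hX dJ1).
  have pB : p <= B by apply: le_trans pC _; rewrite /B addrAC lerDr addr_ge0 // mulr_ge0.
  have qB' : q <= B by apply: le_trans qB _; rewrite /B addrAC lerDl.
  have pq : `|p - q| <= B.
    by rewrite ler_norml; apply/andP; split; move: p0 q0 pB qB'; lra.
  have h := @sqr_diff_le p q B B _ q0 pq (lexx B).
  rewrite p0 pB in h; apply: le_trans (h isT) _.
  have ht : 1 <= expR 1 * expR (- t ^+ 2).
    rewrite -expRD -[X in X <= _](@expR0 R) ler_expR subr_ge0.
    rewrite -(real_normK (num_real t)) expr2; apply: mulr_ile1 => //; exact: le_trans th1.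
  apply: (@le_trans _ _ (C2 * expR (- t ^+ 2))).
    by rewrite /C2 -[X in _ <= X]mulrA ler_peMr // !mulr_ge0.
  rewrite mulrDr -[leLHS]addr0; apply: lerD; last by rewrite !mulr_ge0 // !addr_ge0.
  by rewrite ler_wpM2r ?expR_ge0 // addrAC lerDr addr_ge0.
(* An integer meeting the size condition of [zetaV_fdn] and at most (4 (1 + |t|))^2, so that powers
   of its logarithm become (1 + |t|)^k. *)
pose Z := ((Num.truncn (2 * `|t| + 2)).+1 ^ 2)%N.
have Z0 : (0 < Z)%N by rewrite /Z expn_gt0.
have tt0 : 0 <= 2 * `|t| + 2 by rewrite addr_ge0 // mulr_ge0.
have hZ : (2 * `|Im s| + 2) ^+ 2 <= Z%:R.
  rewrite /Z natrX lerXn2r ?nnegrE ?ler0n //= ltW //; exact: truncnS_gt.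
have hZ2 : Z%:R <= (4 * (1 + `|t|)) ^+ 2.
  rewrite /Z natrX lerXn2r ?nnegrE ?ler0n ?mulr_ge0 ?addr_ge0 //.
  rewrite -natr1; have := tt0; rewrite -truncn_le; have := normr_ge0 t.
  lra.
pose L : R := 1 + ln Z%:R.
have L1 : 1 <= L by rewrite lerDl ln_nat_ge0.
have s12 : 1 <= Re s <= 2 by rewrite /= lexx ler1n.
have d01 : 0 <= d <= 1 by rewrite d1 ltW.
have [h1 h2] := hA s d Z s12 d01 (ltW tth) Z0 hZ; rewrite -/L in h1 h2.
have LA1 : 1 <= L ^+ A by exact: exprn_ege1.
have CL1 : 1 <= C * L ^+ A by exact: mulr_ege1.
have CL0 : 0 <= C * L ^+ A by exact: le_trans CL1.
have pq : `|p - q| <= 2 * (C * L ^+ A) * d ^+ J.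
  have : nc ((zeta s)^-1 - smoothed_moebius d J X s) <= 2 * (C * L ^+ A) * d ^+ J.
    have := approx; rewrite fdn_delete0 hstep0; set V := fdn J _ 0 in h2 *.
    have -> : (-1) ^+ J * (V - (-1) ^+ J * (zeta s)^-1) = (-1) ^+ J * V - (zeta s)^-1.
      by rewrite mulrBr [X in _ - X]mulrA -expr2 sqrr_sign mul1r.
    move=> h.
    have -> : (zeta s)^-1 - smoothed_moebius d J X s
       = (-1) ^+ J * V - (smoothed_moebius d J X s + ((-1) ^+ J * V - (zeta s)^-1)).
      by set u := (-1) ^+ J * V; set v := _^-1; ring.
    apply: le_trans (ncB _ _) _; rewrite ncM ncX ncN nc1 expr1n mul1r.
    apply: le_trans (lerD h2 (le_trans h hX)) _.
    rewrite [C * _ * _]mulrAC -[X in _ + X]mul1r -mulrDl ler_wpM2r //.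
    by move: CL1; set u := C * _; lra.
  have hpq : `|p - q| <= nc ((zeta s)^-1 - smoothed_moebius d J X s).
    rewrite pE /q ler_norml nc_leB andbT lerNl opprB ncBC; exact: nc_leB.
  exact: le_trans hpq.
have pA : 0 <= p <= 2 * (C * L ^+ A).
  rewrite p0 /= pE; apply: le_trans h1 _.
  by move: CL0; set u := C * _; lra.
have eA : 2 * (C * L ^+ A) * d ^+ J <= 2 * (C * L ^+ A).
  by rewrite ler_piMr // mulr_ge0.
apply: le_trans (sqr_diff_le pA q0 pq eA) _.
have LL : L ^+ A * L ^+ A <= c * 4 `^ k * (1 + `|t|) `^ k.
  rewrite -exprD; apply: le_trans (hc Z%:R _) _; first by rewrite ler1n.
  rewrite -mulrA ler_wpM2l // -powRM ?addr_ge0 //.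
  have -> : (4 * (1 + `|t|)) `^ k = ((4 * (1 + `|t|)) ^+ 2) `^ (k / 2).
    rewrite -powR_mulrn ?mulr_ge0 ?addr_ge0 // -powRrM; congr (_ `^ _); by field.
  by apply: ge0_ler_powR; rewrite ?nnegrE ?ler0n ?exprn_ge0 ?mulr_ge0 ?addr_ge0 // ltW.
apply: (@le_trans _ _ (C3 * (d ^+ J * (1 + `|t|) `^ k))).
  have -> : 3 * (2 * (C * L ^+ A)) * (2 * (C * L ^+ A) * d ^+ J)
    = 3 * (2 * C) * (2 * C) * d ^+ J * (L ^+ A * L ^+ A).
    by move: (L ^+ A) (d ^+ J) => u v; ring.
  have -> : C3 * (d ^+ J * (1 + `|t|) `^ k)
    = 3 * (2 * C) * (2 * C) * d ^+ J * (c * 4 `^ k * (1 + `|t|) `^ k).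
    by rewrite /C3; move: (d ^+ J) (4 `^ k) ((1 + `|t|) `^ k) => u v w; ring.
  by rewrite ler_wpM2l // !mulr_ge0.
rewrite mulrDr -[leLHS]add0r; apply: lerD.
  by rewrite mulr_ge0 ?expR_ge0 // !addr_ge0.
by rewrite ler_wpM2r ?mulr_ge0 // lerDr addr_ge0.
Qed.

End SmoothedMoebius.

(** * The mean square *)

Section IntegralSandwich.
Variable R : realType.
Local Notation leb := (@lebesgue_measure R).

Lemma integral_mono (f g : R -> \bar R) :
  (forall t, (0 <= f t)%E) -> (forall t, (f t <= g t)%E) ->
  (\int[leb]_t f t <= \int[leb]_t g t)%E.
Proof.
move=> f0 fg; have g0 t : (0 <= g t)%E by exact: le_trans (f0 t) (fg t).
rewrite !ge0_integralTE //; apply: le_ereal_sup => _ [u uf <-].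
by exists u => // t; exact: le_trans (uf t) (fg t).
Qed.

(* No measurability of [f] is needed: the integral of a nonnegative function is
   a supremum over the simple functions below it. *)
Lemma integral_sandwich (f P E : R -> R) (p e : R) :
  (forall t, 0 <= f t) -> (forall t, `|f t - P t| <= E t) ->
  leb.-integrable [set: R] (EFin \o P) -> (\int[leb]_t (P t)%:E = p%:E)%E ->
  leb.-integrable [set: R] (EFin \o E) -> (\int[leb]_t (E t)%:E = e%:E)%E ->
  exists2 I : R, (\int[leb]_t (f t)%:E = I%:E)%E & `|I - p| <= e.
Proof.
move=> f0 fPE iP eP iE eE.
have up : (\int[leb]_t (f t)%:E <= (p + e)%:E)%E.
  rewrite EFinD -eP -eE -integralD //.
  apply: integral_mono => t; first by rewrite lee_fin.
  rewrite -EFinD lee_fin addrC -lerBlDr; exact: le_trans (ler_norm _) (fPE t).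
have lo : ((p - e)%:E <= \int[leb]_t (f t)%:E)%E.
  rewrite EFinB -eP -eE -integralB //.
  have iPE : leb.-integrable [set: R] (fun t => (P t)%:E - (E t)%:E)%E.
    exact: integrableB.
  (* P - E may be negative while [integral_mono] compares nonnegative functions; its positive part
     is still below f, because f >= 0. *)
  apply: (@le_trans _ _ (\int[leb]_t ((fun t => (P t)%:E - (E t)%:E)^\+ t))%E).
    by apply: le_integral => //; [exact: integrable_funepos|move=> t _; rewrite funeposE le_max lexx].
  apply: integral_mono => t; first by rewrite funeposE le_max lexx orbT.
  rewrite funeposE ge_max -EFinB !lee_fin f0 andbT.
  by move: (fPE t); rewrite ler_norml => /andP[h _]; move: h; lra.
have fin : (\int[leb]_t (f t)%:E)%E \is a fin_num.
  by rewrite fin_numElt (lt_le_trans _ lo) ?ltNyr // (le_lt_trans up) ?ltry.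
exists (fine (\int[leb]_t (f t)%:E)); first by rewrite fineK.
rewrite -(fineK fin) !lee_fin in up lo.
by rewrite ler_norml; apply/andP; split; move: up lo; lra.
Qed.

End IntegralSandwich.

(** * Gaussian majorants of the error *)

Section GaussianGrowth.
Variable R : realType.
Local Notation leb := (@lebesgue_measure R).

(** Writing t = T + M y gives 1 + |2t| <= 5 N (1 + |y|); the factor 1 + |y| <= 2 exp (y^2 / 2) is
    paid for by widening the Gaussian, whence 10 = 5 * 2. *)
Lemma gauss_powR_le (T M N k t : R) : `|T| <= N -> 0 < M <= N -> 1 <= N -> 0 <= k <= 1 ->
  gauss T M t * (1 + `|2 * t|) `^ k <= 10 * N `^ k * gauss T (M * Num.sqrt 2) t.
Proof.
move=> TN /andP[M0 MN] N1 /andP[k0 k1]; have N0 : 0 <= N by exact: le_trans N1.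
rewrite /gauss exprMn sqr_sqrtr ?ler0n //.
pose y := (t - T) / M; have yE : t - T = M * y by rewrite /y mulrC divfK ?gt_eqF.
have e1 : (t - T) ^+ 2 / M ^+ 2 = y ^+ 2 by rewrite /y expr_div_n.
have e2 : (t - T) ^+ 2 / (M ^+ 2 * 2) = y ^+ 2 / 2 by rewrite -e1 invfM mulrA.
rewrite e1 e2.
have y1 : 1 <= 1 + `|y| by rewrite lerDl.
have h1 : 1 + `|2 * t| <= 5 * N * (1 + `|y|).
  have : `|t| <= N + N * `|y|.
    have -> : t = T + M * y by rewrite -yE addrC subrK.
    apply: le_trans (ler_normD _ _) _; apply: lerD => //.
    by rewrite normrM gtr0_norm // ler_wpM2r.
  have -> : `|2 * t| = 2 * `|t| by rewrite normrM gtr0_norm.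
  have : 0 <= N * `|y| by rewrite mulr_ge0.
  have -> : 5 * N * (1 + `|y|) = 5 * N + 5 * (N * `|y|) by move: `|y| => u; ring.
  by move: (N * _) => u; move: N1; lra.
have h2 : 1 + `|y| <= 2 * expR (y ^+ 2 / 2).
  have := expR_ge1Dx (y ^+ 2 / 2); set u := expR _.
  have := sqr_ge0 (`|y| - 1); rewrite -(real_normK (num_real y)); nra.
have h3 : (1 + `|2 * t|) `^ k <= 5 * N `^ k * (1 + `|y|).
  apply: (@le_trans _ _ ((5 * N * (1 + `|y|)) `^ k)).
    by apply: ge0_ler_powR => //; rewrite nnegrE ?addr_ge0 ?mulr_ge0.
  rewrite !powRM ?mulr_ge0 //; apply: ler_pM; rewrite ?mulr_ge0 ?powR_ge0 //.
    apply: ler_wpM2r; rewrite ?powR_ge0 //.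
    by rewrite -[leRHS]powRr1 //; apply: ler_powR => //; rewrite ler1n.
  by rewrite -[leRHS]powRr1 //; apply: ler_powR.
apply: le_trans (ler_wpM2l (expR_ge0 _) (le_trans h3 (ler_wpM2l _ h2))) _.
  by rewrite mulr_ge0 ?powR_ge0.
have -> : expR (- (y ^+ 2 / 2)) = expR (- y ^+ 2) * expR (y ^+ 2 / 2).
  by rewrite -expRD; congr expR; field.
by apply: eqW; move: (N `^ k) (expR _) (expR _) => u v w; ring.
Qed.

(** A sum of Gaussians of known integral that dominates h times the error of [zeta_square_approx] at
    2t, with q in the place of d^J. The first one has width 1, so the range near the pole
    contributes independently of M. *)
Definition error_weight (T M N k q t : R) : R :=
  2 * gauss 0 1 t
  + q * (10 * N `^ k) * (gauss T (M * Num.sqrt 2) t + gauss (- T) (M * Num.sqrt 2) t).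

Lemma h_error_weight (T M N k q t : R) :
  `|T| <= N -> 0 < M <= N -> 1 <= N -> 0 <= k <= 1 -> 0 <= q ->
  h T M t * (expR (- (2 * t) ^+ 2) + q * (1 + `|2 * t|) `^ k) <= error_weight T M N k q t.
Proof.
move=> TN M0N N1 k01 q0; have /andP[M0 _] := M0N.
have hE : h T M t = gauss T M t + gauss (- T) M t by rewrite /h /gauss opprK.
rewrite mulrDr /error_weight; apply: lerD.
  apply: ler_pM; rewrite ?expR_ge0 //.
  - by rewrite hE addr_ge0 ?gauss_ge0.
  - rewrite hE -[2]/(1 + 1); apply: lerD; rewrite /gauss -[leRHS](@expR0 R) ler_expR;
      by rewrite oppr_le0 divr_ge0 ?sqr_ge0.
  - rewrite /gauss ler_expR subr0 expr1n divr1 lerN2 exprMn ler_peMl ?sqr_ge0 //.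
    by rewrite exprn_ege1 // ler1n.
rewrite mulrCA -mulrA ler_wpM2l // hE mulrDl mulrDr; apply: lerD.
  exact: gauss_powR_le.
by apply: gauss_powR_le; rewrite ?normrN.
Qed.

Lemma integral_error_weight (T M N k q : R) : 0 < M ->
  leb.-integrable [set: R] (EFin \o error_weight T M N k q) /\
  (\int[leb]_t (error_weight T M N k q t)%:E =
    (Num.sqrt pi * (2 + 20 * Num.sqrt 2 * (q * M) * N `^ k))%:E)%E.
Proof.
move=> M0; have M20 : 0 < M * Num.sqrt 2 by rewrite mulr_gt0 // sqrtr_gt0.
have [i0 e0] := @integral_gauss R 0 1 ltr01.
have [i1 e1] := @integral_gauss R T _ M20.
have [i2 e2] := @integral_gauss R (- T) _ M20.
have i12 := integrableD measurableT i1 i2.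
have i3 := integrableZl measurableT (q * (10 * N `^ k)) i12.
have i4 := integrableZl measurableT 2 i0.
have E : (fun t => (error_weight T M N k q t)%:E) =
  (fun t => 2%:E * (gauss 0 1 t)%:E + (q * (10 * N `^ k))%:E *
    ((gauss T (M * Num.sqrt 2) t)%:E + (gauss (- T) (M * Num.sqrt 2) t)%:E))%E.
  by [].
split; first by rewrite /comp E; exact: integrableD.
rewrite E integralD // !integralZl // integralD // e0 e1 e2.
by congr EFin; move: (N `^ k) (Num.sqrt pi) (Num.sqrt 2) => u v w; ring.
Qed.

End GaussianGrowth.

(** * Coefficient sums with the smoothed weight *)

Section SmoothedCoefficients.
Variable R : realType.
Variables (a : nat -> R) (N : R).
Hypothesis N1 : 1 <= N.
Implicit Types (c d k n J X Y : nat) (w : nat -> R).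

Let N0 : 0 <= N. Proof. exact: le_trans N1. Qed.

Definition moebius_weight w k : R := mu R k * w k / k%:R.

Lemma dirconv_moebius w c : (0 < c)%N ->
  c%:R * dirconv (bcoef a N) (moebius_weight w) c
  = \sum_(d <- divisors c) mu R (c %/ d)%N * w (c %/ d)%N * (d%:R * bcoef a N d).
Proof.
move=> c0; rewrite /dirconv mulr_sumr; apply: eq_big_seq => d.
rewrite -dvdn_divisors // => dc; have d0 := dvdn_gt0 c0 dc; set k := (c %/ d)%N.
have k0 : (0 < k)%N by rewrite divn_gt0 // dvdn_leq.
have -> : c%:R = d%:R * k%:R :> R by rewrite -natrM mulnC divnK.
have k0' : k%:R != 0 :> R by rewrite pnatr_eq0 -lt0n.
rewrite /moebius_weight; move: (k%:R : R) k0' (mu R k) (w k) (bcoef a N d) (d%:R : R).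
by move=> e e0 f g i j; field.
Qed.

Lemma sum_weighted_le (g v : nat -> R) c : (0 < c)%N ->
  (forall k, (0 < k)%N -> (k <= c)%N -> `|g k| <= v k) ->
  `|\sum_(d <- divisors c) g (c %/ d)%N * (d%:R * bcoef a N d)| <= weighted a N v c.
Proof.
move=> c0 gv; apply: le_trans (ler_norm_sum _ _ _) _; rewrite /weighted.
rewrite big_seq [leRHS]big_seq; apply: ler_sum => d; rewrite -dvdn_divisors // => dc.
have d0 := dvdn_gt0 c0 dc.
rewrite mulrC normrM normrM normr_nat ler_wpM2l ?mulr_ge0 //.
by apply: gv; [rewrite divn_gt0 // dvdn_leq|exact: leq_div].
Qed.

Lemma weightedZ (v : nat -> R) (r : R) c :
  weighted a N (fun k => r * v k) c = r * weighted a N v c.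
Proof.
by rewrite /weighted mulr_sumr; apply: eq_bigr => d _; rewrite mulrCA.
Qed.

Lemma weighted_ge0 (v : nat -> R) c : (0 < c)%N -> (forall k, (0 < k)%N -> 0 <= v k) ->
  0 <= weighted a N v c.
Proof.
move=> c0 v0; rewrite /weighted big_seq; apply: sumr_ge0 => d.
rewrite -dvdn_divisors // => dc; rewrite mulr_ge0 ?mulr_ge0 //; apply: v0.
by rewrite divn_gt0 ?(dvdn_gt0 c0 dc) // dvdn_leq.
Qed.

Variable tm : R.
Hypothesis htm : forall n, n \in dyadic N -> (tau n)%:R <= tm.

Let V := 2 * N * (tm ^+ 2 * normsq a N).

Let V0 : 0 <= V.
Proof.
apply: mulr_ge0; first exact: mulr_ge0.
by apply: mulr_ge0; rewrite ?sqr_ge0 //; apply: sumr_ge0 => n _; exact: sqr_ge0.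
Qed.

(** From w^2 <= w <= J k^{-dl} the sum over k becomes the series of tau at 1 + dl. The bound depends
    on neither X nor Y, which leaves the cut-off free. *)
Lemma dirconv_sqr_sum_le (dl : R) J X Y : 0 < dl ->
  \sum_(1 <= c < Y.+1) c%:R * dirconv (bcoef a N) (moebius_weight (smooth_cut dl J X)) c ^+ 2
  <= V * (J%:R * (1 + dl^-1) ^+ 2).
Proof.
move=> dl0; set w := smooth_cut dl J X.
have w01 k : (0 < k)%N -> 0 <= w k <= 1 by move=> k0; apply: smooth_cut_01 => //; exact: ltW.
apply: (@le_trans _ _ (\sum_(1 <= c < Y.+1) weighted a N w c ^+ 2 / c%:R)).
  rewrite big_nat [leRHS]big_nat; apply: ler_sum => c /andP[c0 _].
  have cp : 0 < c%:R :> R by rewrite ltr0n.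
  rewrite ler_pdivlMr // mulrAC -expr2 -exprMn dirconv_moebius //.
  rewrite -[leLHS]real_normK ?num_real //; apply: lerXn2r; rewrite ?nnegrE //.
    by apply: weighted_ge0 => // k k0; case/andP: (w01 k k0).
  apply: (@sum_weighted_le (fun k => mu R k * w k)) => // k k0 _.
  have /andP[wk0 _] := w01 k k0.
  by rewrite normrM (ger0_norm wk0) ler_piMl // norm_mu_le1.
apply: le_trans (weighted_sqr_sum a N1 w Y htm) _; rewrite -/V; apply: ler_wpM2l => //.
apply: le_trans (ler_wpM2l (ler0n _ J) (tau_series_le Y dl0)).
rewrite mulr_sumr big_nat [leRHS]big_nat; apply: ler_sum => k /andP[k0 _].
rewrite [leRHS]mulrCA ler_wpM2l //; have kp : 0 < k%:R :> R by rewrite ltr0n.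
have /andP[wk0 wk1] := w01 k k0.
rewrite ler_pdivrMr // opprD addrC powRD; last by rewrite lt0r_neq0 ?implybT.
rewrite -[- 1]/(- 1%:R) powR_invn //= expr1 -mulrA divfK ?lt0r_neq0 //.
apply: (@le_trans _ _ (w k)); first by rewrite expr2 ler_piMl.
by apply: smooth_cut_le => //; exact: ltW.
Qed.

(** The difference of squares is factored. The difference factor has weights O(cJ k^{1/2}), the sum
    factor weights at most 2; together they lose c^{1/2}, which the second factor 1/c of c^{-2} can
    afford. *)
Lemma dirconv_acoef_le (dl : R) J X (cJ : R) Y : 0 < dl -> 0 <= cJ ->
  (forall k, (0 < k)%N -> 1 - smooth_cut dl J X k <= cJ * k%:R `^ 2^-1) ->
  `|\sum_(1 <= c < Y.+1) dirconv (bcoef a N) (moebius_weight (smooth_cut dl J X)) c ^+ 2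
    - \sum_(1 <= c < Y.+1) (acoef a N c / c%:R) ^+ 2| <= 18 * cJ * V.
Proof.
move=> dl0 cJ0 hcJ; set w := smooth_cut dl J X.
have w01 k : (0 < k)%N -> 0 <= w k <= 1 by move=> k0; apply: smooth_cut_01 => //; exact: ltW.
(* The exponent 1/4 serves both factors: k^{1/2} <= c^{3/4} v(k) and 1 <= c^{1/4} v(k), with total
   loss exactly c, while v(k)^2 / k = k^{-3/2} sums against tau to at most 9. Hence 18 = 2 * 9. *)
pose v k : R := k%:R `^ (- 4^-1).
rewrite -sumrB; apply: le_trans (ler_norm_sum _ _ _) _.
apply: (@le_trans _ _ (2 * cJ * \sum_(1 <= c < Y.+1) weighted a N v c ^+ 2 / c%:R)).
  rewrite mulr_sumr big_nat [leRHS]big_nat; apply: ler_sum => c /andP[c0 _].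
  have cp : 0 < c%:R :> R by rewrite ltr0n.
  have kc k : (k <= c)%N -> k%:R <= c%:R :> R by rewrite ler_nat.
  set y := dirconv _ _ c; set A := acoef a N c.
  have h1 : `|A - c%:R * y| <= cJ * c%:R `^ (3 / 4) * weighted a N v c.
    rewrite /A /y dirconv_moebius // -sumrB -weightedZ.
    under eq_bigr do rewrite -mulrBl.
    apply: (@sum_weighted_le (fun k => mu R k - mu R k * w k)) => // k k0 kc'.
    have /andP[wk0 wk1] := w01 k k0.
    rewrite -[X in X - _]mulr1 -mulrBr normrM (@ger0_norm _ (1 - _)) ?subr_ge0 //.
    apply: (@le_trans _ _ (1 - w k)).
      by rewrite ler_piMl ?subr_ge0 // norm_mu_le1.
    apply: le_trans (hcJ k k0) _; rewrite -mulrA ler_wpM2l //.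
    have -> : k%:R `^ 2^-1 = k%:R `^ (3 / 4) * v k.
      rewrite /v -powRD; last by rewrite pnatr_eq0 -lt0n k0 implybT.
      by congr (_ `^ _); field.
    rewrite ler_wpM2r ?powR_ge0 //; apply: ge0_ler_powR; rewrite ?nnegrE //.
    exact: kc.
  have h2 : `|A + c%:R * y| <= 2 * c%:R `^ 4^-1 * weighted a N v c.
    rewrite /A /y dirconv_moebius // -big_split /= -weightedZ.
    under eq_bigr do rewrite -mulrDl.
    apply: (@sum_weighted_le (fun k => mu R k + mu R k * w k)) => // k k0 kc'.
    have /andP[wk0 wk1] := w01 k k0.
    rewrite -[X in X + _]mulr1 -mulrDr normrM (@ger0_norm _ (1 + _)) ?addr_ge0 //.
    apply: (@le_trans _ _ 2).
      apply: (@le_trans _ _ (1 + w k)); last by rewrite -[2]/(1 + 1) lerD2l.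
      by rewrite ler_piMl ?addr_ge0 // norm_mu_le1.
    rewrite -mulrA ler_peMr //.
    rewrite [leLHS](_ : 1 = k%:R `^ 4^-1 * v k); last first.
      rewrite /v -powRD; last by rewrite pnatr_eq0 -lt0n k0 implybT.
      by rewrite subrr powRr0.
    rewrite ler_wpM2r ?powR_ge0 //; apply: ge0_ler_powR; rewrite ?nnegrE //.
    exact: kc.
  have -> : y ^+ 2 - (A / c%:R) ^+ 2 = - ((A - c%:R * y) * (A + c%:R * y)) / c%:R ^+ 2.
    by have := lt0r_neq0 cp; move: (c%:R : R) => r r0; field.
  rewrite normrM normrN normrM [X in _ * X]ger0_norm ?invr_ge0 ?sqr_ge0 //.
  rewrite ler_pdivrMr ?exprn_gt0 //.
  apply: le_trans (ler_pM (normr_ge0 _) (normr_ge0 _) h1 h2) _.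
  have cc : c%:R `^ (3 / 4) * c%:R `^ 4^-1 = c%:R :> R.
    rewrite -powRD; last by rewrite lt0r_neq0 ?implybT.
    have -> : 3 / 4 + 4^-1 = 1 :> R by field.
    by rewrite powRr1 // ltW.
  apply: eqW; move: cc (lt0r_neq0 cp).
  set p := c%:R `^ (3 / 4); set q := c%:R `^ 4^-1; set u := weighted _ _ _ _.
  move: p q u (c%:R : R) => p q u r pq r0.
  have -> : cJ * p * u * (2 * q * u) = 2 * cJ * u ^+ 2 * (p * q) by ring.
  by rewrite pq; field.
have -> : 18 * cJ * V = 2 * cJ * (V * 9) by ring.
apply: ler_wpM2l; first by rewrite mulr_ge0.
apply: le_trans (weighted_sqr_sum a N1 v Y htm) _; rewrite -/V; apply: ler_wpM2l => //.
have h2 : 0 < 2^-1 :> R by rewrite invr_gt0.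
have -> : 9 = (1 + 2^-1^-1) ^+ 2 :> R by rewrite invrK; ring.
apply: le_trans (tau_series_le Y h2).
rewrite big_nat [leRHS]big_nat; apply: ler_sum => k /andP[k0 _].
have kp : 0 < k%:R :> R by rewrite ltr0n.
rewrite ler_wpM2l // ler_pdivrMr // /v -powR_mulrn ?powR_ge0 // -powRrM.
rewrite -[X in _ <= _ * X]powRr1 ?(ltW kp) // -powRD; last by rewrite lt0r_neq0 ?implybT.
by apply: ler_powR; rewrite ?ler1n //; lra.
Qed.

Lemma nc_sigma_sum_le (t : R) :
  nc (\sum_(n <- dyadic N) (a n)%:C * divsigma (0 +i* t) n) ^+ 2 <= V.
Proof.
have hF : nc (\sum_(n <- dyadic N) (a n)%:C * divsigma (0 +i* t) n)
    <= \sum_(n <- dyadic N) `|a n| * tm.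
  apply: le_trans (nc_sum _ _ _) _; rewrite big_seq [leRHS]big_seq.
  apply: ler_sum => n nS; rewrite ncM nc_real ler_wpM2l //.
  apply: le_trans (htm nS); apply: le_trans (nc_sum _ _ _) _.
  rewrite /tau -sum1_size natr_sum; apply: ler_sum => d _.
  by rewrite -[natpow _ _]/(cpow d%:R _) nc_cpow /= mul0r expR0.
apply: (@le_trans _ _ ((\sum_(n <- dyadic N) `|a n| * tm) ^+ 2)).
  apply: lerXn2r; rewrite ?nnegrE ?nc_ge0 //; exact: le_trans (nc_ge0 _) hF.
apply: le_trans (sqr_sum_le _ _) _; rewrite /V; apply: ler_pM; rewrite ?ler0n //.
- by apply: sumr_ge0 => n _; exact: sqr_ge0.
- exact: size_dyadic_le.
rewrite /normsq mulr_sumr; apply: ler_sum => n _.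
by rewrite exprMn real_normK ?num_real // mulrC.
Qed.

(** The Moebius sum carries k^{-it}, the divisor sums d^{it}. The coefficients are real, so
    conjugation changes the sign of t without affecting the modulus, and the two polynomials can be
    multiplied. *)
Lemma smoothed_moebius_dirpoly (dl : R) J X (t : R) :
  nc (smoothed_moebius dl J X (1 +i* t)) ^+ 2
  = nc (dirpoly (moebius_weight (smooth_cut dl J X)) X (0 +i* t)) ^+ 2.
Proof.
have -> : smoothed_moebius dl J X (1 +i* t)
  = dirpoly (moebius_weight (smooth_cut dl J X)) X (0 +i* (- t)).
  apply: eq_big_nat => k /andP[k0 _]; have kp : 0 < k%:R :> R by rewrite ltr0n.
  have -> : - (1 +i* t) = (-1)%:C + (0 +i* (- t)) :> R[i].
    by apply/eqP; rewrite eq_complex /= addr0 add0r !eqxx.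
  rewrite cpowD cpow_real // /moebius_weight [in RHS]rmorphM mulrA -rmorphM /=.
  rewrite -[- 1]/(- 1%:R) powR_invn ?(ltW kp) //.
  by rewrite -[in LHS]rmorphM.
rewrite !dirpoly_sqr; apply: eq_bigr => c _; apply: eq_bigr => c' _.
by rewrite mulNr cosN.
Qed.

End SmoothedCoefficients.

(** * The Eisenstein integral against the sum of squares *)

Section MeanSquare.
Variable R : realType.
Local Notation leb := (@lebesgue_measure R).
Variables (a : nat -> R) (N tm : R).
Hypothesis N1 : 1 <= N.
Hypothesis htm : forall n, n \in dyadic N -> (tau n)%:R <= tm.

Let V := 2 * N * (tm ^+ 2 * normsq a N).

Let V0 : 0 <= V.
Proof. exact: le_trans (sqr_ge0 _) (nc_sigma_sum_le a N1 htm 0). Qed.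

Variables (T M k dl C : R) (J X Y : nat).
Hypotheses (M1N : 1 <= M <= N) (TN : `|T| <= N) (k01 : 0 <= k <= 1).
Hypotheses (dl0 : 0 < dl) (C0 : 0 <= C) (X0 : (0 < X)%N).
Hypothesis hz : forall t : R,
  `| (nc (zeta (1 +i* t)))^-1 ^+ 2 - nc (smoothed_moebius dl J X (1 +i* t)) ^+ 2 |
  <= C * (expR (- t ^+ 2) + dl ^+ J * (1 + `|t|) `^ k).
Hypothesis XY : (Num.truncn (2 * N) * X <= Y)%N.

Let integrand t := h T M t / nc (zeta (1 +i* (2 * t))) ^+ 2
  * nc (\sum_(n <- dyadic N) (a n)%:C * divsigma (0 +i* (2 * t)) n) ^+ 2.

Lemma mean_square_smoothed :
  exists2 I : R,
    (\int[leb]_t (integrand t)%:E = I%:E)%E &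
    `|I - 2 * (Num.sqrt pi * M) * \sum_(1 <= c < Y.+1)
         dirconv (bcoef a N) (moebius_weight (smooth_cut dl J X)) c ^+ 2|
    <= 8 * Num.sqrt pi * (1 + 2 * expR 2) * (V * (J%:R * (1 + dl^-1) ^+ 2))
       + V * C * (Num.sqrt pi * (2 + 20 * Num.sqrt 2 * (dl ^+ J * M) * N `^ k)).
Proof.
have /andP[M1 MN] := M1N.
have M0 : 0 < M by exact: lt_le_trans M1.
set x := dirconv _ _.
have [P [iP [eP hP]]] := h_dirpoly_diagonal T x Y M1.
have [iE eE] := integral_error_weight T N k (dl ^+ J) M0.
have D0 : (0 < Num.truncn (2 * N))%N.
  by rewrite truncn_ge_nat; move: N1; lra.
(* The divisor sum times the smoothed inverse of zeta is a single Dirichlet polynomial, the form to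
   which the Gaussian mean square applies. *)
have factor t : nc (dirpoly x Y (0 +i* t)) ^+ 2 =
    nc (\sum_(n <- dyadic N) (a n)%:C * divsigma (0 +i* t) n) ^+ 2
    * nc (smoothed_moebius dl J X (1 +i* t)) ^+ 2.
  rewrite smoothed_moebius_dirpoly divsigma_dirpoly // -exprMn -ncM.
  rewrite (dirpolyM _ D0 X0 XY) //; first exact: bcoef_eq0.
  by move=> i Xi; rewrite /moebius_weight /smooth_cut leqNgt Xi mulr0 mul0r.
pose E t := V * C * error_weight T M N k (dl ^+ J) t.
have h0 t : 0 <= h T M t by rewrite /h addr_ge0 // expR_ge0.
have [||||||I eI hI] := @integral_sandwich R integrand
   (fun t => h T M t * nc (dirpoly x Y (0 +i* (2 * t))) ^+ 2) E P
   (V * C * (Num.sqrt pi * (2 + 20 * Num.sqrt 2 * (dl ^+ J * M) * N `^ k))) => //.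
- by move=> t; rewrite /integrand mulr_ge0 ?sqr_ge0 // divr_ge0 ?sqr_ge0.
- move=> t; rewrite /integrand factor -exprVn.
  set F := nc (\sum_(n <- _) _) ^+ 2; set z := _^-1 ^+ 2; set s := nc _ ^+ 2.
  have F0 : 0 <= F by exact: sqr_ge0.
  have FV : F <= V by exact: nc_sigma_sum_le.
  have -> : h T M t * z * F - h T M t * (F * s) = h T M t * (F * (z - s)) by ring.
  rewrite normrM (ger0_norm (h0 t)) normrM (ger0_norm F0) /E.
  have hF := ler_pM F0 (normr_ge0 _) FV (hz (2 * t)).
  apply: le_trans (ler_wpM2l (h0 t) hF) _.
  rewrite [V * (C * _)]mulrA mulrCA (ler_wpM2l (mulr_ge0 V0 C0)) //.
  by apply: h_error_weight => //; rewrite ?M0 // exprn_ge0 // ltW.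
- exact: (integrableZl measurableT (V * C) iE).
- by rewrite EFinM -eE -integralZl.
exists I; first exact: eI.
set Q := 2 * _ * _ in hP *; have -> : I - Q = (P - Q) + (I - P) by ring.
apply: le_trans (ler_normD _ _) _; apply: lerD => //.
apply: le_trans hP _; apply: ler_wpM2l.
  by rewrite mulr_ge0 ?mulr_ge0 ?sqrtr_ge0 // addr_ge0 // mulr_ge0 // expR_ge0.
exact: dirconv_sqr_sum_le.
Qed.

(** The condition d^J M <= 1 absorbs the factor M twice: in the integrated error of the zeta
    approximation, where 40 = 20 * 2 bounds 20 sqrt 2, and in M times the bound of
    [dirconv_acoef_le], where 36 = 2 * 18. *)
Lemma mean_square_acoef (cJ : R) :
  0 <= cJ ->
  (forall i, (0 < i)%N -> 1 - smooth_cut dl J X i <= cJ * dl ^+ J * i%:R `^ 2^-1) ->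
  dl ^+ J * M <= 1 ->
  exists2 I : R,
    (\int[leb]_t (integrand t)%:E = I%:E)%E &
    `|I - 2 * Num.sqrt pi * (M * \sum_(1 <= c < Y.+1) (acoef a N c / c%:R) ^+ 2)|
    <= Num.sqrt pi * V * (8 * (1 + 2 * expR 2) * (J%:R * (1 + dl^-1) ^+ 2)
         + C * (2 + 40 * N `^ k) + 36 * cJ).
Proof.
move=> cJ0 hcJ dM; have [I eI hI] := mean_square_smoothed.
exists I => //; have /andP[M1 MN] := M1N; have M0 : 0 <= M by exact: le_trans M1.
have dJ0 : 0 <= dl ^+ J by rewrite exprn_ge0 // ltW.
have p0 : 0 <= Num.sqrt pi :> R by exact: sqrtr_ge0.
have hA := dirconv_acoef_le a N1 htm Y dl0 (mulr_ge0 cJ0 dJ0) hcJ; rewrite -/V in hA.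
set x := \sum_(1 <= c < _) _ in hI hA; set A := \sum_(1 <= c < _) _ in hA *.
have -> : I - 2 * Num.sqrt pi * (M * A)
  = (I - 2 * (Num.sqrt pi * M) * x) + 2 * (Num.sqrt pi * M) * (x - A).
  by move: (Num.sqrt pi) => u; ring.
apply: le_trans (ler_normD _ _) _.
rewrite [X in _ + X]normrM ger0_norm ?mulr_ge0 //.
have hA' : 2 * (Num.sqrt pi * M) * `|x - A| <= 36 * cJ * (Num.sqrt pi * V).
  apply: le_trans (ler_wpM2l _ hA) _; first by rewrite !mulr_ge0.
  have -> : 2 * (Num.sqrt pi * M) * (18 * (cJ * dl ^+ J) * V)
    = 36 * cJ * (Num.sqrt pi * V) * (dl ^+ J * M).
    by move: (dl ^+ J) (Num.sqrt pi) => u v; ring.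
  by rewrite ler_piMr // (mulr_ge0 (mulr_ge0 _ cJ0) (mulr_ge0 p0 V0)).
apply: le_trans (lerD hI hA') _.
have s2 : Num.sqrt 2 <= 2 :> R.
  rewrite -[leRHS](@ger0_norm R) // -sqrtr_sqr ler_wsqrtr // ler_eXnr //; exact: ler1n.
have hE : 20 * Num.sqrt 2 * (dl ^+ J * M) * N `^ k <= 40 * N `^ k.
  rewrite ler_wpM2r ?powR_ge0 //.
  have -> : 40 = 20 * 2 * 1 :> R by ring.
  by apply: ler_pM; rewrite ?mulr_ge0 ?sqrtr_ge0 // ler_wpM2l.
have hE' : V * C * (Num.sqrt pi * (2 + 20 * Num.sqrt 2 * (dl ^+ J * M) * N `^ k))
   <= Num.sqrt pi * V * (C * (2 + 40 * N `^ k)).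
  have -> : V * C * (Num.sqrt pi * (2 + 20 * Num.sqrt 2 * (dl ^+ J * M) * N `^ k))
    = Num.sqrt pi * V * (C * (2 + 20 * Num.sqrt 2 * (dl ^+ J * M) * N `^ k)).
    by move: (Num.sqrt pi) (_ * N `^ k) => u v; ring.
  by rewrite (ler_wpM2l (mulr_ge0 p0 V0)) // ler_wpM2l // lerD2l.
apply: le_trans (lerD (lerD (lexx _) hE') (lexx _)) _.
apply: eqW.
by move: (Num.sqrt pi) (C * _) (expR 2) (_ ^+ 2) => u v w z; ring.
Qed.

End MeanSquare.

(** * Choice of the parameters *)

Section Truncation.
Variable R : realType.

(** The first condition keeps the Moebius tail below the smoothing error d^J, the second is the
    hypothesis of [onem_smooth_cut_le]. Both hold for large X, and no upper bound on X is
    recorded. *)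
Lemma exists_cutoff (d : R) (J : nat) : 0 < d -> exists2 X : nat, (0 < X)%N &
  2 ^+ J * (d^-1 * X%:R `^ (- d)) <= d ^+ J /\ 1 <= d ^+ J * X%:R `^ 2^-1.
Proof.
move=> d0; have dJ : 0 < d ^+ J by rewrite exprn_gt0.
have h2 : 0 < 2^-1 :> R by rewrite invr_gt0.
pose e := d ^+ J * (d / 2 ^+ J); have e0 : 0 < e by rewrite mulr_gt0 // divr_gt0 // exprn_gt0.
have near1 : \forall n \near \oo, n%:R `^ (- d) < e.
  have := cvg_natpowN d0 => /cvgrPdist_lt /(_ _ e0); apply: filterS => n.
  by rewrite sub0r normrN ger0_norm // powR_ge0.
have near2 : \forall n \near \oo, n%:R `^ (- 2^-1) < d ^+ J.
  have := cvg_natpowN h2 => /cvgrPdist_lt /(_ _ dJ); apply: filterS => n.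
  by rewrite sub0r normrN ger0_norm // powR_ge0.
have [X [[X0 h1] hX]] := filter_ex (filterI (filterI (nbhs_infty_gt 0) near1) near2).
exists X => //; split.
  have -> : d ^+ J = 2 ^+ J * (d^-1 * e).
    have := lt0r_neq0 d0; have : 2 ^+ J != 0 :> R by rewrite expf_neq0.
    by rewrite /e; move: (d ^+ J) (2 ^+ J) => u v v0 d1; field; apply/andP; split.
  by rewrite !ler_wpM2l ?exprn_ge0 ?invr_ge0 ?(ltW d0) // ltW.
have Xp : 0 < X%:R `^ 2^-1 :> R by apply: powR_gt0; rewrite ltr0n.
by rewrite -ler_pdivrMr // div1r -powRN ltW.
Qed.

End Truncation.

Theorem proposition4 (R : realType) (eps : R) (heps : 0 < eps) :
  exists2 C : R, 0 < C &
  forall (M T N : R) (a : nat -> R),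
    1 <= M -> 1 <= T -> 1 <= N ->
    N `^ eps <= M -> M <= T -> T < N ->
    (forall n : nat, ~~ (N < n%:R <= 2 * N) -> a n = 0) ->
    (`| eisenstein a N T M - (2 / Num.sqrt pi * Sigma_form a N M)%:E |
       <= (C * (N `^ (1 + eps) * normsq a N))%:E)%E.
Proof.
(* u = N^k enters to the fourth power: squared through the divisor bound and squared through (1 +
   1/d)^2 with 1/d = u. The minimum with 1 keeps k <= 1 for [gauss_powR_le]. *)
pose k : R := Num.min eps 1 / 4.
have k0 : 0 < k by rewrite divr_gt0 // lt_min heps ltr01.
have k4e : k *+ 4 <= eps by rewrite -mulr_natr /k divfK // ge_min lexx.
have k1 : k <= 1.
  have : Num.min eps 1 <= 1 by rewrite ge_min lexx orbT.
  by rewrite /k; lra.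
pose J := (Num.truncn k^-1).+1.
have Jk : 1 <= J%:R * k by rewrite -ler_pdivrMr // div1r ltW // truncnS_gt.
have [Ct Ct1 hCt] := tau_le_powR k0.
have [cJ cJ1 hcJ] := @onem_smooth_cut_le R J.
have [C C1 hC] := zeta_square_approx J k0.
have Ct0 : 0 < Ct by exact: lt_le_trans Ct1.
have cJ0 : 0 < cJ by exact: lt_le_trans cJ1.
have C0 : 0 < C by exact: lt_le_trans C1.
(* 32 = 8 * 4 uses (1 + u)^2 <= 4 u^2, and 42 = 2 + 40 uses 1 <= u <= u^2. *)
pose K := 32 * (1 + 2 * expR 2) * J%:R + 42 * C + 36 * cJ.
have E0 : 0 <= 1 + 2 * expR 2 :> R by rewrite addr_ge0 // mulr_ge0 // expR_ge0.
have K0 : 0 < K by rewrite /K ltr_wpDl ?mulr_gt0 // addr_ge0 ?mulr_ge0 // ltW.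
(* 8 = 2 * 4: the factor 2N in V, and (2^k)^2 <= 4 from the divisor bound at 2N. *)
exists (8 * Ct ^+ 2 * K); first by rewrite !mulr_gt0 // exprn_gt0.
move=> M T N a M1 T1 N1 _ MT TN _.
have N0 : 0 < N by exact: lt_le_trans N1.
have MN : 1 <= M <= N by rewrite M1 (le_trans MT) // ltW.
have TN' : `|T| <= N by rewrite ger0_norm ?(ltW TN) // (le_trans ler01).
pose u := N `^ k; have u0 : 0 < u by exact: powR_gt0.
have u1 : 1 <= u by rewrite -(powRr0 N) ler_powR // ltW.
pose d := u^-1; have d0 : 0 < d by rewrite invr_gt0.
have d01 : 0 < d <= 1 by rewrite d0 invf_le1.
have dM : d ^+ J * M <= 1.
  rewrite exprVn mulrC ler_pdivrMr ?exprn_gt0 // mul1r.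
  apply: le_trans (_ : N <= _); first by case/andP: MN.
  rewrite -powR_mulrn ?(ltW u0) // -powRrM -[leLHS]powRr1 ?(ltW N0) //.
  by apply: ler_powR; rewrite // mulrC.
pose tm := Ct * (2 * N) `^ k.
have htm n : n \in dyadic N -> (tau n)%:R <= tm.
  move=> nS; have /andP[n0 _] := dyadic_bounds N1 nS.
  apply: le_trans (hCt n n0) _; rewrite ler_wpM2l ?(ltW Ct0) //.
  apply: ge0_ler_powR; rewrite ?nnegrE ?(ltW k0) // ?mulr_ge0 ?(ltW N0) //.
  by move: nS; rewrite mem_dyadic => /andP[].
have [X X0 [hX hX2]] := exists_cutoff J d0.
have hz := hC d X d01 X0 hX.
have cJ0' := ltW cJ0.
have k01 : 0 <= k <= 1 by rewrite (ltW k0).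
have main Y XY := mean_square_acoef a N1 htm MN TN' k01 d0 (ltW C0) X0 hz
  (XY : (Num.truncn (2 * N) * X <= Y)%N) cJ0' (hcJ d X d0 hX2) dM.
have [I eI _] := main _ (leqnn _).
set B := Num.sqrt pi * _ * _ in main.
(* [main] names an I for every Y, but each equals the same integral, and the bound B does not
   involve Y; letting Y tend to infinity replaces the partial sums by [Sigma_form]. *)
have hI : `|I - 2 * Num.sqrt pi * Sigma_form a N M| <= B.
  have cv : (fun Y => `|I - 2 * Num.sqrt pi *
        (M * \sum_(1 <= c < Y.+1) (acoef a N c / c%:R) ^+ 2)|) @ \oo
      --> `|I - 2 * Num.sqrt pi * Sigma_form a N M|.
    apply: cvg_norm; apply: cvgB; first exact: cvg_cst.
    by apply: cvgM; [exact: cvg_cst|exact: Sigma_form_cvg].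
  apply: (cvgr_to_le cv).
  exists (Num.truncn (2 * N) * X)%N => // Y XY.
  by have [I' eI' hI'] := main Y XY; move: hI'; move: eI'; rewrite eI => -[<-].
have s0 : 0 < Num.sqrt pi :> R by rewrite sqrtr_gt0 pi_gt0.
have s2 : pi = Num.sqrt pi ^+ 2 :> R by rewrite sqr_sqrtr // pi_ge0.
(* Dividing by pi leaves a spare factor sqrt(pi) >= 1 on the side of the bound, dropped in the last
   line. *)
have s1 : 1 <= Num.sqrt pi :> R.
  rewrite -[leLHS]sqrtr1 ler_wsqrtr //; apply: le_trans (pi_ge2 R); exact: ler1n.
have nn : 0 <= normsq a N by apply: sumr_ge0 => n _; exact: sqr_ge0.
rewrite /eisenstein eI -EFinM -EFinB /= lee_fin.
have -> : pi^-1 * I - 2 / Num.sqrt pi * Sigma_form a N M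
  = (I - 2 * Num.sqrt pi * Sigma_form a N M) / pi.
  move: s2 (lt0r_neq0 s0); move: (Num.sqrt pi) (Sigma_form a N M) => s S -> sn.
  by field.
rewrite normrM normfV (gtr0_norm (pi_gt0 R)) ler_pdivrMr ?pi_gt0 //.
apply: le_trans hI _; rewrite /B [X in _ <= _ * X]s2 (expr2 (Num.sqrt pi)) -[leLHS]mulrA [leRHS]mulrCA.
rewrite ler_wpM2l ?(ltW s0) //.
set V := 2 * N * _; set W := _ + 36 * cJ.
have hV : V <= 8 * Ct ^+ 2 * N * normsq a N * u ^+ 2.
  have k2 : 2 `^ k <= 2 :> R by rewrite -[leRHS]powRr1 // ler_powR // ler1n.
  have k2' : (2 `^ k) ^+ 2 <= 4 :> R.
    by rewrite (_ : 4 = 2 ^+ 2) ?lerXn2r ?nnegrE ?powR_ge0 //; ring.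
  rewrite /V /tm powRM ?(ltW N0) // -/u.
  have -> : 2 * N * ((Ct * (2 `^ k * u)) ^+ 2 * normsq a N)
    = 2 * Ct ^+ 2 * N * normsq a N * u ^+ 2 * (2 `^ k) ^+ 2.
    by move: (2 `^ k) => p; ring.
  have -> : 8 * Ct ^+ 2 * N * normsq a N * u ^+ 2
    = 2 * Ct ^+ 2 * N * normsq a N * u ^+ 2 * 4 by ring.
  apply: ler_wpM2l => //; apply: mulr_ge0; last exact: sqr_ge0.
  by apply: mulr_ge0 => //; apply: mulr_ge0; [apply: mulr_ge0; rewrite ?sqr_ge0|exact: ltW].
have uu : u <= u ^+ 2 by rewrite expr2 ler_peMr // ltW.
have hW : W <= K * u ^+ 2.
  rewrite /W /K /d invrK -/u 2!(mulrDl _ _ (u ^+ 2)); apply: lerD; first apply: lerD.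
  - have h4 : (1 + u) ^+ 2 <= 4 * u ^+ 2.
      rewrite (_ : 4 * u ^+ 2 = (u + u) ^+ 2); last ring.
      by apply: lerXn2r; rewrite ?nnegrE ?addr_ge0 ?(ltW u0) // lerD2r.
    rewrite (_ : 32 * _ * _ * _ = 8 * (1 + 2 * expR 2) * (J%:R * (4 * u ^+ 2))).
      by apply: ler_wpM2l; [exact: mulr_ge0|rewrite ler_wpM2l].
    by move: (expR 2) (J%:R : R) => p q; ring.
  - rewrite [42 * C]mulrC -[_ * 42 * _]mulrA ler_wpM2l ?(ltW C0) //.
    by move: uu u1; lra.
  - by rewrite ler_peMr ?mulr_ge0 // exprn_ege1.
have V0 : 0 <= V by apply: mulr_ge0; [rewrite mulr_ge0 // ltW|rewrite mulr_ge0 // sqr_ge0].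
have W0 : 0 <= W.
  have u00 := ltW u0; have d00 := ltW d0; have C00 := ltW C0.
  apply: addr_ge0; last exact: mulr_ge0.
  apply: addr_ge0.
    by apply: mulr_ge0; [exact: mulr_ge0|apply: mulr_ge0 => //; exact: sqr_ge0].
  by apply: mulr_ge0 => //; apply: addr_ge0 => //; exact: mulr_ge0.
apply: le_trans (ler_pM V0 W0 hV hW) _.
have -> : 8 * Ct ^+ 2 * N * normsq a N * u ^+ 2 * (K * u ^+ 2)
  = 8 * Ct ^+ 2 * K * (N * u ^+ 4 * normsq a N).
  by ring.
have KK : 0 <= 8 * Ct ^+ 2 * K by rewrite mulr_ge0 ?(ltW K0) // mulr_ge0 // sqr_ge0.
have uN : N * u ^+ 4 <= N `^ (1 + eps).
  rewrite powRD ?lt0r_neq0 ?implybT // powRr1 ?(ltW N0) // ler_pM2l //.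
  rewrite /u -powR_mulrn ?powR_ge0 // -powRrM mulr_natr.
  exact: ler_powR.
apply: le_trans (ler_wpM2l KK (ler_wpM2r nn uN)) _.
by rewrite ler_peMr // mulr_ge0 // mulr_ge0 // powR_ge0.
Qed.
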